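(* Let $\ell>0$, $\rho,I_\rho>0$, $\alpha,\beta,\gamma,\delta>0$, $K,EI\in\mathcal A$, $\mu=\max\{\mu_K,\mu_{EI}\}$, with either $\mu_K,\mu_{EI}\in[0,1)$ or $\mu_K,\mu_{EI}\in[1,2)$. Assume $\mu+2C_h<2$. Consider the Timoshenko system with boundary feedback $$K(\ell)(w_x+\psi)(t,\ell)+\gamma w(t,\ell)=-\alpha w_t(t,\ell),\qquad EI(\ell)\psi_x(t,\ell)+\delta\psi(t,\ell)=-\beta\psi_t(t,\ell),\qquad t>0.$$ Then there are positive constants $\eta_{11},\eta_{12},\eta_{21},\eta_{22}$, depending only on $\ell,\rho,I_\rho,K,EI,\alpha,\beta,\gamma,\delta$, such that, with $$\omega:=\frac{2-\mu-C_h}{2\max\{\eta_{21},\eta_{22}\}\left(1+2\max\{\frac{\alpha}{\gamma^3},\frac{\beta}{\delta^3}\}\right)},$$ $$\tilde C(\omega):=\frac1\omega\max\{\eta_{21},\eta_{22}\}(1+C'')+2\max\{\eta_{21},\eta_{22}\}C'''+\max\{\eta_{11},\eta_{12}\}+2\left(2C_F+\frac\mu2C_{NL}\right),\qquad \kappa:=\frac{2-\mu-C_h}{2\tilde C(\omega)},$$ every finite energy solution of the feedback system satisfies $$E_{\gamma,\delta}(t)\le E_{\gamma,\delta}(0)\,e^{1-\kappa t}\qquad\text{for all } t\ge\frac1\kappa .$$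
   Context: **Class $\mathcal A$.** $a\in C([0,\ell])\cap C^1((0,\ell])$ belongs to $\mathcal A$ if $a>0$ on $(0,\ell]$, $a(0)=0$, $\mu_a:=\sup_{0<x\le\ell}\frac{x|a'(x)|}{a(x)}<2$, and $a\in C^{[\mu_a]}([0,\ell])$, where $[\cdot]$ is the integer part. $EI$ is a single function symbol. **System.** On $(0,\infty)\times(0,\ell)$: $\rho w_{tt}-(K(w_x+\psi))_x=0$, $I_\rho\psi_{tt}-(EI\psi_x)_x+K(w_x+\psi)=0$; at $x=0$: $w(t,0)=\psi(t,0)=0$ if $\mu_K,\mu_{EI}\in[0,1)$, and $\lim_{x\to0^+}K(w_x+\psi)(t,x)=\lim_{x\to0^+}EI\psi_x(t,x)=0$ if $\mu_K,\mu_{EI}\in[1,2)$; at $x=\ell$ the feedback conditions of the claim; initial data $(w,\psi)(0)=(w^0,\psi^0)\in\mathcal V_R$, $(w_t,\psi_t)(0)=(w^1,\psi^1)\in L^2(0,\ell)^2$. Here $V^1_{K,EI}(0,\ell)$ is the space of pairs $(w,\psi)\in L^2(0,\ell)^2$, locally absolutely continuous on $(0,\ell]$, with $\sqrt K(w'+\psi),\sqrt{EI}\psi'\in L^2(0,\ell)$, and $\mathcal V_R=\{(v,\phi)\in V^1_{K,EI}:v(0)=\phi(0)=0\}$ in the weakly degenerate case ($\mu_K,\mu_{EI}<1$), $\mathcal V_R=V^1_{K,EI}$ in the strongly degenerate case. Finite energy solutions are the mild (semigroup) solutions in $C([0,\infty);\mathcal V_R)\cap C^1([0,\infty);L^2(0,\ell)^2)$.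 **Energy.** $E_{\gamma,\delta}(t)=\frac12\left[\int_0^\ell[\rho w_t^2+I_\rho\psi_t^2+K(w_x+\psi)^2+EI\psi_x^2]dx+\gamma w^2(t,\ell)+\delta\psi^2(t,\ell)\right]$. **Constants.** $C_h=\max\{\ell\sqrt{\rho/I_\rho},\ \sqrt{\|K\|_\infty/EI(\ell)}\,\max\{1,\ell^2\}\}$. $C_F=c\,\max\{\sqrt{\rho/K(\ell)},\sqrt{I_\rho/EI(\ell)}\}$ with $c=\ell$ if $\mu\le1$; if $\mu>1$, $c=\ell^{2-\mu}$ when $\ell\le1$ and $c=\ell^\mu$ when $\ell\ge1$. With $n=\min\{2,\frac1{2-\mu}\}$, $C_N=\max\Big\{2\ell^2\max\{\tfrac1{K(\ell)},\tfrac1{EI(\ell)}\}\,n\,\max\{2,1+\tfrac{2\ell^2\|K\|_\infty}{K(\ell)}n\},\ \tfrac{2\ell}{\gamma},\ \tfrac{8\ell^3\|K\|_\infty}{\delta K(\ell)}n\Big\}$, $C_{NL}=\max\{\sqrt\rho,\sqrt{I_\rho}\}\sqrt{C_N}$. $C''=\max\{\rho,I_\rho\}\max\{\frac1{\gamma^2},\frac1{\delta^2}\}\max\{\frac1\alpha,\frac1\beta\}C_N$, $\ C'''=1+2\max\{\rho,I_\rho\}\max\{\frac1{\gamma^3},\frac1{\delta^3}\}$. *)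

(* Defs.v *)
From HB Require Import structures.
From mathcomp Require Import all_boot all_order all_algebra.
From mathcomp Require Import all_classical all_reals all_analysis.
Import Order.TTheory GRing.Theory Num.Theory.
Import numFieldNormedType.Exports.

Set Implicit Arguments.
Unset Strict Implicit.
Unset Printing Implicit Defensive.

Local Open Scope classical_set_scope.
Local Open Scope ring_scope.

(* The derivative of f at x relative to A; on an interval it is one-sided at the
   endpoints, so it ignores the values of f outside A. *)
Definition deriv_in (R : realType) (A : set R) (f : R -> R) (x : R) : R :=
  lim ((f y - f x) / (y - x) @[y --> within A (dnbhs x)]).

Definition derivable_in (R : realType) (A : set R) (f : R -> R) (x : R) : Prop :=
  cvg ((f y - f x) / (y - x) @[y --> within A (dnbhs x)]).

Fixpoint Ck_on (R : realType) (A : set R) (k : nat) (f : R -> R) : Prop :=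
  {within A, continuous f} /\
  if k is k'.+1 then
    (forall x, A x -> derivable_in A f x) /\ Ck_on A k' (deriv_in A f)
  else True.

Definition mu_set (R : realType) (l : R) (a : R -> R) : set R :=
  [set x * `|deriv_in `[0, l] a x| / a x | x in `]0, l]].

(* sup is 0 on sets that are not bounded above, whence has_ubound in classA. *)
Definition mu (R : realType) (l : R) (a : R -> R) : R := sup (mu_set l a).

Definition classA (R : realType) (l : R) (a : R -> R) : Prop :=
  [/\ Ck_on `[0, l] 0 a /\ Ck_on `]0, l] 1 a,
      forall x, 0 < x <= l -> 0 < a x,
      a 0 = 0,
      has_ubound (mu_set l a) /\ mu l a < 2
    & Ck_on `[0, l] (Num.truncn (mu l a)) a].

Definition weakly_degenerate (R : realType) (l : R) (K EI : R -> R) : Prop :=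
  mu l K < 1 /\ mu l EI < 1.

Definition strongly_degenerate (R : realType) (l : R) (K EI : R -> R) : Prop :=
  1 <= mu l K /\ 1 <= mu l EI.

Definition abs_continuous (R : realType) (a b : R) (f : R -> R) : Prop :=
  forall e : R, 0 < e -> exists2 d : R, 0 < d &
    forall (n : nat) (u v : 'I_n -> R),
      (forall i, a <= u i /\ u i <= v i /\ v i <= b) ->
      (forall i j, i != j -> v i <= u j \/ v j <= u i) ->
      \sum_(i < n) (v i - u i) < d ->
      \sum_(i < n) `|f (v i) - f (u i)| < e.

Definition loc_abs_continuous (R : realType) (l : R) (f : R -> R) : Prop :=
  forall x, 0 < x <= l -> abs_continuous x l f.

Definition ae_on (R : realType) (l : R) (P : R -> Prop) : Prop :=
  {ae @lebesgue_measure R, forall x, `]0, l[%classic x -> P x}.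

Definition L2 (R : realType) (l : R) (f : R -> R) : Prop :=
  measurable_fun `]0, l[ f /\
  (@lebesgue_measure R).-integrable `]0, l[ (EFin \o (fun x => f x ^+ 2)).

(* H^1(0,l), through the continuous representative on ]0, l]; the derivative of
   a locally absolutely continuous function exists almost everywhere, and
   derive1 is used only inside integrals and almost-everywhere statements. *)
Definition H1 (R : realType) (l : R) (f : R -> R) : Prop :=
  [/\ loc_abs_continuous l f, L2 l f & L2 l (derive1 f)].

(* Pairs of functions of x, i.e. (w, psi) or (w_t, psi_t). Elements of L^2 are
   represented by functions, equality in L^2 being equality a.e. *)
Definition field2 (R : realType) : Type := ((R -> R^o) * (R -> R^o))%type.

(* ((w, psi), (w_t, psi_t)) *)
Definition state (R : realType) : Type := (field2 R * field2 R)%type.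

Definition V1 (R : realType) (l : R) (K EI : R -> R) (y : field2 R) : Prop :=
  [/\ L2 l y.1 /\ L2 l y.2,
      loc_abs_continuous l y.1 /\ loc_abs_continuous l y.2,
      L2 l (fun x => Num.sqrt (K x) * (derive1 y.1 x + y.2 x))
    & L2 l (fun x => Num.sqrt (EI x) * derive1 y.2 x)].

(* The values at 0 are traces: elements of V1 are determined on ]0, l] only. *)
Definition VR (R : realType) (l : R) (K EI : R -> R) (y : field2 R) : Prop :=
  V1 l K EI y /\
  (weakly_degenerate l K EI ->
     y.1 x @[x --> 0^'+] --> (0 : R) /\ y.2 x @[x --> 0^'+] --> (0 : R)).

(* Squared norms. Rintegral is 0 on non-integrable functions; these are applied
   only to elements of the corresponding spaces. *)
Definition sqnormL2 (R : realType) (l : R) (y : field2 R) : R :=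
  \int[@lebesgue_measure R]_(x in `]0, l[) (y.1 x ^+ 2 + y.2 x ^+ 2).

Definition sqnormV (R : realType) (l : R) (K EI : R -> R) (y : field2 R) : R :=
  sqnormL2 l y +
  \int[@lebesgue_measure R]_(x in `]0, l[)
    (K x * (derive1 y.1 x + y.2 x) ^+ 2 + EI x * derive1 y.2 x ^+ 2).

Definition inH (R : realType) (l : R) (K EI : R -> R) (U : state R) : Prop :=
  VR l K EI U.1 /\ (L2 l U.2.1 /\ L2 l U.2.2).

Definition sqnormH (R : realType) (l : R) (K EI : R -> R) (U : state R) : R :=
  sqnormV l K EI U.1 + sqnormL2 l U.2.

(* Continuity and differentiability on [0, +oo[ (one-sided at 0) of curves in a
   space with squared norm N. *)
Definition continuous_curve (R : realType) (T : lmodType R) (N : T -> R)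
    (U : R -> T) : Prop :=
  forall t, 0 <= t -> N (U s - U t) @[s --> within `[0, +oo[ (nbhs t)] --> (0 : R).

Definition derivative_curve (R : realType) (T : lmodType R) (N : T -> R)
    (U U' : R -> T) : Prop :=
  forall t, 0 <= t ->
    N ((s - t)^-1 *: (U s - U t) - U' t)
      @[s --> within `[0, +oo[ (dnbhs t)] --> (0 : R).

(* F = A U, where A is the (unbounded) operator on VR x L^2 of the first-order
   form U' = A U of the feedback system: U = ((w, psi), (v, phi)) lies in the
   domain of A and
   F = ((v, phi), ((K (w' + psi))' / rho, ((EI psi')' - K (w' + psi)) / Irho)).
   p and q are the continuous representatives of K (w' + psi) and EI psi'. *)
Definition timoshenko_op (R : realType) (l rho Irho alpha beta gamma delta : R)
    (K EI : R -> R) (U F : state R) : Prop :=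
  let w := U.1.1 in let psi := U.1.2 in
  let v := U.2.1 in let phi := U.2.2 in
  VR l K EI (w, psi) /\ VR l K EI (v, phi) /\
  exists p q : R -> R,
    [/\ H1 l p /\ H1 l q,
        ae_on l (fun x => p x = K x * (derive1 w x + psi x)) /\
        ae_on l (fun x => q x = EI x * derive1 psi x),
        p l + gamma * w l = - alpha * v l /\
        q l + delta * psi l = - beta * phi l,
        strongly_degenerate l K EI ->
          p x @[x --> 0^'+] --> (0 : R) /\ q x @[x --> 0^'+] --> (0 : R)
      & ae_on l (fun x =>
          [/\ F.1.1 x = v x, F.1.2 x = phi x,
              F.2.1 x = derive1 p x / rho
            & F.2.2 x = (derive1 q x - p x) / Irho])].

(* U is a mild solution of U' = A U: U is continuous into VR x L^2 and, J t
   being the integral of U over [0, t] (the primitive of U that vanishes at 0),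
   J t lies in the domain of A and U t = U 0 + A (J t) for all t >= 0. *)
Definition mild_solution (R : realType) (l rho Irho alpha beta gamma delta : R)
    (K EI : R -> R) (U : R -> state R) : Prop :=
  [/\ forall t, 0 <= t -> inH l K EI (U t),
      continuous_curve (sqnormH l K EI) U
    & exists J : R -> state R,
        [/\ forall t, 0 <= t -> inH l K EI (J t),
            sqnormH l K EI (J 0) = 0,
            derivative_curve (sqnormH l K EI) J U
          & forall t, 0 <= t ->
              timoshenko_op l rho Irho alpha beta gamma delta K EI
                (J t) (U t - U 0)]].

(* The initial data are (w 0, psi 0) and (wt 0, psit 0). *)
Definition finite_energy_solution (R : realType)
    (l rho Irho alpha beta gamma delta : R) (K EI : R -> R)
    (w psi wt psit : R -> R -> R) : Prop :=
  let y : R -> field2 R := fun t => (w t, psi t) in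
  let y' : R -> field2 R := fun t => (wt t, psit t) in
  [/\ forall t, 0 <= t -> VR l K EI (y t),
      continuous_curve (sqnormV l K EI) y,
      (forall t, 0 <= t -> L2 l (wt t) /\ L2 l (psit t)) /\
      continuous_curve (sqnormL2 l) y',
      derivative_curve (sqnormL2 l) y y'
    & mild_solution l rho Irho alpha beta gamma delta K EI (fun t => (y t, y' t))].

Definition energy (R : realType) (l rho Irho gamma delta : R) (K EI : R -> R)
    (w psi wt psit : R -> R -> R) (t : R) : R :=
  2^-1 * (\int[@lebesgue_measure R]_(x in `]0, l[)
            (rho * wt t x ^+ 2 + Irho * psit t x ^+ 2
             + K x * (derive1 (w t) x + psi t x) ^+ 2
             + EI x * derive1 (psi t) x ^+ 2)
          + gamma * w t l ^+ 2 + delta * psi t l ^+ 2).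

Definition supnorm (R : realType) (l : R) (a : R -> R) : R :=
  sup [set `|a x| | x in `[0, l]].

Definition mu_max (R : realType) (l : R) (K EI : R -> R) : R :=
  Num.max (mu l K) (mu l EI).

Definition C_h (R : realType) (l rho Irho : R) (K EI : R -> R) : R :=
  Num.max (l * Num.sqrt (rho / Irho))
          (Num.sqrt (supnorm l K / EI l) * Num.max 1 (l ^+ 2)).

Definition C_F (R : realType) (l rho Irho : R) (K EI : R -> R) : R :=
  let m := mu_max l K EI in
  let c := if m <= 1 then l
           else if l <= 1 then l `^ (2 - m) else l `^ m in
  c * Num.max (Num.sqrt (rho / K l)) (Num.sqrt (Irho / EI l)).

Definition C_N (R : realType) (l gamma delta : R) (K EI : R -> R) : R :=
  let n := Num.min 2 (1 / (2 - mu_max l K EI)) in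
  Num.max
    (Num.max
      (2 * l ^+ 2 * Num.max (1 / K l) (1 / EI l) * n
       * Num.max 2 (1 + 2 * l ^+ 2 * supnorm l K / K l * n))
      (2 * l / gamma))
    (8 * l ^+ 3 * supnorm l K / (delta * K l) * n).

Definition C_NL (R : realType) (l rho Irho gamma delta : R) (K EI : R -> R) : R :=
  Num.max (Num.sqrt rho) (Num.sqrt Irho) * Num.sqrt (C_N l gamma delta K EI).

Definition C_two (R : realType) (l rho Irho alpha beta gamma delta : R)
    (K EI : R -> R) : R :=
  Num.max rho Irho * Num.max (1 / gamma ^+ 2) (1 / delta ^+ 2)
  * Num.max (1 / alpha) (1 / beta) * C_N l gamma delta K EI.

Definition C_three (R : realType) (rho Irho gamma delta : R) : R :=
  1 + 2 * Num.max rho Irho * Num.max (1 / gamma ^+ 3) (1 / delta ^+ 3).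

(* Main.v *)
(** The constants eta are at our disposal, so kappa can be made as small as
    needed; since [3 <= exp 2] it suffices to find [k > 0], depending on the data
    only, with [E t <= 3 E 0 exp (- k t)]. For [U = ((w, psi), (v, phi))] in the
    domain of the operator, add to the energy small multiples of two forms.
    The dilation form
      [int (rho v x (w' + psi) + Irho phi x psi' + mu/4 (rho v w + Irho phi psi))]
    decreases along the flow by [(2 - mu - 2 C_h) / 4] times the interior energy,
    up to boundary values at [x = l]. The multiplier form
      [int (rho v Z + Irho phi Xi)],
    where [(Z, Xi)] solves the static beam equations loaded at [x = l] by
    [(gamma w l, delta psi l)] (a rigid motion of the beam in the strongly
    degenerate case), absorbs [w l ^ 2 + psi l ^ 2]; what remains is
    [v l ^ 2 + phi l ^ 2], which the dissipation controls. Gronwall's lemma gives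
    the decay for curves in the domain. If [J] is the time integral of a mild
    solution [U], the quotients [(J (t + h) - J t) / h] are such curves, and they
    converge to [U t] in the energy norm as [h] tends to [0]. *)
From HB Require Import structures.
From mathcomp Require Import all_boot all_order all_algebra.
From mathcomp Require Import all_classical all_reals all_analysis.
From mathcomp Require Import measurable_realfun.
From mathcomp Require Import ring lra.
Require Import Defs.
Import Order.TTheory GRing.Theory Num.Theory.
Import numFieldNormedType.Exports.
Set Implicit Arguments.
Unset Strict Implicit.
Unset Printing Implicit Defensive.
Local Open Scope classical_set_scope.
Local Open Scope ring_scope.

(** The weight [mu / 4] in the dilation form equalises two effects. Differentiating the [x]-weighted
    part yields [- 1/2] of the kinetic density and at worst [- (1 - mu) / 2] of the elastic one; the
    term with [mu / 4] brings both to [- (2 - mu) / 4]. The couplings [p x psi'] and [rho x v phi]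
    cost at most [C_h / 2] of the elastic and of the kinetic density, whence the hypothesis
    [mu + 2 C_h < 2]. The analytic obstacle is the end [x = 0]: each integration by parts is the
    fundamental theorem on []0, l]] followed by a limit at 0, where the boundary term must vanish or
    have a sign. As absolute continuity is given in epsilon-delta form, that theorem is derived from
    the Jordan decomposition and Radon-Nikodym. The bound [x^2 / a <= l^2 / a(l)], a consequence of
    [mu < 2], makes [x (w' + psi)] and [x psi'] square integrable; the Hardy and trace estimates,
    and through them the continuity of the forms in the energy norm, rest on it. *)

(** * Absolute continuity of the total variation *)

Section AbsContinuousVariation.
Context (R : realType).
Implicit Types (a b c d : R) (f : R -> R).

(* An interval [[u, v]] is encoded by the pair [(v, u)], as in [variation_zip]. *)
Definition apart (p q : R * R) := (p.1 <= q.2) || (q.1 <= p.2).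

Definition interval_family a b (s : seq (R * R)) :=
  all (fun p => [&& a <= p.2, p.2 <= p.1 & p.1 <= b]) s && pairwise apart s.

Lemma apart_sym p q : apart p q = apart q p.
Proof. by rewrite /apart orbC. Qed.

(** Sequences of pairs can be concatenated and refined, which the refinement argument for the total
    variation requires. *)
Lemma abs_continuous_seq a b f : abs_continuous a b f ->
  forall e, 0 < e -> exists2 d, 0 < d & forall s, interval_family a b s ->
    \sum_(p <- s) (p.1 - p.2) < d -> \sum_(p <- s) `|f p.1 - f p.2| < e.
Proof.
move=> acf e e0; have [d d0 H] := acf e e0; exists d => // s /andP[sab ds].
rewrite !(big_nth (0, 0)) !big_mkord => sd.
pose F (i : 'I_(size s)) := nth (0, 0) s i.
apply: (H _ (fun i => (F i).2) (fun i => (F i).1)) => //.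
- move=> i; have /(allP sab)/and3P[-> -> ->]// : F i \in s by apply: mem_nth.
- move=> i j ij; apply/orP; rewrite -/(apart (F i) (F j)).
  have [ji|ji] := ltnP i j; first by apply: (pairwiseP (0, 0) ds); rewrite ?inE.
  rewrite apart_sym; apply: (pairwiseP (0, 0) ds); rewrite ?inE//.
  by rewrite ltn_neqAle ji andbT eq_sym.
Qed.

Lemma abs_continuousS a b c d f : a <= c -> d <= b ->
  abs_continuous a b f -> abs_continuous c d f.
Proof.
move=> ac db acf e e0; have [r r0 H] := acf e e0; exists r => // n u v huv.
by apply: H => i; have [cu [uv vd]] := huv i; rewrite (le_trans ac)// uv (le_trans vd).
Qed.

Lemma zip_partition_family c d s : itv_partition c d s ->
  interval_family c d (zip s (c :: s)) /\
  \sum_(p <- zip s (c :: s)) (p.1 - p.2) = d - c.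
Proof.
elim: s c => [|x s IH] c.
  by move=> /itv_partition_nil ->; rewrite /= big_nil subrr.
move=> /[dup] xs /itv_partition_cons => /IH[/andP[IH1 IH2] IH3].
have [pxs _] := xs; have /andP[cx _] : (c < x) && path <%O x s := pxs.
have zE : zip (x :: s) (c :: x :: s) = (x, c) :: zip s (x :: s) by [].
rewrite {}zE.
have xd : x <= d by apply: itv_partition_le; exact: itv_partition_cons xs.
rewrite /interval_family.
move: (zip s (x :: s)) IH1 IH2 IH3 => z IH1 IH2 IH3.
split; last by rewrite big_cons/= IH3; ring.
rewrite /= lexx (ltW cx) xd IH2 andbT/=.
rewrite andbT; apply/andP; split; apply/allP => p /(allP IH1)/and3P[xp pp pd].
  by rewrite pp pd (le_trans (ltW cx)).
by rewrite /apart xp.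
Qed.

Lemma interval_family_refine a b c d (s t : seq (R * R)) :
  interval_family a b (s ++ (d, c) :: t) -> forall l, interval_family c d l ->
  interval_family a b (s ++ l ++ t).
Proof.
rewrite /interval_family => + l; rewrite !all_cat/= !pairwise_cat/=.
rewrite !allrel_consr/= allrel_catr.
move=> /andP[/and3P[-> /and3P[ac cd db] ->]] /and4P[/andP[sdc ->] -> dct ->] /andP[lcd ->].
rewrite !andbT/=; apply/and3P; split.
- apply/allP => p /(allP lcd)/and3P[cp -> pd].
  by rewrite (le_trans ac)//= (le_trans pd).
- apply/allrelP => q p /(allP sdc) + /(allP lcd)/and3P[cp pp pd].
  by rewrite /apart/= => /orP[qc|dq]; rewrite ?(le_trans qc)//= ?(le_trans pd)// orbT.
- apply/allrelP => p q /(allP lcd)/and3P[cp pp pd] /(allP dct).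
  by rewrite /apart/= => /orP[dq|qc]; [rewrite (le_trans pd)//|rewrite (le_trans qc)// orbT].
Qed.

Notation TV := (@total_variation R).

(** Any partition of a piece shorter than [d] is an admissible family, so the variation there is at
    most 1; finitely many steps of length [d / 2] exhaust [[a, b]]. *)
Lemma abs_continuous_bounded_variation a b f : a <= b ->
  abs_continuous a b f -> bounded_variation a b f.
Proof.
move=> ab acf; have [d d0 H] := abs_continuous_seq acf ltr01.
have small c e : a <= c -> c <= e -> e <= b -> e - c < d -> bounded_variation c e f.
  move=> ac ce eb ecd; exists 1 => _ [s cse <-].
  have [fs len] := zip_partition_family cse.
  rewrite variation_zip// ltW// H ?len//.
  case/andP: fs => /allP fs ps; apply/andP; split => //.
  apply/allP => p /fs /and3P[cp -> pe].
  by rewrite (le_trans ac)//= (le_trans pe).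
have step n e : a <= e -> e <= b -> e - a < (d / 2) *+ n -> bounded_variation a e f.
  elim: n e => [|n IH] e ae eb; first by rewrite mulr0n ltNge subr_ge0 ae.
  rewrite mulrS => ean.
  have [ea|ea] := leP (e - d / 2) a.
    by apply: small => //; rewrite ltrBlDr (le_lt_trans (_ : e <= a + d / 2))//; lra.
  have h : e - d / 2 <= e by rewrite gerBl divr_ge0// ltW.
  apply/bounded_variationP => //.
  rewrite (total_variationD f (ltW ea) h) fin_numD.
  apply/andP; split; apply/bounded_variationP => //; first exact: ltW.
    by apply: IH; [exact: ltW|exact: le_trans eb|lra].
  by apply: small => //; [exact: ltW|lra].
have [n nab] : exists n, b - a < (d / 2) *+ n.
  exists (Num.bound ((b - a) / (d / 2))).
  rewrite -mulr_natl -ltr_pdivrMr ?divr_gt0//.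
  apply: archi_boundP; rewrite divr_ge0 ?subr_ge0//.
  by rewrite divr_ge0// ltW.
exact: (step n).
Qed.

Lemma bounded_variation_le_sup a b f M : a < b -> bounded_variation a b f ->
  (forall s, itv_partition a b s -> variation a b f s <= M) ->
  fine (TV a b f) <= M.
Proof.
move=> ab bv H; rewrite /total_variation ereal_sup_EFin//=; last exact: variations_neq0.
by apply: ge_sup; [exact: variations_neq0|move=> _ [s /H ? <-]].
Qed.

Lemma total_variation_fine_itv a b f u v : bounded_variation a b f ->
  a <= u -> u <= v -> v <= b ->
  fine (TV a v f) - fine (TV a u f) = fine (TV u v f).
Proof.
move=> bv au uv vb.
have bvv : bounded_variation a v f by apply: bounded_variationl bv => //; exact: le_trans uv.
have bvu := bounded_variationl au uv bvv.
have bvuv := bounded_variationr au uv bvv.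
rewrite (total_variationD f au uv) fineD; first by rewrite addrC addKr.
  exact/bounded_variationP.
exact/bounded_variationP.
Qed.

(** Partitioning the intervals of a family gives a family of the same total length, so the bound for
    [f] holds for every choice of partitions. Taking the supremum over them, one interval at a time,
    replaces increments of [f] by increments of the variation and [< e] by [<= e]. *)
Lemma abs_continuous_total_variation a b f : a <= b -> abs_continuous a b f ->
  forall e, 0 < e -> exists2 d, 0 < d & forall s, interval_family a b s ->
    \sum_(p <- s) (p.1 - p.2) < d ->
    \sum_(p <- s) (fine (TV a p.1 f) - fine (TV a p.2 f)) <= e.
Proof.
move=> ab acf e e0; have [d d0 H] := abs_continuous_seq acf e0.
have bv := abs_continuous_bounded_variation ab acf.
exists d => // s.
(* [t] collects the pieces of the intervals already partitioned, which are counted with increments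
   of [f]; those still in [s] are counted with increments of the variation. *)
suff gen t : interval_family a b (t ++ s) -> \sum_(p <- t ++ s) (p.1 - p.2) < d ->
    \sum_(p <- t) `|f p.1 - f p.2| +
    \sum_(p <- s) (fine (TV a p.1 f) - fine (TV a p.2 f)) <= e.
  by move=> fs sd; have := gen [::] fs sd; rewrite big_nil add0r.
elim: s t => [|[v u] s IH] t fts len.
  by rewrite cats0 in fts len; rewrite big_nil addr0 ltW// H.
have /and3P[au uv vb] : [&& a <= u, u <= v & v <= b].
  by have /andP[/allP + _] := fts; move=> /(_ (v, u)); apply; rewrite mem_cat inE eqxx orbT.
rewrite big_cons/= (total_variation_fine_itv bv)//.
move: len; rewrite big_cat big_cons/= => len.
have bvuv : bounded_variation u v f.
  by apply: (bounded_variationr au uv); apply: bounded_variationl bv => //; exact: le_trans uv.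
have [uv'|vu] := ltP u v; last first.
  have -> : v = u by apply/eqP; rewrite eq_le uv vu.
  rewrite total_variationxx/= add0r; apply: IH.
    by have := interval_family_refine fts (_ : interval_family u v [::]); apply.
  by rewrite big_cat/=; move: len; rewrite (le_anti (introT andP (conj uv vu))); lra.
suff : fine (TV u v f) <= e - \sum_(p <- t) `|f p.1 - f p.2| -
   \sum_(p <- s) (fine (TV a p.1 f) - fine (TV a p.2 f)) by lra.
apply: bounded_variation_le_sup => // l uvl.
have [fl lenl] := zip_partition_family uvl.
have := IH (t ++ zip l (u :: l)).
rewrite -catA !big_cat/= lenl -(variation_zip _ uvl) => IHl.
rewrite -subr_ge0.
suff : \sum_(p <- t) `|f p.1 - f p.2| + variation u v f l +
   \sum_(p <- s) (fine (TV a p.1 f) - fine (TV a p.2 f)) <= e by lra.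
by apply: IHl; [exact: interval_family_refine fts _ fl|lra].
Qed.

End AbsContinuousVariation.

(** * Densities of absolutely continuous monotone functions *)

Section LebesgueStieltjesDensity.
Context (R : realType) (G : R -> R) (M : R)
  (G_nd : {homo G : x y / x <= y})
  (G_bounded : forall x, `|G x| <= M)
  (G_ac : forall e, 0 < e -> exists2 d, 0 < d &
  forall s : seq (R * R), all (fun p => p.2 <= p.1) s -> pairwise (@apart R) s ->
  \sum_(p <- s) (p.1 - p.2) < d -> \sum_(p <- s) (G p.1 - G p.2) <= e).

Local Notation leb := (@lebesgue_measure R).

Lemma ac_right_continuous : right_continuous G.
Proof.
move=> x; apply/cvgrPdist_le => e e0.
have [d d0 H] := G_ac e0.
near=> y.
have xy : x <= y by apply: ltW; near: y; exact: nbhs_right_gt.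
have := H [:: (y, x)]; rewrite /= !big_seq1/= xy => /(_ isT isT).
rewrite distrC ger0_norm ?subr_ge0; last exact: G_nd.
apply; rewrite ltrBlDl; near: y; apply: nbhs_right_lt; by rewrite ltrDl.
Unshelve. all: by end_near. Qed.

(** The measure bound limits the distance between any two points of [I], which is therefore bounded;
    openness excludes both endpoints. *)
Lemma bounded_open_interval (I : set R) (D : R) : open I -> is_interval I -> I !=set0 ->
  (leb I <= D%:E)%E -> [/\ inf I < sup I, I = `]inf I, sup I[%classic & leb I = (sup I - inf I)%:E].
Proof.
move=> oI iI [x Ix] ID.
have mI : measurable I by exact: is_interval_measurable.
have dist y z : I y -> I z -> z - y <= D.
  move=> Iy Iz; have [zy|yz] := leP z y.
    apply: (@le_trans _ _ 0); first by rewrite subr_le0.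
    by rewrite -lee_fin; apply: le_trans ID.
  rewrite -lee_fin; apply: le_trans ID.
  have <- : leb `[y, z] = (z - y)%:E.
    by rewrite lebesgue_measure_itv/= lte_fin yz.
  apply: le_measure; rewrite ?inE//.
  by move=> t /=; rewrite in_itv/= => yt; apply: (iI _ _ Iy Iz).
have hs : has_sup I.
  by split; [exists x|exists (x + D) => y Iy; rewrite -lerBlDl; exact: dist].
have hi : has_inf I.
  by split; [exists x|exists (x - D) => y Iy; rewrite lerBlDl -lerBlDr; exact: dist].
have IE : I = `]inf I, sup I[%classic.
  apply/seteqP; split => [y Iy|y] /=; rewrite in_itv/=.
    have /nbhs_ballP[e /= e0 He] : \forall z \near y, I z by apply: open_nbhs_nbhs; split.
    have e20 : 0 < e / 2 by rewrite divr_gt0.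
    have He2 z : `|y - z| <= e / 2 -> I z.
      by move=> yz; apply: He; rewrite /ball/=; apply: le_lt_trans yz _; rewrite ltr_pdivrMr// ltr_pMr// ltr1n.
    apply/andP; split.
      apply: (@le_lt_trans _ _ (y - e / 2)); last by rewrite gtrBl.
      by apply: ge_inf; [exact: hi.2|apply: He2; rewrite opprB addrC subrK gtr0_norm].
    apply: (@lt_le_trans _ _ (y + e / 2)); first by rewrite ltrDl.
    apply: ub_le_sup; first exact: hs.2.
    by apply: He2; rewrite opprD addrA subrr sub0r normrN gtr0_norm.
  move=> /andP[iy ys].
  have [z Iz zy] := inf_lt hi.1 iy; have [t It yt] := sup_gt hs.1 ys.
  by apply: (iI _ _ Iz It); rewrite !ltW.
have lt : inf I < sup I.
  by move: Ix; rewrite {1}IE/= in_itv/= => /andP[]; exact: lt_trans.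
by split => //; rewrite {1}IE lebesgue_measure_itv/= lte_fin lt.
Qed.

Lemma open_interval_apart (a b c d : R) : a < b -> c < d ->
  `]a, b[ `&` `]c, d[ = set0 -> apart (b, a) (d, c).
Proof.
move=> ab cd abcd; rewrite /apart/=; apply/negP => /negP; rewrite negb_or -!ltNge => /andP[cb ad].
have : (`]a, b[ `&` `]c, d[)%classic ((Num.max a c + Num.min b d) / 2).
  have m : Num.max a c < Num.min b d by rewrite gt_max !lt_min ab cb ad cd.
  have := midf_lt m => -[]; rewrite gt_max lt_min => -[h1 h2].
  by rewrite /= !in_itv/=; lra.
by rewrite abcd.
Qed.

HB.instance Definition _ := isCumulative.Build R _ R G G_nd ac_right_continuous.

Local Notation LS := (lebesgue_stieltjes_measure G).

Lemma LS_ocitv (x y : R) : x <= y -> LS `]x, y]%classic = (G y - G x)%:E.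
Proof.
move=> xy; rewrite /lebesgue_stieltjes_measure /measure_extension measurable_mu_extE/=.
  by rewrite wlength_itv_bnd// EFinB.
exact: is_ocitv.
Qed.

(** Finiteness allows the Stieltjes measure to be regarded as a charge, as Radon-Nikodym demands. *)
Lemma LS_lty : (LS setT < +oo)%E.
Proof.
rewrite -(bigcup_itvT false false).
pose I n : set R := `]- (n%:R), n%:R]%classic.
have : (LS \o I) n @[n --> \oo] --> LS (\bigcup_n I n).
  apply: nondecreasing_cvg_mu; rewrite /I//; first exact: bigcup_measurable.
  by move=> *; apply/subsetPset/subset_itv; rewrite leBSide/= ?lerN2 ler_nat.
move=> h; apply: (@le_lt_trans _ _ (M + M)%:E); last exact: ltry.
rewrite -(cvg_lim _ h)//; apply: lime_le; first by apply/cvg_ex; eexists; exact: h.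
near=> n; rewrite /= /I LS_ocitv; last by rewrite (le_trans (_ : _ <= 0))// lerNl oppr0.
rewrite lee_fin; have := G_bounded n%:R; have := G_bounded (- n%:R).
by rewrite !ler_norml; lra.
Unshelve. all: by end_near. Qed.

(** Outer regularity encloses [N] in an open set of Lebesgue measure below [d]. That set is a
    countable disjoint union of open intervals; absolute continuity bounds the Stieltjes mass of any
    finite number of them by [e], hence that of all. *)
Lemma LS_null (N : set R) : measurable N -> leb N = 0%E -> LS N = 0%E.
Proof.
move=> mN N0; apply/eqP; rewrite eq_le measure_ge0 andbT.
apply/lee_addgt0Pr => e e0; rewrite add0e.
have [d d0 H] := G_ac e0.
have Noo : (leb N < +oo)%E by rewrite N0.
have [U [oU NU UNd]] := lebesgue_regularity_outer mN Noo d0.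
have mU : measurable U by exact: open_measurable.
have Ud : (leb U < d%:E)%E.
  have UE0 : U = N `|` (U `\` N) by rewrite setDUK.
  apply: (@le_lt_trans _ _ (leb N + leb (U `\` N))%E); last by rewrite N0 add0e.
  by rewrite {1}UE0; apply: measureU2 => //; exact: measurableD.
apply: (@le_trans _ _ (LS U)); first by apply: le_measure; rewrite ?inE.
have UE := open_disjoint_itv_bigcup oU.
set I := open_disjoint_itv oU in UE.
have tI : trivIset setT I by exact: open_disjoint_itv_trivIset.
have oI i : open (I i) by exact: open_disjoint_itv_open.
have iI i : is_interval (I i) by exact: open_disjoint_itv_is_interval.
have mI i : measurable (I i) by exact: is_interval_measurable.
have IU i : I i `<=` U by rewrite UE; exact: bigcup_sup.
have Id i : (leb (I i) <= d%:E)%E.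
  apply: le_trans (ltW Ud).
  by apply: le_measure; [rewrite inE; exact: mI|rewrite inE|exact: IU].
have Ine i : I i !=set0 ->
    [/\ inf (I i) < sup (I i), I i = `]inf (I i), sup (I i)[%classic
      & leb (I i) = (sup (I i) - inf (I i))%:E].
  by move=> ne; exact: bounded_open_interval (Id i).
have sumU (m : {measure set (measurableTypeR R) -> \bar R}) :
    m U = (\sum_(0 <= i <oo) m (I i))%E.
  rewrite {1}UE measure_bigcup//; last by move=> i _; exact: mI.
  by apply: congr_lim; apply/funext => n; apply: eq_bigl => i; rewrite in_setT.
rewrite sumU; apply: lime_le; first exact: is_cvg_nneseries.
near=> n.
(* Empty components are filtered out, since their [sup] and [inf] are default values. *)
pose s := [seq (sup (I i), inf (I i)) | i <- iota 0 n & `[< I i !=set0 >]].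
have step : (\sum_(0 <= i < n) LS (I i) <= (\sum_(p <- s) (G p.1 - G p.2))%:E)%E.
  rewrite -sumEFin big_map big_filter /index_iota subn0 [leRHS]big_mkcond/=.
  apply: lee_sum => i _; case: ifPn => [/asboolP ne|/asboolPn/set0P/negP/negbNE/eqP ->].
    have [lt IE _] := Ine _ ne; rewrite {1}IE -(LS_ocitv (ltW lt)).
    by apply: le_measure; rewrite ?inE//; exact: subset_itv_oo_oc.
  by rewrite measure0.
apply: le_trans step _; rewrite lee_fin; apply: H.
- apply/allP => p /mapP[i]; rewrite mem_filter => /andP[/asboolP ne _] ->/=.
  by have [/ltW] := Ine _ ne.
- rewrite pairwise_map; apply/(pairwiseP 0%N) => i j.
  set t := [seq k <- _ | _]; have ut : uniq t by rewrite filter_uniq// iota_uniq.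
  rewrite inE => it; rewrite inE => jt ij /=.
  have tne k : (k < size t)%N -> I (nth 0%N t k) !=set0.
    by move=> /(mem_nth 0%N); rewrite mem_filter => /andP[/asboolP].
  have [lti Ei _] := Ine _ (tne _ it); have [ltj Ej _] := Ine _ (tne _ jt).
  apply: open_interval_apart => //; rewrite -Ei -Ej.
  by move/trivIsetP: tI; apply => //; rewrite nth_uniq// ltn_eqF.
- rewrite -lte_fin; apply: le_lt_trans Ud.
  rewrite sumU; apply: le_trans (_ : \sum_(0 <= i < n) leb (I i) <= _)%E.
    rewrite -sumEFin big_map big_filter /index_iota subn0 [leLHS]big_mkcond/=.
    apply: lee_sum => i _; case: ifPn => [/asboolP ne|_]; last exact: measure_ge0.
    by have [_ _ ->] := Ine _ ne.
  exact: nneseries_lim_ge.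
Unshelve. all: by end_near. Qed.

(** By [LS_null] the Stieltjes measure is dominated by Lebesgue measure; [h] is its Radon-Nikodym
    derivative, made real-valued by [fine]. *)
Lemma LS_density : exists2 h : R -> R, leb.-integrable setT (EFin \o h) &
  forall x y, x <= y -> (G y - G x)%:E = (\int[leb]_(t in `]x, y]) (h t)%:E)%E.
Proof.
pose nu : {finite_measure set (measurableTypeR R) -> \bar R} := mfrestr measurableT LS_lty.
pose c : {charge set (measurableTypeR R) -> \bar R} := charge_of_finite_measure nu.
have dom : c `<< leb.
  apply/null_content_dominatesP => A mA A0.
  by rewrite /c /charge_of_finite_measure /= /mfrestr /mrestr setIT; exact: LS_null.
exists (fine \o Radon_Nikodym c leb).
  apply: eq_integrable (Radon_Nikodym_integrable dom) => // x _ /=.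
  by rewrite fineK//; exact: Radon_Nikodym_fin_num.
move=> x y xy; rewrite -LS_ocitv//.
transitivity (c `]x, y]%classic).
  by rewrite /c /charge_of_finite_measure /= /mfrestr /mrestr setIT.
rewrite (Radon_Nikodym_integral dom)//; apply: eq_integral => t _ /=.
by rewrite fineK//; exact: Radon_Nikodym_fin_num.
Qed.

End LebesgueStieltjesDensity.

(** * The fundamental theorem for absolutely continuous functions *)

Section AbsContinuousFTC.
Context (R : realType).
Implicit Types (a b c d : R) (f : R -> R).
Local Notation leb := (@lebesgue_measure R).

(** The retraction onto [[a, b]] when [a <= b]. It is monotone and 1-Lipschitz, so composing with it
    extends a function to the whole line and keeps monotonicity, continuity and absolute
    continuity. *)
Definition clamp a b (x : R) := Num.max a (Num.min x b).

Lemma clamp_itv a b x : a <= b -> a <= clamp a b x <= b.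
Proof. by move=> ab; rewrite /clamp le_max lexx/= ge_max ab/= ge_min lexx orbT. Qed.

Lemma clamp_id a b x : a <= x <= b -> clamp a b x = x.
Proof. by move=> /andP[ax xb]; rewrite /clamp (min_idPl xb) (max_idPr ax). Qed.

Lemma clamp_nd a b : {homo clamp a b : x y / x <= y}.
Proof.
move=> x y xy; rewrite /clamp ge_max le_max lexx/= le_max; apply/orP; right.
by rewrite le_min ge_min xy/= ge_min lexx orbT.
Qed.

Lemma clamp_lip a b x y : x <= y -> clamp a b y - clamp a b x <= y - x.
Proof.
move=> xy; rewrite /clamp.
have uv : Num.min y b - Num.min x b <= y - x.
  by case: (leP x b) => xb; case: (leP y b) => yb; lra.
have mm : Num.min x b <= Num.min y b by rewrite le_min !ge_min xy lexx orbT.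
apply: le_trans uv; move: (Num.min x b) (Num.min y b) mm.
by move=> u v uv; case: (leP a u) => ?; case: (leP a v) => ?; lra.
Qed.

Lemma density_clamped a b (W : R -> R) : a < b ->
  {in `[a, b] &, {homo W : x y / x <= y}} ->
  (forall e, 0 < e -> exists2 d, 0 < d & forall s, interval_family a b s ->
    \sum_(p <- s) (p.1 - p.2) < d -> \sum_(p <- s) (W p.1 - W p.2) <= e) ->
  exists2 h : R -> R, leb.-integrable setT (EFin \o h) &
  forall x y, a <= x -> x <= y -> y <= b ->
    (W y - W x)%:E = (\int[leb]_(t in `]x, y]) (h t)%:E)%E.
Proof.
move=> ab Wnd Wac; have cI x : clamp a b x \in `[a, b].
  by rewrite in_itv/=; apply: clamp_itv; exact: ltW.
have Gnd : {homo (W \o clamp a b) : x y / x <= y}.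
  by move=> x y xy /=; apply: Wnd => //; exact: clamp_nd.
have Gbd x : `|(W \o clamp a b) x| <= `|W a| + `|W b|.
  have := cI x; rewrite in_itv/= => /andP[ax xb].
  have h1 : W a <= W (clamp a b x) by apply: Wnd => //; rewrite in_itv/= lexx ltW.
  have h2 : W (clamp a b x) <= W b by apply: Wnd => //; rewrite in_itv/= lexx ltW.
  rewrite ler_norml/=; apply/andP; split.
    by apply: le_trans h1; rewrite lerNl; rewrite (le_trans (ler_norm _))// normrN lerDl.
  by apply: (le_trans h2); rewrite (le_trans (ler_norm _))// lerDr.
have [h hi hE] : exists2 h : R -> R, leb.-integrable setT (EFin \o h) &
  forall x y, x <= y -> ((W \o clamp a b) y - (W \o clamp a b) x)%:E =
     (\int[leb]_(t in `]x, y]) (h t)%:E)%E.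
  apply: (LS_density Gnd Gbd) => e e0.
  have [d d0 H] := Wac e e0; exists d => // s snd sap sd.
  have := H [seq (clamp a b p.1, clamp a b p.2) | p <- s].
  rewrite !big_map /= => -> //; last first.
    apply: le_lt_trans sd; rewrite big_seq [leRHS]big_seq; apply: ler_sum => p ps.
    by apply: clamp_lip; exact: (allP snd).
  apply/andP; split.
    apply/allP => _ /mapP[p ps ->]/=.
    have /andP[-> _] := clamp_itv p.2 (ltW ab); have /andP[_ ->] := clamp_itv p.1 (ltW ab).
    by rewrite andbT; apply: clamp_nd; exact: (allP snd).
  rewrite pairwise_map; apply: sub_pairwise sap => p q; rewrite /apart/=.
  by move=> /orP[h|h]; apply/orP; [left|right]; exact: clamp_nd.
exists h => // x y ax xy yb; rewrite -hE//=.
by rewrite !clamp_id//; [rewrite ax (le_trans xy)|rewrite (le_trans ax)].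
Qed.

Lemma derivable_shift (F : R -> R) c x : derivable F x 1 ->
  derivable (fun y => F y + c) x 1 /\ derive1 (fun y => F y + c) x = derive1 F x.
Proof.
move=> dF; have dc : derivable (cst c : R -> R) x 1 by exact: derivable_cst.
split; first exact: (derivableD dF dc).
by rewrite !derive1E (deriveD dF dc) derive_cst addr0.
Qed.

(** Jordan decomposition: [f = V - (V - f)] with [V] the total variation, and both parts are
    nondecreasing and absolutely continuous, so they have densities [h1] and [h2]. Lebesgue
    differentiation of the primitive of [h1 - h2] gives the derivative almost everywhere. *)
Lemma abs_continuous_FTC a b f : a < b -> abs_continuous a b f ->
  exists h : R -> R, [/\ leb.-integrable setT (EFin \o h),
    forall x y, a <= x -> x <= y -> y <= b ->
      f y - f x = \int[leb]_(t in `]x, y]) h t &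
    {ae leb, forall x, `]a, b[%classic x -> derivable f x 1 /\ derive1 f x = h x}].
Proof.
move=> ab acf; have bv := abs_continuous_bounded_variation (ltW ab) acf.
pose V x := fine (total_variation a x f).
have VB x y : a <= x -> x <= y -> y <= b -> `|f y - f x| <= V y - V x.
  move=> ax xy yb; rewrite /V (total_variation_fine_itv bv)//.
  rewrite -lee_fin fineK; first exact: total_variation_ge.
  apply/bounded_variationP => //; apply: (bounded_variationr ax xy).
  by apply: bounded_variationl bv => //; exact: le_trans xy.
have [||h1 ih1 h1E] := @density_clamped a b V ab.
- move=> x y; rewrite !in_itv/= => /andP[ax _] /andP[_ yb] xy.
  by rewrite -subr_ge0; apply: le_trans (VB _ _ ax xy yb).
- exact: abs_continuous_total_variation (ltW ab) acf.
have [||h2 ih2 h2E] := @density_clamped a b (fun x => V x - f x) ab.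
- move=> x y; rewrite !in_itv/= => /andP[ax _] /andP[_ yb] xy.
  by have := VB _ _ ax xy yb; rewrite ler_norml; lra.
- move=> e e0; have e20 : 0 < e / 2 by rewrite divr_gt0.
  have [d1 d10 H1] := abs_continuous_total_variation (ltW ab) acf e20.
  have [d2 d20 H2] := abs_continuous_seq acf e20.
  exists (Num.min d1 d2) => [|s fs]; rewrite ?lt_min ?d10//= => /andP[s1 s2].
  have S1 := H1 _ fs s1; have S2 := H2 _ fs s2.
  apply: (@le_trans _ _ (\sum_(p <- s) (V p.1 - V p.2) + \sum_(p <- s) `|f p.1 - f p.2|)).
    rewrite -big_split/=; apply: ler_sum => p _.
    by have := ler_norm (- (f p.1 - f p.2)); rewrite normrN; lra.
  by rewrite /V; lra.
pose h x := h1 x - h2 x.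
have ih : leb.-integrable setT (EFin \o h).
  have -> : EFin \o h = (EFin \o h1 \- (EFin \o h2))%E by [].
  exact: integrableB.
have hE x y : a <= x -> x <= y -> y <= b -> f y - f x = \int[leb]_(t in `]x, y]) h t.
  move=> ax xy yb; rewrite RintegralB//; [|exact: integrableS ih1|exact: integrableS ih2].
  by rewrite /Rintegral -h1E// -h2E//=; ring.
exists h; split => //.
have hloc : locally_integrable [set: R] h.
  by have := integrable_locally measurableT ih; rewrite patch_setT.
have ihy y : leb.-integrable `]-oo, y] (EFin \o h).
  by apply: integrableS ih => //; exact: measurable_itv.
pose F y := \int[leb]_(t in `]-oo, y]) h t.
have : {ae leb, forall x, derivable F x 1 /\ derive1 F x = h x} := FTC1Ny ihy hloc.
apply: filterS; first exact: (ae_filter_ringOfSetsType leb).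
move=> x [dF F'] /=; rewrite in_itv/= => /andP[ax xb].
(* The primitive [F] starts at [-oo], hence inside []a, b[] it differs from [f] by a constant. *)
have fF : {near x, (fun y => F y + (f a - F a)) =1 f}.
  near=> y.
  have ay : a <= y by apply: ltW; near: y; exact: lt_nbhsr.
  have yb : y <= b by apply: ltW; near: y; exact: lt_nbhsl.
  have := hE _ _ (lexx a) ay yb.
  have := @Rintegral_itvB _ h -oo%O (BRight y) a (ihy y); rewrite bnd_simp => /(_ isT ay).
  by rewrite /F; lra.
clearbody F.
have [dF2 dF2E] := derivable_shift (f a - F a) dF.
split; first exact: near_eq_derivable fF dF2.
by rewrite -F' -dF2E !derive1E (near_eq_derive _ fF).
Unshelve. all: by end_near. Qed.

End AbsContinuousFTC.

(** * Measurability of the derivative *)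

Section MeasurableDerivative.
Context (R : realType).
Implicit Types f : R -> R.

Definition diff_quotient f (h x : R) : R := h^-1 * (f (h + x) - f x).

Lemma continuous_diff_quotient f h : continuous f -> continuous (diff_quotient f h).
Proof.
move=> cf x; apply: cvgM; first exact: cvg_cst.
apply: cvgB; last exact: cf.
apply: continuous_comp; last exact: cf.
by apply: cvgD; [exact: cvg_cst|exact: cvg_id].
Qed.

(** A Cauchy condition for difference quotients, with tolerance [1 / (n + 1)] at scale
    [1 / (m + 1)]. It is closed in [x], so the set of differentiability arises from closed sets by
    countable operations. *)
Definition osc_le f (n m : nat) : set R := [set x | forall h k : R,
  h != 0 -> k != 0 -> `|h| < m.+1%:R^-1 -> `|k| < m.+1%:R^-1 ->
  `|diff_quotient f h x - diff_quotient f k x| <= n.+1%:R^-1].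

Lemma closed_osc_le f n m : continuous f -> closed (osc_le f n m).
Proof.
move=> cf; pose P := [set hk : R * R | [/\ hk.1 != 0, hk.2 != 0,
  `|hk.1| < m.+1%:R^-1 & `|hk.2| < m.+1%:R^-1]].
have -> : osc_le f n m = \bigcap_(hk in P)
   (fun x => `|diff_quotient f hk.1 x - diff_quotient f hk.2 x|) @^-1` [set y | y <= n.+1%:R^-1].
  apply/seteqP; split => x /= H.
    by move=> [h k] [] /= *; exact: H.
  by move=> h k h0 k0 hm km; apply: (H (h, k)).
apply: closed_bigI => hk _; apply: closed_comp; last exact: closed_le.
move=> x _; apply: cvg_norm; apply: cvgB; exact: continuous_diff_quotient.
Qed.

Lemma derivable_osc f x : derivable f x 1 <->
  (\bigcap_n \bigcup_m osc_le f n m) x.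
Proof.
have E : (fun h : R => h^-1 *: ((f \o shift x) (h *: 1) - f x)) = (fun h => diff_quotient f h x).
  by apply/funext => h; rewrite /diff_quotient /= [h *: 1]mulr1.
rewrite /derivable E; split.
  move=> /cvg_ex[/= l /cvgrPdist_le Hl] n _.
  have n0 : 0 < n.+1%:R^-1 / 2 :> R by rewrite divr_gt0.
  have /nbhs_ballP[d /= d0 Hd] := Hl _ n0.
  have [m] : exists m : nat, m.+1%:R^-1 < d :> R.
    exists (Num.bound d^-1); rewrite invf_plt ?posrE//.
    by rewrite (lt_trans (archi_boundP _))// ?invr_ge0 ?ltW// ltr_nat.
  move=> md; exists m => // h k h0 k0 hm km.
  have Hd' z : z != 0 -> `|z| < m.+1%:R^-1 -> `|l - diff_quotient f z x| <= n.+1%:R^-1 / 2.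
    by move=> z0 zm; apply: Hd => //; rewrite /ball/= sub0r normrN (lt_trans zm).
  have := Hd' h h0 hm; have := Hd' k k0 km.
  by move: (n.+1%:R^-1) => c; rewrite !ler_norml; lra.
move=> H; apply/cauchy_cvgP/cauchy_exP => e e0.
have [n ne] : exists n : nat, n.+1%:R^-1 < e :> R.
  exists (Num.bound e^-1); rewrite invf_plt ?posrE//.
  by rewrite (lt_trans (archi_boundP _))// ?invr_ge0 ?ltW// ltr_nat.
have [m _ Hm] := H n I.
pose h0 : R := m.+1%:R^-1 / 2; have m0 : 0 < m.+1%:R^-1 :> R by [].
have h0m : `|h0| < m.+1%:R^-1.
  by rewrite /h0; move: (m.+1%:R^-1 : R) m0 => c c0; rewrite ger0_norm; lra.
exists (diff_quotient f h0 x); apply/nbhs_ballP; exists m.+1%:R^-1 => //= h.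
rewrite /ball/= sub0r normrN => hm hn0.
apply: le_lt_trans ne; apply: Hm => //.
by rewrite /h0 mulf_neq0// ?invr_eq0 ?pnatr_eq0.
Qed.

Lemma measurable_derive1 f : continuous f -> measurable_fun setT (derive1 f).
Proof.
move=> cf; pose D := \bigcap_n \bigcup_m osc_le f n m.
have mD : measurable D.
  apply: bigcap_measurable => // n _; apply: bigcup_measurable => m _.
  by apply: closed_measurable; exact: closed_osc_le.
rewrite -(setUv D); apply/measurable_funU => //; first exact: measurableC.
split.
  apply: (@measurable_fun_cvg _ _ _ _ (fun n => diff_quotient f n.+1%:R^-1)).
    move=> n; apply: measurable_funTS; apply: continuous_measurable_fun.
    exact: continuous_diff_quotient.
  move=> x /derivable_osc dx.
  have cv : diff_quotient f h x @[h --> 0^'] --> derive1 f x.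
    move/cvg_ex: dx => [y Hy].
    have Hy' : h^-1 *: (f (h + x) - f x) @[h --> 0^'] --> y.
      rewrite (_ : (fun h : R => _) = (fun h : R => h^-1 *: ((f \o shift x) (h *: 1) - f x)))//.
      by apply/funext => h /=; rewrite [h *: 1]mulr1.
    by rewrite /derive1 (cvg_lim _ Hy').
  apply: (cvgr_dnbhsP _ _ _).1 cv (fun n => n.+1%:R^-1) _; split.
    by move=> n; rewrite invr_eq0 pnatr_eq0.
  exact: cvg_harmonic.
(* Where the quotients do not converge, [derive1] is the default value of [lim], a constant. *)
apply: (eq_measurable_fun (cst (point : R))) => //.
move=> x; rewrite inE => Dx; rewrite /= /derive1 /lim /lim_in xgetPN// => y Hy.
apply: Dx; apply/derivable_osc; apply/cvg_ex; exists y.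
rewrite (_ : (fun h : R => _) = (fun h => h^-1 *: (f (h + x) - f x)))//.
by apply/funext => h /=; rewrite [h *: 1]mulr1.
Qed.

Lemma clamp_continuous_ac a b f : a <= b -> abs_continuous a b f ->
  continuous (f \o clamp a b).
Proof.
move=> ab acf x; apply/cvgrPdist_lt => e e0; have [d d0 H] := abs_continuous_seq acf e0.
have key y z : y <= z -> z - y < d -> `|f (clamp a b z) - f (clamp a b y)| < e.
  move=> yz zyd; have := H [:: (clamp a b z, clamp a b y)].
  rewrite /interval_family/= !big_seq1/=; apply.
    have /andP[-> _] := clamp_itv y ab; have /andP[_ ->] := clamp_itv z ab.
    by rewrite clamp_nd.
  exact: le_lt_trans (clamp_lip _ _ yz) zyd.
apply/nbhs_ballP; exists d => //= y; rewrite /ball/=.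
have [xy|yx] := leP x y; first by rewrite distrC ger0_norm ?subr_ge0// => /(key _ _ xy); rewrite distrC.
by rewrite gtr0_norm ?subr_gt0// => /(key _ _ (ltW yx)).
Qed.

Lemma near_clamp a b f x : x \in `]a, b[ -> {near x, f \o clamp a b =1 f}.
Proof.
move=> /near_in_itvoo; apply: filterS => y; rewrite in_itv/= => /andP[ay yb].
by rewrite clamp_id// !ltW.
Qed.

Lemma measurable_derive1_ac a b f : a <= b -> abs_continuous a b f ->
  measurable_fun `]a, b[ (derive1 f).
Proof.
move=> ab acf; apply: (eq_measurable_fun (derive1 (f \o clamp a b))).
  move=> x; rewrite inE/= => xab; rewrite !derive1E.
  by apply: near_eq_derive; exact: near_clamp.
by apply: measurable_funTS; apply: measurable_derive1; exact: clamp_continuous_ac.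
Qed.

End MeasurableDerivative.

(** * Integrable and square integrable functions on []0, l[] *)

Section IntegrationOnInterval.
Context (R : realType) (l : R).
Implicit Types f g h k : R -> R.
Local Notation leb := (@lebesgue_measure R).
Local Notation I := (`]0, l[%classic : set R).

Definition L1 f := leb.-integrable I (EFin \o f).
Definition int f : R := \int[leb]_(x in I) f x.

Lemma ae_onW (P : R -> Prop) : (forall x, 0 < x < l -> P x) -> ae_on l P.
Proof. by move=> H; apply: aeW => x; rewrite /= in_itv/=; exact: H. Qed.

Lemma ae_onS (P T : R -> Prop) :
  (forall x, 0 < x < l -> P x -> T x) -> ae_on l P -> ae_on l T.
Proof.
move=> H; have FF := ae_filter_ringOfSetsType leb; rewrite /ae_on; apply: filterS.
by move=> x Px /= xI; apply: H; [move: xI; rewrite in_itv|exact: Px].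
Qed.

Lemma ae_onS2 (P Q T : R -> Prop) :
  (forall x, 0 < x < l -> P x -> Q x -> T x) -> ae_on l P -> ae_on l Q -> ae_on l T.
Proof.
move=> H; have FF := ae_filter_ringOfSetsType leb; rewrite /ae_on; apply: filterS2.
by move=> x Px Qx /= xI; apply: H; [move: xI; rewrite in_itv|exact: Px|exact: Qx].
Qed.

Lemma ae_onI (P Q : R -> Prop) : ae_on l P -> ae_on l Q -> ae_on l (fun x => P x /\ Q x).
Proof. by apply: ae_onS2. Qed.

Lemma L1_measurable f : L1 f -> measurable_fun I f.
Proof. by move=> /integrableP[/measurable_EFinP]. Qed.

Lemma L1_add f g : L1 f -> L1 g -> L1 (fun x => f x + g x).
Proof. exact: integrableD. Qed.

Lemma L1_scale c f : L1 f -> L1 (fun x => c * f x).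
Proof. exact: integrableZl. Qed.

Lemma L1_le f g : measurable_fun I f -> L1 g ->
  (forall x, 0 < x < l -> `|f x| <= g x) -> L1 f.
Proof.
move=> mf ig H; apply: (le_integrable _ _ _ ig) => //; first exact/measurable_EFinP.
move=> x; rewrite /= in_itv/= => xI; rewrite lee_fin.
exact: le_trans (H _ xI) (ler_norm _).
Qed.

Lemma L1_ae f g : measurable_fun I g -> L1 f -> ae_on l (fun x => f x = g x) -> L1 g.
Proof.
move=> mg iF fg; apply/integrableP; split; first exact/measurable_EFinP.
have /integrableP[mf] := iF; apply: le_lt_trans; apply: ae_ge0_le_integral => //=.
- by apply/measurable_EFinP; exact: measurableT_comp.
- by apply/measurable_EFinP; apply: measurableT_comp => //; exact/measurable_EFinP.
- have FF := ae_filter_ringOfSetsType leb; move: fg; rewrite /ae_on; apply: filterS.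
  by move=> x H /H /= ->.
Qed.

Lemma L1_cst c : L1 (fun=> c).
Proof.
apply/integrableP; split; first exact: measurable_cst.
rewrite /= integral_cst//= lebesgue_measure_itv/= lte_fin; case: ifP => _.
  by rewrite -EFinD -EFinM ltry.
by rewrite mule0.
Qed.

Lemma intD f g : L1 f -> L1 g -> int (fun x => f x + g x) = int f + int g.
Proof. exact: RintegralD. Qed.

Lemma intZ c f : L1 f -> int (fun x => c * f x) = c * int f.
Proof. by move=> iF; rewrite /int RintegralZl. Qed.

Lemma int_ae f g : measurable_fun I f -> measurable_fun I g ->
  ae_on l (fun x => f x = g x) -> int f = int g.
Proof.
move=> mf mg fg; rewrite /int /Rintegral; congr fine.
apply: ae_eq_integral => //; [exact/measurable_EFinP|exact/measurable_EFinP|].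
have FF := ae_filter_ringOfSetsType leb; move: fg; rewrite /ae_on; apply: filterS.
by move=> x H /H /= ->.
Qed.

Lemma eq_int f g : (forall x, 0 < x < l -> f x = g x) -> int f = int g.
Proof. by move=> H; apply: eq_Rintegral => x; rewrite inE/= in_itv/= => /H. Qed.

Lemma eq_L1 f g : (forall x, 0 < x < l -> f x = g x) -> L1 f -> L1 g.
Proof.
by move=> H; apply: eq_integrable => // x; rewrite inE/= in_itv/= => /H ->.
Qed.

Lemma int_ge0 f : (forall x, 0 < x < l -> 0 <= f x) -> 0 <= int f.
Proof. by move=> H; apply: Rintegral_ge0 => x; rewrite /= in_itv/= => /H. Qed.

(** Replacing [g] by the maximum of [f] and [g] changes it on a null set only and makes the
    inequality hold everywhere. *)
Lemma le_int f g : L1 f -> L1 g -> ae_on l (fun x => f x <= g x) -> int f <= int g.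
Proof.
move=> iF ig fg; have mf := L1_measurable iF; have mg := L1_measurable ig.
pose g' x := Num.max (f x) (g x).
have mg' : measurable_fun I g' by exact: measurable_maxr.
have gg' : ae_on l (fun x => g x = g' x).
  by apply: ae_onS fg => x _ fgx; rewrite /g' (max_idPr fgx).
have ig' : L1 g' := L1_ae mg' ig gg'.
rewrite (int_ae mg mg' gg'); apply: le_Rintegral => // x _.
by rewrite /g' le_max lexx.
Qed.

Lemma int_cst c : 0 <= l -> int (fun=> c) = l * c.
Proof.
move=> l0; rewrite /int /Rintegral integral_cst//= lebesgue_measure_itv/= lte_fin.
by case: ltgtP l0 => //= [_|<-] _; rewrite ?subr0 1?mulrC// ?mule0 ?mul0r.
Qed.

End IntegrationOnInterval.

Section SquareIntegrable.
Context (R : realType) (l : R).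
Implicit Types f g h k : R -> R.
Local Notation leb := (@lebesgue_measure R).
Local Notation I := (`]0, l[%classic : set R).
Local Notation L2 := (L2 l).
Local Notation L1 := (L1 l).
Local Notation int := (int l).

Lemma L2_measurable f : L2 f -> measurable_fun I f.
Proof. by case. Qed.

Lemma L2_sq f : L2 f -> L1 (fun x => f x ^+ 2).
Proof. by case. Qed.

Lemma L2_mul f g : L2 f -> L2 g -> L1 (fun x => f x * g x).
Proof.
move=> [mf if2] [mg ig2]; apply: (@L1_le _ _ _ (fun x => f x ^+ 2 + g x ^+ 2)).
- exact: measurable_funM.
- exact: L1_add.
move=> x _; rewrite ler_norml; apply/andP; split.
  by have := sqr_ge0 (f x + g x); nra.
by have := sqr_ge0 (f x - g x); nra.
Qed.

Lemma L2_ae f g : measurable_fun I g -> L2 f -> ae_on l (fun x => f x = g x) -> L2 g.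
Proof.
move=> mg [mf if2] fg; split => //; apply: L1_ae if2 _; first exact: measurable_funX.
by apply: ae_onS fg => x _ ->.
Qed.

Lemma eq_L2 f g : (forall x, 0 < x < l -> f x = g x) -> L2 f -> L2 g.
Proof.
move=> fg Hf; apply: (L2_ae _ Hf); last exact: ae_onW.
apply: eq_measurable_fun (L2_measurable Hf) => x.
by rewrite inE/= in_itv/= => /fg.
Qed.

Lemma L2_add f g : L2 f -> L2 g -> L2 (fun x => f x + g x).
Proof.
move=> Lf Lg; have [mf if2] := Lf; have [mg ig2] := Lg; split.
  exact: measurable_funD.
apply: (@eq_L1 _ _ (fun x => (f x ^+ 2 + g x ^+ 2) + 2 * (f x * g x))).
  by move=> x _; ring.
by apply: L1_add; [exact: L1_add|apply: L1_scale; exact: L2_mul].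
Qed.

Lemma L2_bmul C k f : measurable_fun I k -> (forall x, 0 < x < l -> `|k x| <= C) ->
  L2 f -> L2 (fun x => k x * f x).
Proof.
move=> mk kC [mf if2]; split; first exact: measurable_funM.
apply: (@L1_le _ _ _ (fun x => C ^+ 2 * f x ^+ 2)).
- by apply: measurable_funX; exact: measurable_funM.
- exact: L1_scale.
move=> x xI; rewrite ger0_norm ?sqr_ge0// exprMn ler_wpM2r ?sqr_ge0//.
by rewrite -[k x ^+ 2]real_normK ?num_real// lerXn2r ?nnegrE//; rewrite ?(le_trans _ (kC _ xI))// kC.
Qed.

Lemma L2_scale c f : L2 f -> L2 (fun x => c * f x).
Proof. by apply: (L2_bmul (C := `|c|)) => //; exact: measurable_cst. Qed.

Lemma L2_lin a b f g : L2 f -> L2 g -> L2 (fun x => a * f x + b * g x).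
Proof. by move=> Lf Lg; apply: L2_add; exact: L2_scale. Qed.

Lemma L2_cst c : L2 (fun=> c).
Proof. by split; [exact: measurable_cst|exact: L1_cst]. Qed.

Lemma L2_L1 f : L2 f -> L1 f.
Proof.
move=> Lf; apply: eq_L1 (L2_mul (L2_cst 1) Lf) => x _.
by rewrite mul1r.
Qed.

Lemma int_sq_ge0 f : 0 <= int (fun x => f x ^+ 2).
Proof. by apply: int_ge0 => x _; exact: sqr_ge0. Qed.

Lemma int_sqD f g t : L2 f -> L2 g -> int (fun x => (f x + t * g x) ^+ 2) =
  int (fun x => f x ^+ 2) + 2 * t * int (fun x => f x * g x) + t ^+ 2 * int (fun x => g x ^+ 2).
Proof.
move=> Lf Lg; have fg := L2_mul Lf Lg.
rewrite (@eq_int _ _ _ (fun x => (f x ^+ 2 + (2 * t) * (f x * g x)) + t ^+ 2 * g x ^+ 2)).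
  rewrite intD ?intD ?intZ//; try exact: L2_sq; try (apply: L1_scale => //; exact: L2_sq).
  by apply: L1_add; [exact: L2_sq|exact: L1_scale].
by move=> x _; ring.
Qed.

(** The polynomial [a + 2 t b + t^2 c] is the integral of [(f + t g)^2], hence nonnegative for all
    [t]. *)
Lemma cauchy_schwarz_int f g : L2 f -> L2 g ->
  int (fun x => f x * g x) ^+ 2 <= int (fun x => f x ^+ 2) * int (fun x => g x ^+ 2).
Proof.
move=> Lf Lg; set b := int _; set a := int _; set c := int _.
have H t : 0 <= a + 2 * t * b + t ^+ 2 * c by rewrite -int_sqD//; exact: int_sq_ge0.
have a0 : 0 <= a by exact: int_sq_ge0.
have [c0|] := ltP 0 c.
  have := H (- b / c).
  have -> : a + 2 * (- b / c) * b + (- b / c) ^+ 2 * c = (a * c - b ^+ 2) / c.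
    by field; rewrite gt_eqF.
  by rewrite pmulr_lge0 ?invr_gt0// subr_ge0.
have c0 : 0 <= c by exact: int_sq_ge0.
move=> c0'; have cE : c = 0 by apply/eqP; rewrite eq_le c0 c0'.
rewrite cE mulr0; have [->|b0] := eqVneq b 0; first by rewrite expr0n.
(* With [c = 0] the polynomial is affine in [t]; this [t] gives it the value [-1]. *)
have := H (- (a + 1) / (2 * b)).
have -> : a + 2 * (- (a + 1) / (2 * b)) * b + (- (a + 1) / (2 * b)) ^+ 2 * c = -1.
  by rewrite cE; field.
by rewrite lerNr oppr0 ler10.
Qed.

End SquareIntegrable.

(** * Calculus of absolutely continuous functions up to the end [x = 0] *)

Section AbsContinuousAlgebra.
Context (R : realType).
Implicit Types (a b c : R) (f g : R -> R).

Lemma abs_continuous_ext a b f g : (forall x, a <= x <= b -> f x = g x) ->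
  abs_continuous a b f -> abs_continuous a b g.
Proof.
move=> fg acf e e0; have [d d0 H] := acf e e0; exists d => // n u v uv dis s.
rewrite (eq_bigr (fun i => `|f (v i) - f (u i)|)); first exact: H.
move=> i _; have [au [uvi vb]] := uv i.
by rewrite !fg// ?au ?vb ?(le_trans au)// (le_trans uvi).
Qed.

(** Sums, products and the reciprocal of a coefficient are all instances: their increments are
    dominated by those of the given functions. *)
Lemma abs_continuous_le a b f g h (C D : R) :
  (forall x y, a <= x -> x <= y -> y <= b ->
     `|h y - h x| <= C * `|f y - f x| + D * `|g y - g x|) -> 0 <= C -> 0 <= D ->
  abs_continuous a b f -> abs_continuous a b g -> abs_continuous a b h.
Proof.
move=> H C0 D0 acf acg e e0.
have p1 : 0 < C + D + 1 by rewrite ltr_wpDl// addr_ge0.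
have e' : 0 < e / (C + D + 1) by rewrite divr_gt0.
have [d1 d10 H1] := acf _ e'; have [d2 d20 H2] := acg _ e'.
exists (Num.min d1 d2) => [|n u v uv dis]; first by rewrite lt_min d10.
rewrite lt_min => /andP[s1 s2]; have := H1 n u v uv dis s1; have := H2 n u v uv dis s2.
set sf := \sum_(i < n) _; set sg := \sum_(i < n) _ => gs fs.
apply: (@le_lt_trans _ _ (C * sg + D * sf)).
  rewrite /sf /sg !mulr_sumr -big_split/=; apply: ler_sum => i _.
  by have [au [uvi vb]] := uv i; exact: H.
have eE : e = C * (e / (C + D + 1)) + D * (e / (C + D + 1)) + e / (C + D + 1).
  by field; rewrite gt_eqF.
move: e' gs fs eE; move: (e / _) => r r0 gs fs ->.
have h1 : C * sg <= C * r by rewrite ler_wpM2l// ltW.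
have h2 : D * sf <= D * r by rewrite ler_wpM2l// ltW.
lra.
Qed.

Lemma abs_continuous_bounded a b f : abs_continuous a b f ->
  exists2 M, 0 <= M & forall x, a <= x <= b -> `|f x| <= M.
Proof.
move=> acf; have [ab|ba] := leP a b; last first.
  by exists 0 => // x /andP[ax xb]; have := lt_le_trans ba (le_trans ax xb); rewrite ltxx.
have bv := abs_continuous_bounded_variation ab acf.
exists (`|f a| + fine (total_variation a b f)).
  by rewrite addr_ge0// fine_ge0// total_variation_ge0.
move=> x /andP[ax xb]; rewrite -[f x](subrK (f a)) addrC (le_trans (ler_normD _ _))// lerD2l.
have bvx := bounded_variationl ax xb bv.
have bvx' := bounded_variationr ax xb bv.
rewrite (total_variationD f ax xb) fineD; last 2 first.
  exact/bounded_variationP.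
  exact/bounded_variationP.
rewrite -[leLHS]addr0; apply: lerD; last by rewrite fine_ge0// total_variation_ge0.
rewrite -lee_fin fineK; first exact: total_variation_ge.
exact/bounded_variationP.
Qed.

Lemma abs_continuousD a b f g : abs_continuous a b f -> abs_continuous a b g ->
  abs_continuous a b (fun x => f x + g x).
Proof.
apply: (@abs_continuous_le _ _ _ _ _ 1 1) => // x y _ _ _.
by rewrite !mul1r opprD addrACA ler_normD.
Qed.

Lemma abs_continuousM a b f g : abs_continuous a b f -> abs_continuous a b g ->
  abs_continuous a b (fun x => f x * g x).
Proof.
move=> acf acg; have [M M0 fM] := abs_continuous_bounded acf.
have [N N0 gN] := abs_continuous_bounded acg.
apply: (@abs_continuous_le _ _ f g _ N M) => // x y ax xy yb.
have -> : f y * g y - f x * g x = g y * (f y - f x) + f x * (g y - g x) by ring.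
rewrite (le_trans (ler_normD _ _))// !normrM lerD// ler_wpM2r//.
  by apply: gN; rewrite (le_trans ax).
by apply: fM; rewrite ax (le_trans xy).
Qed.

Lemma abs_continuous_lip a b f (C : R) : 0 <= C ->
  (forall x y, a <= x -> x <= y -> y <= b -> `|f y - f x| <= C * (y - x)) ->
  abs_continuous a b f.
Proof.
move=> C0 H e e0; exists (e / (C + 1)).
  by rewrite divr_gt0// ltr_wpDl.
move=> n u v uv dis s; apply: (@le_lt_trans _ _ (C * \sum_(i < n) (v i - u i))).
  rewrite mulr_sumr; apply: ler_sum => i _; have [au [uvi vb]] := uv i; exact: H.
have p1 : 0 < C + 1 by rewrite ltr_wpDl.
have e' : 0 < e / (C + 1) by rewrite divr_gt0.
have eE : e = C * (e / (C + 1)) + e / (C + 1) by field; rewrite gt_eqF.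
move: e' s eE; move: (e / _) => r r0 s ->.
have h1 : C * (\sum_(i < n) (v i - u i)) <= C * r by rewrite ler_wpM2l// ltW.
lra.
Qed.

End AbsContinuousAlgebra.

Section LocallyAbsContinuous.
Context (R : realType) (l : R) (l_gt0 : 0 < l).
Implicit Types (f g h : R -> R).
Local Notation leb := (@lebesgue_measure R).
Local Notation I := (`]0, l[%classic : set R).
Local Notation L1 := (L1 l).
Local Notation int := (int l).

Lemma interval_bigcup : I = \bigcup_n `]l / n.+2%:R, l[%classic.
Proof.
apply/seteqP; split => x /=; rewrite in_itv/=.
  move=> /andP[x0 xl]; exists (Num.bound (l / x)) => //=; rewrite in_itv/= xl andbT.
  rewrite ltr_pdivrMr// mulrC -ltr_pdivrMr//.
  by rewrite (lt_trans (archi_boundP _))// ?divr_ge0 ?ltW// ltr_nat.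
by move=> [n _]/=; rewrite in_itv/= => /andP[nx ->]; rewrite (lt_trans _ nx)// divr_gt0.
Qed.

Lemma cut_itv n : 0 < l / n.+2%:R < l.
Proof. by rewrite divr_gt0//= ltr_pdivrMr// ltr_pMr// ltr1n. Qed.

Lemma cut_itvW n : 0 < l / n.+2%:R <= l.
Proof. by have /andP[-> /ltW] := cut_itv n. Qed.

Lemma ae_on_bigcup (P : R -> Prop) :
  (forall n, {ae leb, forall x, `]l / n.+2%:R, l[%classic x -> P x}) -> ae_on l P.
Proof.
move=> H; have : {ae leb, forall x n, `]l / n.+2%:R, l[%classic x -> P x}.
  exact: ae_foralln.
have FF := ae_filter_ringOfSetsType leb; rewrite /ae_on; apply: filterS => x Hx.
by rewrite interval_bigcup => -[n _ xn]; exact: Hx xn.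
Qed.

Lemma loc_ac_derivable f : loc_abs_continuous l f -> ae_on l (fun x => derivable f x 1).
Proof.
move=> acf; apply: ae_on_bigcup => n.
have /andP[n0 nl] := cut_itv n.
have [h [_ _]] := abs_continuous_FTC nl (acf _ (cut_itvW n)).
have FF := ae_filter_ringOfSetsType leb; apply: filterS => x H /H.
by case.
Qed.

Lemma loc_ac_measurable_derive1 f : loc_abs_continuous l f -> measurable_fun I (derive1 f).
Proof.
move=> acf; rewrite interval_bigcup; apply/measurable_fun_bigcup => // n.
have /andP[n0 nl] := cut_itv n.
by apply: measurable_derive1_ac; [exact: ltW|exact: acf (cut_itvW n)].
Qed.

Lemma loc_ac_continuous_at f x : loc_abs_continuous l f -> 0 < x < l ->
  {for x, continuous f}.
Proof.
move=> acf /andP[x0 xl].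
have hx : 0 < x / 2 <= l by apply/andP; split; lra.
have cf : {for x, continuous (f \o clamp (x / 2) l)}.
  by apply: clamp_continuous_ac; [lra|exact: acf].
have xI : x \in `]x / 2, l[ by rewrite in_itv/=; lra.
have nf := near_clamp f xI.
rewrite /prop_for /continuous_at -(nbhs_singleton nf).
by apply: cvg_trans cf; apply: near_eq_cvg; move: nf; apply: filterS => y ->.
Qed.

Lemma loc_ac_measurable f : loc_abs_continuous l f -> measurable_fun I f.
Proof.
move=> acf; apply: open_continuous_measurable_fun; first exact: interval_open.
by move=> x; rewrite inE/= in_itv/= => /(loc_ac_continuous_at acf).
Qed.

Lemma loc_ac_FTC f g : loc_abs_continuous l f -> L1 g ->
  ae_on l (fun x => derive1 f x = g x) ->
  forall x, 0 < x <= l -> f l - f x = \int[leb]_(t in `]x, l[) g t.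
Proof.
move=> acf ig fg x xI; have [xl|lx] := ltP x l; last first.
  have -> : x = l by apply/eqP; rewrite eq_le lx; case/andP: xI => _ ->.
  by rewrite subrr set_itvoo0// Rintegral_set0.
have [h [ih hE hae]] := abs_continuous_FTC xl (acf x xI).
rewrite hE// ?ltW// -Rintegral_itv_bndo_bndc; last exact: integrableS ih.
rewrite /Rintegral; congr fine; have sub : `]x, l[ `<=` I.
  by apply: subset_itvr; rewrite bnd_simp; case/andP: xI => /ltW.
apply: ae_eq_integral => //.
- by apply/measurable_EFinP; apply: measurable_funTS; case/integrableP: ih => /measurable_EFinP.
- by apply/measurable_EFinP; exact: measurable_funS (L1_measurable ig).
have FF := ae_filter_ringOfSetsType leb; move: fg hae; rewrite /ae_on; apply: filterS2.
by move=> t H1 H2 xt; rewrite -H1; [have [_ ->] := H2 xt|exact: sub].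
Qed.

Lemma int_tail_cvg g : L1 g -> \int[leb]_(t in `]x, l[) g t @[x --> 0^'+] --> int g.
Proof.
move=> ig; pose G := g \_ I.
have iG : leb.-integrable setT (EFin \o G).
  by move: ig; rewrite integrable_mkcond//= restrict_EFin.
have iG0 : leb.-integrable `[0, l] (EFin \o G) by exact: integrableS iG.
have c0 := parameterized_integral_cvg_left l_gt0 iG0.
have E x : 0 < x < l -> int g - parameterized_integral leb 0 x G = \int[leb]_(t in `]x, l[) g t.
  move=> /andP[x0 xl].
  rewrite -(@Rintegral_itvB _ g (BRight 0) (BLeft l) x ig) ?bnd_simp ?ltW//.
  congr (_ - _); rewrite /parameterized_integral -Rintegral_itv_obnd_cbnd; last exact: integrableS iG.
  apply: eq_Rintegral => t; rewrite inE/= in_itv/= => /andP[t0 tx].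
  by rewrite /G patchE mem_set//= in_itv/= t0 (le_lt_trans tx).
have c1 : int g - parameterized_integral leb 0 x G @[x --> 0^'+] --> int g - 0.
  by apply: cvgB; [exact: cvg_cst|exact: cvg_at_right_filter].
rewrite -[X in _ --> X]subr0; apply: cvg_trans c1; apply: near_eq_cvg; near=> x.
apply: E; apply/andP; split; near: x; [exact: nbhs_right_gt|exact: nbhs_right_lt].
Unshelve. all: by end_near. Qed.

(** Integrability of the derivative up to 0 gives a function controlled only on []0, l]] a trace at
    0. *)
Lemma FTC_cvg0 f g : loc_abs_continuous l f -> L1 g ->
  ae_on l (fun x => derive1 f x = g x) -> f x @[x --> 0^'+] --> f l - int g.
Proof.
move=> acf ig fg; have := int_tail_cvg ig => /(cvgB (cvg_cst (f l))).
apply: cvg_trans; apply: near_eq_cvg; near=> x.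
have xI : 0 < x <= l by apply/andP; split; near: x; [exact: nbhs_right_gt|exact: nbhs_right_le].
have E := loc_ac_FTC acf ig fg xI; change (f l - \int[leb]_(t in `]x, l[) g t = f x); lra.
Unshelve. all: by end_near. Qed.

Lemma FTC_eq f g : loc_abs_continuous l f -> L1 g ->
  ae_on l (fun x => derive1 f x = g x) -> f x @[x --> 0^'+] --> 0 -> int g = f l.
Proof.
move=> acf ig fg f0; have := FTC_cvg0 acf ig fg.
by move=> /(cvg_unique _ f0) => H; have := H (@Rhausdorff _); lra.
Qed.

(** Serves identities whose boundary term at 0 has a sign: the nonnegative part [f - h] is discarded
    and only [h] has to vanish in the limit. *)
Lemma FTC_le f g h : loc_abs_continuous l f -> L1 g ->
  ae_on l (fun x => derive1 f x = g x) -> h x @[x --> 0^'+] --> 0 ->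
  (forall x, 0 < x < l -> h x <= f x) -> int g <= f l.
Proof.
move=> acf ig fg h0 hf; have c := FTC_cvg0 acf ig fg.
rewrite -subr_ge0; apply: ler_cvg_to h0 c _; near=> x; apply: hf.
by apply/andP; split; near: x; [exact: nbhs_right_gt|exact: nbhs_right_lt].
Unshelve. all: by end_near. Qed.

Lemma loc_acD f g : loc_abs_continuous l f -> loc_abs_continuous l g ->
  loc_abs_continuous l (fun x => f x + g x).
Proof. by move=> Hf Hg x xl; apply: abs_continuousD; [exact: Hf|exact: Hg]. Qed.

Lemma loc_acM f g : loc_abs_continuous l f -> loc_abs_continuous l g ->
  loc_abs_continuous l (fun x => f x * g x).
Proof. by move=> Hf Hg x xl; apply: abs_continuousM; [exact: Hf|exact: Hg]. Qed.

Lemma loc_ac_cst (c : R) : loc_abs_continuous l (fun=> c).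
Proof.
by move=> x xl; apply: (@abs_continuous_lip _ _ _ _ 0) => // *; rewrite subrr normr0 mul0r.
Qed.

Lemma loc_ac_id : loc_abs_continuous l id.
Proof.
by move=> x xl; apply: (@abs_continuous_lip _ _ _ _ 1) => // u v *; rewrite mul1r ger0_norm// subr_ge0.
Qed.

Lemma loc_acZ c f : loc_abs_continuous l f -> loc_abs_continuous l (fun x => c * f x).
Proof. by move=> Hf; apply: loc_acM => //; exact: loc_ac_cst. Qed.

Lemma loc_ac_ext f g : (forall x, 0 < x <= l -> f x = g x) ->
  loc_abs_continuous l f -> loc_abs_continuous l g.
Proof.
move=> fg Hf x /andP[x0 xl]; apply: (@abs_continuous_ext _ _ _ f).
  by move=> y /andP[xy yl]; apply: fg; rewrite (lt_le_trans x0).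
by apply: Hf; rewrite x0.
Qed.

(** If [|f - g|] were positive at [x], continuity would keep it positive on an interval ending at
    [x], which has positive measure. Looking to the left of [x] includes the case [x = l], so almost
    everywhere equality passes to traces at [l]. *)
Lemma loc_ac_ae_eq f g : loc_abs_continuous l f -> loc_abs_continuous l g ->
  ae_on l (fun x => f x = g x) -> forall x, 0 < x <= l -> f x = g x.
Proof.
move=> acf acg fg x xI; apply/eqP/negP => /negP fgx.
have hI : 0 < x / 2 <= l by move: xI => /andP[]; lra.
have h2l : x / 2 <= l by case/andP: hI.
pose d y := `|f (clamp (x / 2) l y) - g (clamp (x / 2) l y)|.
have cd : continuous d.
  move=> y; apply: cvg_norm; apply: cvgB.
    exact: (clamp_continuous_ac h2l (acf _ hI)).
  exact: (clamp_continuous_ac h2l (acg _ hI)).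
have cx : clamp (x / 2) l x = x by apply: clamp_id; move: xI => /andP[]; lra.
have dx : 0 < d x by rewrite /d cx normr_gt0 subr_eq0.
have /nbhs_ballP[e /= e0 He] : \forall y \near x, 0 < d y.
  by apply: (cvgr_gt _ (cd x)).
have [A [mA A0 HA]] := fg.
pose u := Num.max (x - e) (x / 2).
have ux : u < x by rewrite /u gt_max; move: xI => /andP[]; lra.
have : (leb `]u, x[ <= leb A)%E.
  apply: le_measure; rewrite ?inE//; apply: subset_trans HA => y /=.
  rewrite in_itv/= /u gt_max -andbA => /and3P[yxe yx2 yx] /= H.
  have /He : ball x e y by rewrite /ball/= gtr0_norm; lra.
  rewrite /d clamp_id; last by move: xI => /andP[]; lra.
  rewrite H ?subrr ?normr0 ?ltxx//= in_itv/=; move: xI => /andP[]; lra.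
by rewrite A0 lebesgue_measure_itv/= lte_fin ux -EFinD lee_fin leNgt subr_gt0 ux.
Qed.

End LocallyAbsContinuous.

Lemma int_bmul_le (R : realType) (l c : R) (k f : R -> R) :
  measurable_fun (`]0, l[%classic : set R) k -> (forall x, 0 < x < l -> `|k x| <= c) ->
  L2 l f -> int l (fun x => (k x * f x) ^+ 2) <= c ^+ 2 * int l (fun x => f x ^+ 2).
Proof.
move=> mk kc Lf; rewrite -intZ; last exact: L2_sq.
apply: le_int; [exact: L2_sq (L2_bmul mk kc Lf)|by apply: L1_scale; exact: L2_sq|].
apply: ae_onW => x xI; rewrite exprMn ler_wpM2r ?sqr_ge0//.
by rewrite -[k x ^+ 2]real_normK ?num_real// lerXn2r ?nnegrE//; [exact: le_trans (kc x xI)|exact: kc].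
Qed.

Lemma L2_idM (R : realType) (l : R) (f : R -> R) : L2 l f -> L2 l (fun x => x * f x).
Proof.
move=> Lf; apply: (L2_bmul (k := id) (C := l)) Lf; first exact: measurable_id.
by move=> x /andP[x0 xl]; rewrite ger0_norm ltW.
Qed.

Lemma loc_ac_bounded_L2 (R : realType) (l C : R) (y : R -> R) : loc_abs_continuous l y ->
  (forall x, 0 < x <= l -> `|y x| <= C) -> L2 l y.
Proof.
move=> acy yC.
have h := L2_bmul (loc_ac_measurable acy) (_ : forall x, 0 < x < l -> `|y x| <= C) (L2_cst l 1).
apply: eq_L2 (h _) => x; first by rewrite mulr1.
by move=> /andP[x0 xl]; apply: yC; rewrite x0 ltW.
Qed.

Lemma sq_sub_le_int (R : realType) (l : R) (f g : R -> R) : 0 < l -> L2 l f -> L2 l g ->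
  int l (fun x => (f x - x * g x) ^+ 2) <=
  2 * int l (fun x => f x ^+ 2) + 2 * l ^+ 2 * int l (fun x => g x ^+ 2).
Proof.
move=> l0 Lf Lg; have Lf2 := L2_sq Lf; have Lg2 := L2_sq Lg.
rewrite -!intZ// -intD; [|exact: L1_scale..].
have Lxg := L2_idM Lg.
have Ld : L2 l (fun x => f x - x * g x).
  by apply: eq_L2 (L2_lin 1 (-1) Lf Lxg) => x _; rewrite mul1r mulN1r.
apply: le_int; [exact: L2_sq Ld|by apply: L1_add; exact: L1_scale|].
apply: ae_onW => x /andP[x0 xl]; have h := sqr_ge0 (f x + x * g x).
have xx : x ^+ 2 <= l ^+ 2 by rewrite lerXn2r ?nnegrE ?ltW.
have := ler_wpM2r (sqr_ge0 (g x)) xx; nra.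
Qed.

(** * Coefficients of class [classA] *)

Section RelativeDerivative.
Context (R : realType).

Lemma within_dnbhs_nbhs (A : set R) (x : R) : nbhs x A -> within A (dnbhs x) = dnbhs x.
Proof.
move=> nA; have FA : dnbhs x A by apply: filterS nA => y Ay _.
apply/seteqP; split => P; rewrite /within /= => FP.
  by apply: filterS2 FP FA => y; apply.
by apply: filterS FP => y Py _.
Qed.

Lemma deriv_in_interior (A : set R) (f : R -> R) (x : R) : nbhs x A ->
  derivable_in A f x -> derivable f x 1 /\ derive1 f x = deriv_in A f x.
Proof.
move=> nA /cvg_ex[/= L HL].
have E : deriv_in A f x = L.
  by rewrite /deriv_in; move: HL; rewrite within_dnbhs_nbhs// => HL; exact: cvg_lim.
have /nbhs_ballP[r /= r0 Ar] := nA.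
have c : h^-1 *: (f (h + x) - f x) @[h --> 0^'] --> L.
  move/cvgrPdist_lt : HL => HL; apply/cvgrPdist_lt => e e0.
  have /nbhs_ballP[d /= d0 Hd] := HL e e0.
  apply/nbhs_ballP; exists (Num.min r d); first by rewrite /= lt_min r0.
  move=> h; rewrite /ball/= sub0r normrN lt_min => /andP[hr hd] h0.
  have hx : h + x - x = h by rewrite addrK.
  have := Hd (h + x); rewrite /ball/= opprD addrCA subrr addr0 normrN => /(_ hd).
  rewrite -subr_eq0 hx => /(_ h0) => Hx.
  rewrite (_ : h^-1 *: _ = (f (h + x) - f x) / h); last exact: mulrC.
  apply: Hx.
  by apply: Ar; rewrite /ball/= opprD addrCA subrr addr0 normrN.
split; last by rewrite E /derive1; apply: cvg_lim.
apply/cvg_ex; exists L; apply: cvg_trans c; apply: near_eq_cvg; near=> h.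
by rewrite /= [h *: 1]mulr1.
Unshelve. all: by end_near. Qed.

End RelativeDerivative.

Section DegenerateCoefficient.
Context (R : realType) (l : R) (l_gt0 : 0 < l) (a : R -> R) (m : R).
Context (aA : classA l a) (am : mu l a <= m) (m2 : m < 2).
Local Notation leb := (@lebesgue_measure R).
Local Notation I := (`]0, l[%classic : set R).

Lemma coef_gt0 x : 0 < x <= l -> 0 < a x.
Proof. by case: aA => _ H _ _ _; exact: H. Qed.

Lemma coef_continuous : {within `[0, l], continuous a}.
Proof. by case: aA => -[[H _] _] _ _ _ _. Qed.

Lemma coef_derivable x : 0 < x < l -> derivable a x 1.
Proof.
move=> /[dup] xI /andP[x0 xl]; case: aA => -[_ [_ [H _]]] _ _ _ _.
have xA : (`]0, l]%classic : set R) x by rewrite /= in_itv/= x0 ltW.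
have nA : nbhs x (`]0, l]%classic : set R).
  have /near_in_itvoo : x \in `]0, l[ by rewrite in_itv/= x0.
  by apply: filterS => y /=; rewrite !in_itv/= => /andP[-> /ltW].
by have [] := deriv_in_interior nA (H x xA).
Qed.

Lemma coef_derive_le x : 0 < x < l -> x * `|derive1 a x| <= m * a x.
Proof.
move=> /[dup] xI /andP[x0 xl]; have xIl : 0 < x <= l by rewrite x0 ltW.
have nA : nbhs x (`[0, l]%classic : set R).
  have /near_in_itvoo : x \in `]0, l[ by rewrite in_itv/= x0.
  by apply: filterS => y /=; rewrite !in_itv/= => /andP[/ltW -> /ltW].
(* The class grants derivability relative to []0, l]], whereas [mu] is built with the derivative
   relative to [[0, l]]; at interior points the two filters coincide. *)
have dI : derivable_in `[0, l] a x.
  have nA' : nbhs x (`]0, l]%classic : set R).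
    have /near_in_itvoo : x \in `]0, l[ by rewrite in_itv/= x0.
    by apply: filterS => y /=; rewrite !in_itv/= => /andP[-> /ltW].
  case: aA => -[_ [_ [H _]]] _ _ _ _; move: (H x); rewrite /= in_itv/= xIl => /(_ isT).
  by rewrite /derivable_in !within_dnbhs_nbhs.
have [_ ->] := deriv_in_interior nA dI.
rewrite -ler_pdivrMr ?coef_gt0//; apply: le_trans am.
case: aA => _ _ _ [hub _] _; apply: ub_le_sup => //.
by exists x => //=; rewrite in_itv.
Qed.

Lemma coef_le_supnorm x : 0 <= x <= l -> a x <= supnorm l a.
Proof.
move=> xI; rewrite /supnorm.
have [c cI Hc] := EVT_max (ltW l_gt0) coef_continuous.
have a0 y : 0 <= y <= l -> 0 <= a y.
  rewrite le_eqVlt => /andP[/predU1P[<-|y0] yl]; first by case: aA => _ _ ->.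
  by apply/ltW/coef_gt0; rewrite y0.
apply: le_trans (ler_norm _) _; apply: ub_le_sup; last by exists x => //=; rewrite in_itv.
exists (a c) => _ [y /= yI <-]; move: yI; rewrite in_itv/= => yI.
by rewrite ger0_norm ?a0//; apply: Hc; rewrite in_itv.
Qed.

(** At an intermediate point [c >= z] the slope is at most [m a(c) / c] by [coef_derive_le]. The
    Lipschitz constant degenerates as [z] tends to 0, hence only local absolute continuity. *)
Lemma coef_MVT_bound x y (z : R) : 0 < z -> z <= x -> x <= y -> y <= l ->
  `|a y - a x| <= m * supnorm l a / z * (y - x).
Proof.
move=> z0 zx; rewrite le_eqVlt => /predU1P[<- _|xy yl].
  by rewrite !subrr normr0 mulr0.
have x0 := lt_le_trans z0 zx.
have cI c : c \in `]x, y[ -> 0 < c < l.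
  by rewrite in_itv/= => /andP[xc cy]; rewrite (lt_trans x0)//= (lt_le_trans cy).
have [||c cxy ->] := @MVT R a (derive1 a) x y xy.
- move=> c /cI /coef_derivable dc; rewrite derive1E; exact: derivableP.
- apply: continuous_subspaceW coef_continuous => t /=; rewrite !in_itv/= => /andP[xt ty].
  by rewrite (le_trans (ltW x0))//= (le_trans ty).
rewrite normrM [`|y - x|]gtr0_norm ?subr_gt0//; apply: ler_wpM2r; first by rewrite subr_ge0 ltW.
have cl := cI c cxy; have c0 : 0 < c by case/andP: cl.
have zc : z <= c by move: cxy; rewrite in_itv/= => /andP[xc _]; rewrite (le_trans zx)// ltW.
rewrite ler_pdivlMr//; apply: (@le_trans _ _ (c * `|derive1 a c|)).
  by rewrite mulrC ler_wpM2r.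
apply: le_trans (coef_derive_le cl) _.
have m0 : 0 <= m * a c by apply: le_trans (coef_derive_le cl); rewrite mulr_ge0// ltW.
have ac : 0 < a c by apply: coef_gt0; case/andP: cl => -> /ltW.
rewrite ler_wpM2l//; first by move: m0; rewrite pmulr_lge0.
by apply: coef_le_supnorm; case/andP: cl => /ltW -> /ltW.
Qed.

Lemma coef_ac : loc_abs_continuous l a.
Proof.
move=> x /andP[x0 xl].
have m0 : 0 <= m * supnorm l a / x.
  have lI : 0 < l / 2 < l by apply/andP; split; have := l_gt0; lra.
  have al : 0 < a (l / 2) by apply: coef_gt0; case/andP: lI => -> /ltW.
  rewrite divr_ge0// ?(ltW x0)// mulr_ge0//.
    have : 0 <= m * a (l / 2) by apply: le_trans (coef_derive_le lI); rewrite mulr_ge0// ltW//; case/andP: lI.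
    by rewrite pmulr_lge0.
  apply: le_trans (ltW al) _; apply: coef_le_supnorm; case/andP: lI => /ltW -> /ltW//.
by apply: abs_continuous_lip m0 _ => u v xu uv vl; exact: coef_MVT_bound.
Qed.

(** On [[x, l]] the coefficient has a positive minimum, attained at [c], so increments of [1 / a]
    are at most [a(c)^-2] times those of [a]. *)
Lemma coefV_ac : loc_abs_continuous l (fun x => (a x)^-1).
Proof.
move=> x /[dup] xI /andP[x0 xl].
have cx : {within `[x, l], continuous a}.
  apply: continuous_subspaceW coef_continuous => t /=; rewrite !in_itv/= => /andP[xt ->].
  by rewrite (le_trans (ltW x0)).
have [c cI Hc] := EVT_min xl cx.
have pos t : x <= t <= l -> 0 < a t.
  by move=> /andP[xt tl]; apply: coef_gt0; rewrite (lt_le_trans x0).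
have ac : 0 < a c by apply: pos; move: cI; rewrite in_itv.
apply: (@abs_continuous_le _ _ _ a a _ ((a c)^-1 ^+ 2) 0) => //; try exact: coef_ac.
- move=> u v xu uv vl; rewrite mul0r addr0.
  have au : 0 < a u by apply: pos; rewrite xu (le_trans uv).
  have av : 0 < a v by apply: pos; rewrite vl (le_trans xu).
  have -> : (a v)^-1 - (a u)^-1 = ((a v)^-1 * (a u)^-1) * - (a v - a u).
    by field; rewrite !gt_eqF.
  rewrite normrM normrN ler_wpM2r// ger0_norm; last by rewrite mulr_ge0// invr_ge0 ltW.
  rewrite expr2; apply: ler_pM; rewrite ?invr_ge0 ?(ltW au) ?(ltW av)// lef_pV2 ?posrE//;
    apply: Hc; rewrite in_itv/=.
    by rewrite vl (le_trans xu).
  by rewrite xu (le_trans uv).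
- by rewrite exprn_ge0// invr_ge0 ltW.
Qed.

Lemma loc_ac_le (f : R -> R) x : loc_abs_continuous l f -> ae_on l (fun x => 0 <= derive1 f x) ->
  0 < x <= l -> f x <= f l.
Proof.
move=> acf fpos xI; have [xl|lx] := ltP x l; last first.
  by rewrite (_ : x = l)//; apply/eqP; rewrite eq_le lx; case/andP: xI => _ ->.
rewrite -subr_ge0.
have [h [ih hE hae]] := abs_continuous_FTC xl (acf x xI).
rewrite (hE _ _ (lexx x) (ltW xl) (lexx l)) -Rintegral_itv_bndo_bndc; last exact: integrableS ih.
have x0 : 0 < x by case/andP: xI.
pose h' t := Num.max (h t) 0.
have mh : measurable_fun setT h by case/integrableP: ih => /measurable_EFinP.
suff -> : \int[leb]_(t in `]x, l[) h t = \int[leb]_(t in `]x, l[) h' t.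
  by apply: Rintegral_ge0 => t _; rewrite /h' le_max lexx orbT.
rewrite /Rintegral; congr fine; apply: ae_eq_integral => //.
- by apply/measurable_EFinP; apply: measurable_funTS.
- by apply/measurable_EFinP; apply: measurable_funTS; exact: measurable_maxr.
have FF := ae_filter_ringOfSetsType leb; move: fpos hae; rewrite /ae_on; apply: filterS2.
move=> t H1 H2 xt; have [_ E] := H2 xt; rewrite /h' (max_idPl _)// -E; apply: H1.
by move: xt; rewrite /= !in_itv/= => /andP[/(lt_trans x0) ->].
Qed.

Lemma coef_is_derive x : 0 < x < l -> is_derive x 1 a (derive1 a x).
Proof. by move=> /coef_derivable dx; rewrite derive1E; exact: derivableP. Qed.

Lemma coef_derive_lr x : 0 < x < l -> - (m * a x) <= x * derive1 a x <= m * a x.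
Proof.
move=> xI; have := coef_derive_le xI; rewrite -ler_norml normrM gtr0_norm//.
by case/andP: xI.
Qed.

Lemma coef_is_deriveV x : 0 < x < l ->
  is_derive x 1 (fun y => (a y)^-1) (- derive1 a x / a x ^+ 2).
Proof.
move=> xI; have ax : a x != 0 by rewrite gt_eqF// coef_gt0//; case/andP: xI => -> /ltW.
have := coef_is_derive xI => d; apply: is_derive_eq.
by rewrite /GRing.scale/= mulNr mulrC mulNr.
Qed.

(** The derivative of [x^2 / a] has the sign of [2 a - x a'], which is nonnegative because
    [x a' <= m a] and [m < 2]. *)
Lemma sq_coef_le x : 0 < x <= l -> x ^+ 2 / a x <= l ^+ 2 / a l.
Proof.
apply: (@loc_ac_le (fun x => x ^+ 2 / a x)).
  apply: loc_acM; last exact: coefV_ac.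
  have := loc_acM (@loc_ac_id R l) (@loc_ac_id R l).
  by apply: loc_ac_ext => y _; rewrite expr2.
apply: ae_onW => y yI; have dV := coef_is_deriveV yI.
have ay : 0 < a y by rewrite coef_gt0//; case/andP: yI => -> /ltW.
have d : is_derive y 1 (fun x => x ^+ 2 / a x) (y * (2 * a y - y * derive1 a y) / a y ^+ 2).
  apply: is_derive_eq; rewrite /GRing.scale/=; field; by rewrite gt_eqF.
rewrite derive1E derive_val; have y0 : 0 < y by case/andP: yI.
have /andP[_ h] := coef_derive_lr yI.
rewrite divr_ge0// ?exprn_ge0 ?(ltW ay)// mulr_ge0 ?(ltW y0)// subr_ge0.
by apply: le_trans h _; rewrite ler_wpM2r// ltW.
Qed.

(** The derivative of [x / a] is [(a - x a') / a^2], at least [(1 - m) / a]. Integrating it over an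
    interval cut off from 0 bounds the integral of [1 / a] by [(1 - m)^-1 l / a(l)], uniformly in
    the cut; monotone convergence then removes the cut. *)
Lemma coefV_L1 : m < 1 -> L1 l (fun x => (a x)^-1).
Proof.
move=> m1; have mV : measurable_fun I (fun x => (a x)^-1).
  exact: (loc_ac_measurable coefV_ac).
pose F n : set R := `]l / n.+2%:R, l[%classic.
have bound n : (\int[leb]_(x in F n) ((a x)^-1)%:E <= ((1 - m)^-1 * (l / a l))%:E)%E.
  have /andP[x0 xl] := cut_itv l_gt0 n; have xI := cut_itvW l_gt0 n.
  set x := l / n.+2%:R in x0 xl xI.
  have acq : loc_abs_continuous l (fun x => x * (a x)^-1).
    by apply: loc_acM; [exact: loc_ac_id|exact: coefV_ac].
  have [h [ih hE hae]] := abs_continuous_FTC xl (acq x xI).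
  have := hE _ _ (lexx x) (ltW xl) (lexx l).
  rewrite -Rintegral_itv_bndo_bndc; last exact: integrableS ih.
  move=> E; have ax : 0 < a x by exact: coef_gt0.
  have ihF : leb.-integrable (F n) (EFin \o h) by apply: integrableS ih => //; exact: measurable_itv.
  pose h' t := Num.max (h t) 0.
  have mh : measurable_fun setT h by case/integrableP: ih => /measurable_EFinP.
  have x0t t : `]x, l[%classic t -> 0 < t < l.
    by rewrite /= in_itv/= => /andP[/(lt_trans x0) -> ->].
  have hge : {ae leb, forall t, F n t -> (1 - m) * (a t)^-1 <= h t}.
    have FF := ae_filter_ringOfSetsType leb; move: hae; apply: filterS => t H Ft.
    have [_ <-] := H Ft; have tI := x0t _ Ft; have t0 : 0 < t by case/andP: tI.
    have dV := coef_is_deriveV tI.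
    have at0 : 0 < a t by rewrite coef_gt0//; case/andP: tI => -> /ltW.
    have d : is_derive t 1 (fun x => x * (a x)^-1) ((a t - t * derive1 a t) / a t ^+ 2).
      apply: is_derive_eq; rewrite /GRing.scale/=; field; by rewrite gt_eqF.
    rewrite derive1E derive_val.
    have -> : (1 - m) * (a t)^-1 = ((1 - m) * a t) / a t ^+ 2 by field; rewrite gt_eqF.
    rewrite ler_pM2r ?invr_gt0 ?exprn_gt0//.
    by have /andP[_ h1] := coef_derive_lr tI; lra.
  have mF : measurable (F n) by exact: measurable_itv.
  have sub : F n `<=` I by apply: subset_itvr; rewrite bnd_simp ltW.
  have Fpos t : F n t -> 0 < (a t)^-1.
    by move=> /x0t /andP[t0 tl]; rewrite invr_gt0 coef_gt0// t0 ltW.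
  apply: (@le_trans _ _ (\int[leb]_(t in F n) ((1 - m)^-1 * h' t)%:E)%E).
    apply: ae_ge0_le_integral => //.
    - by move=> t Ft; rewrite lee_fin ltW// Fpos.
    - by apply/measurable_EFinP; exact: measurable_funS mV.
    - by move=> t Ft; rewrite lee_fin mulr_ge0// ?invr_ge0 ?subr_ge0 ?(ltW m1)// le_max lexx orbT.
    - by apply/measurable_EFinP; apply: measurable_funM => //; apply: measurable_funTS; exact: measurable_maxr.
    have FF := ae_filter_ringOfSetsType leb; move: hge; apply: filterS => t H Ft.
    by rewrite lee_fin ler_pdivlMl ?subr_gt0// le_max H.
  under eq_integral do rewrite EFinM.
  rewrite ge0_integralZl_EFin//; last 3 first.
  - by move=> t _; rewrite lee_fin le_max lexx orbT.
  - by apply/measurable_EFinP; apply: measurable_funTS; exact: measurable_maxr.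
  - by rewrite invr_ge0 subr_ge0 ltW.
  rewrite EFinM lee_pmul2l ?lte_fin ?invr_gt0 ?subr_gt0//.
  have -> : (\int[leb]_(t in F n) (h' t)%:E = \int[leb]_(t in F n) (EFin \o h) t)%E.
    apply: ae_eq_integral => //.
    - by apply/measurable_EFinP; apply: measurable_funTS; exact: measurable_maxr.
    - by apply/measurable_EFinP; exact: measurable_funTS.
    - have FF := ae_filter_ringOfSetsType leb; move: hge; apply: filterS => t H Ft /=.
      rewrite /h' (max_idPl _)//; apply: le_trans (H Ft).
      by rewrite mulr_ge0// ?subr_ge0 ltW// Fpos.
  have -> : (\int[leb]_(t in F n) (EFin \o h) t)%E = (l / a l - x / a x)%:E.
    by rewrite E /Rintegral fineK//; exact: integrable_fin_num.
  by rewrite lee_fin gerBl divr_ge0 ?(ltW x0)// ltW.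
rewrite /L1; apply/integrableP; split; first exact/measurable_EFinP.
under eq_integral => x xI.
  rewrite /= ger0_norm; first over.
  by rewrite invr_ge0 ltW// coef_gt0//; move: xI; rewrite inE/= in_itv/= => /andP[-> /ltW].
apply: (@le_lt_trans _ _ ((1 - m)^-1 * (l / a l))%:E); last exact: ltry.
rewrite (interval_bigcup l_gt0).
have c : (\int[leb]_(x in F i) ((a x)^-1)%:E)%E @[i --> \oo] -->
    (\int[leb]_(x in \bigcup_i F i) ((a x)^-1)%:E)%E.
  apply: ge0_nondecreasing_set_cvg_integral => [i j ij|i|i|i x].
  - apply/subsetPset; apply: subset_itvr; rewrite bnd_simp.
    by rewrite ler_wpM2l ?(ltW l_gt0)// lef_pV2 ?posrE// ler_nat !ltnS.
  - exact: measurable_itv.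
  - apply/measurable_EFinP; apply: measurable_funS mV => //.
    by apply: subset_itvr; rewrite bnd_simp; case/andP: (cut_itv l_gt0 i) => /ltW.
  - rewrite /F /= in_itv/= => /andP[xi xl]; rewrite lee_fin invr_ge0 ltW// coef_gt0// (ltW xl) andbT.
    by apply: lt_trans xi; case/andP: (cut_itv l_gt0 i).
rewrite -(cvg_lim _ c)//; apply: lime_le; first by apply/cvg_ex; eexists; exact: c.
exact: nearW.
Qed.

End DegenerateCoefficient.

Section Primitive.
Context (R : realType) (l : R) (l_gt0 : 0 < l).
Local Notation leb := (@lebesgue_measure R).
Local Notation I := (`]0, l[%classic : set R).

(** Local boundedness of [g] makes the primitive from 0 Lipschitz away from 0, continuity makes it
    differentiable everywhere inside, and integrability gives the limit at 0 and the global
    bound. *)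
Lemma primitive_exists (g : R -> R) : L1 l g ->
  (forall x, 0 < x < l -> {for x, continuous g}) ->
  (forall x, 0 < x <= l -> exists2 B, 0 <= B & forall y, x <= y < l -> `|g y| <= B) ->
  exists G : R -> R, [/\ loc_abs_continuous l G,
    forall x, 0 < x < l -> is_derive x 1 G (g x),
    G x @[x --> 0^'+] --> (0 : R) &
    exists2 C, 0 <= C & forall x, 0 < x <= l -> `|G x| <= C].
Proof.
move=> ig cg bg; pose f := g \_ I.
have iT : leb.-integrable setT (EFin \o f).
  by move: ig; rewrite /L1 integrable_mkcond//= restrict_EFin.
have ii (i : interval R) : leb.-integrable [set` i] (EFin \o f) by exact: integrableS iT.
pose G x := \int[leb]_(t in `[0, x]) f t.
have GB u v : 0 <= u -> u <= v -> G v - G u = \int[leb]_(t in `]u, v]) f t.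
  move=> u0 uv; rewrite /G (@Rintegral_itvB _ f (BLeft 0) (BRight v) u)//.
have fb x y B : 0 < x -> 0 <= B -> (forall y, x <= y < l -> `|g y| <= B) -> x <= y -> `|f y| <= B.
  move=> x0 B0 HB xy; rewrite /f patchE; case: ifPn => [|_]; last by rewrite normr0.
  by rewrite inE/= in_itv/= => /andP[_ yl]; apply: HB; rewrite xy.
have cstI u v (B : R) : leb.-integrable `]u, v] (EFin \o (fun=> B)).
  apply/integrableP; split; first exact: measurable_cst.
  rewrite /= integral_cst//= lebesgue_measure_itv/= lte_fin; case: ifP => _.
    by rewrite -EFinD -EFinM ltry.
  by rewrite mule0.
exists G; split.
- move=> x xI; have [B B0 HB] := bg x xI; have x0 : 0 < x by case/andP: xI.
  apply: (abs_continuous_lip B0) => u v xu uv vl; rewrite GB//; last by rewrite (le_trans (ltW x0)).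
  apply: le_trans (le_normr_Rintegral _ (ii _)) _ => //.
  apply: (@le_trans _ _ (\int[leb]_(t in `]u, v]) B)).
    apply: le_Rintegral => //.
    + exact: integrable_norm (ii _).
    move=> t; rewrite /= in_itv/= => /andP[ut _]; by apply: (fb x) => //; apply: le_trans xu _; exact: ltW.
  rewrite /Rintegral integral_cst//= lebesgue_measure_itv/= lte_fin.
  move: uv; rewrite le_eqVlt => /predU1P[->|uv]; last by rewrite uv.
  by rewrite ltxx subrr mule0 mulr0.
- move=> x /[dup] xI /andP[x0 xl].
  have [||dG G'] := @continuous_FTC1 R f (BLeft 0) x l xl (ii _).
  + by rewrite lte_fin.
  + have xi : x \in `]0, l[ by rewrite in_itv/= x0.
    have nf : {near x, g =1 f}.
      move/near_in_itvoo: xi; apply: filterS => y yI.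
      by rewrite /f patchE mem_set.
    rewrite /prop_for /continuous_at -(nbhs_singleton nf).
    apply: cvg_trans (cg x xI); apply: near_eq_cvg; move: nf; apply: filterS => y ->//.
  by have := derivableP dG; rewrite -derive1E G' /f patchE mem_set//= in_itv/= x0.
- by apply: cvg_at_right_filter; exact: (parameterized_integral_cvg_left l_gt0 (ii _)).
- exists (\int[leb]_t `|f t|); first exact: Rintegral_ge0.
  move=> x /andP[x0 xl]; apply: le_trans (le_normr_Rintegral _ (ii _)) _ => //.
  have iN := integrable_norm iT.
  rewrite /Rintegral fine_le//.
  - by apply: integrable_fin_num => //; exact: integrableS iN.
  - exact: integrable_fin_num.
  apply: ge0_subset_integral => //.
  by case/integrableP: iN.
Qed.

End Primitive.

(** * Boundary terms at the degenerate end *)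

Section BoundaryAtZero.
Context (R : realType).
Implicit Types (l x : R) (f g p y : R -> R).
Local Notation leb := (@lebesgue_measure R).

Lemma subset_itv0 x l : x <= l -> (`]0, x[%classic : set R) `<=` `]0, l[.
Proof. by move=> xl; apply: subset_itvl; rewrite bnd_simp. Qed.

Lemma L1_sub x l f : x <= l -> L1 l f -> L1 x f.
Proof. by move=> xl; apply: integrableS => //; exact: subset_itv0. Qed.

Lemma L2_sub x l f : x <= l -> L2 l f -> L2 x f.
Proof.
move=> xl [mf if2]; split; last exact: L1_sub xl if2.
by apply: measurable_funS mf => //; exact: subset_itv0.
Qed.

Lemma loc_ac_sub x l f : x <= l -> loc_abs_continuous l f -> loc_abs_continuous x f.
Proof.
move=> xl acf t /andP[t0 tx]; apply: (@abs_continuousS _ t l) => //.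
by apply: acf; rewrite t0 (le_trans tx).
Qed.

Lemma int_sub x l f : x <= l -> L1 l f -> (forall t, 0 < t < l -> 0 <= f t) ->
  int x f <= int l f.
Proof.
move=> xl iF f0; rewrite /int /Rintegral fine_le//.
- by apply: integrable_fin_num => //; exact: L1_sub iF.
- exact: integrable_fin_num.
apply: ge0_subset_integral => //; last exact: subset_itv0.
by case/integrableP: iF.
Qed.

Lemma loc_ac_is_derive l f : loc_abs_continuous l f -> 0 < l ->
  ae_on l (fun x => is_derive x 1 f (derive1 f x)).
Proof.
move=> acf l0; apply: ae_onS (loc_ac_derivable l0 acf) => x _ dx.
by rewrite derive1E; exact: derivableP.
Qed.

Lemma is_derive1E f x (d : R) : is_derive x 1 f d -> derive1 f x = d.
Proof. by move=> H; rewrite derive1E derive_val. Qed.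

Lemma bump_integral_ge x (y c : R) f : 0 < x -> x < y -> leb.-integrable `]x, y] (EFin \o f) ->
  (forall t, x < t <= y -> c <= f t) -> c * (y - x) <= \int[leb]_(t in `]x, y]) f t.
Proof.
move=> x0 xy iF cf; apply: (@le_trans _ _ (\int[leb]_(t in `]x, y]) c)).
  rewrite /Rintegral integral_cst//= lebesgue_measure_itv/= lte_fin xy.
  by rewrite -EFinD -EFinM.
apply: le_Rintegral => //.
  apply/integrableP; split; first exact: measurable_cst.
by rewrite /= integral_cst//= lebesgue_measure_itv/= lte_fin xy -EFinD -EFinM ltry.
Qed.

(** The derivative [y^2 + 2 y (x y')] of [x y^2] is integrable, so [x y^2] has a limit [L >= 0]. If
    [L > 0], then for small [x] one has [y^2 >= L / (4 x)] on []x, 2 x]], so the integral of [y^2]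
    there is at least [L / 4]; but these integrals tend to 0. *)
Lemma sq_weight_cvg0 l y g : 0 < l -> loc_abs_continuous l y -> L2 l y -> L2 l g ->
  ae_on l (fun x => x * derive1 y x = g x) -> x * y x ^+ 2 @[x --> 0^'+] --> (0 : R).
Proof.
move=> l0 acy Ly Lg yg; pose f x := x * y x ^+ 2.
have acf : loc_abs_continuous l f.
  apply: loc_acM; first exact: loc_ac_id.
  by apply: loc_ac_ext (loc_acM acy acy) => x _; rewrite expr2.
pose f' x := y x ^+ 2 + 2 * (y x * g x).
have if' : L1 l f' by apply: L1_add; [exact: L2_sq|apply: L1_scale; exact: L2_mul].
have fE : ae_on l (fun x => derive1 f x = f' x).
  apply: ae_onS2 yg (loc_ac_is_derive acy l0) => x xI E dy; apply: is_derive1E.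
  rewrite /f; apply: is_derive_eq; rewrite /f' -E /GRing.scale/=; ring.
have cf := FTC_cvg0 l0 acf if' fE.
set L := f l - int l f' in cf.
have L0 : 0 <= L.
  apply: (ler_cvg_to (cvg_cst 0) cf); near=> x.
  by rewrite /f mulr_ge0 ?sqr_ge0// ltW//; near: x; exact: nbhs_right_gt.
have [L00|Lpos] := eqVneq L 0; first by rewrite L00 in cf.
exfalso; have {}L0 : 0 < L by rewrite lt_neqAle eq_sym Lpos.
have iy := L2_sq Ly.
have tail := int_tail_cvg l0 iy.
set Phi := (fun x : R => \int[leb]_(t in `]x, l[) (y t ^+ 2)) in tail.
have tail2 : Phi (2 * x) @[x --> 0^'+] --> int l (fun t => y t ^+ 2).
  move/cvgrPdist_lt : tail => tail; apply/cvgrPdist_lt => e e0.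
  have [r /= r0 Hr] := tail e e0; exists (r / 2); first by rewrite /= divr_gt0.
  move=> x; rewrite /= sub0r normrN => xr x0; apply: Hr; last by rewrite mulr_gt0.
  by rewrite /= sub0r normrN normrM ger0_norm//; lra.
have d0 : Phi x - Phi (2 * x) @[x --> 0^'+] --> (0 : R).
  by have c := cvgB tail tail2; rewrite subrr in c; exact: c.
have L4 : 0 < L / 4 by rewrite divr_gt0.
have L2' : L / 2 < L by rewrite ltr_pdivrMr// ltr_pMr// ltr1n.
have [r r0 Hr] : exists2 r, 0 < r & forall t, 0 < t < r -> L / 2 < f t.
  have [r /= r0 Hr] := cvgr_gt _ cf _ L2'; exists r => // t /andP[t0 tr].
  by apply: Hr => //; rewrite /= sub0r normrN gtr0_norm.
near (0 : R)^'+ => x.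
have x0 : 0 < x by near: x; exact: nbhs_right_gt.
have x2l : 2 * x < l.
  by rewrite mulrC -ltr_pdivlMr//; near: x; apply: nbhs_right_lt; rewrite divr_gt0.
have x2r : 2 * x < r.
  by rewrite mulrC -ltr_pdivlMr//; near: x; apply: nbhs_right_lt; rewrite divr_gt0.
have small : Phi x - Phi (2 * x) < L / 4.
  by near: x; apply: (cvgr_lt _ d0).
have ixl : leb.-integrable `]x, l[ (EFin \o (fun t => y t ^+ 2)).
  by apply: integrableS iy => //; apply: subset_itvr; rewrite bnd_simp ltW.
have E := @Rintegral_itvB _ (fun t => y t ^+ 2) (BRight x) (BLeft l) (2 * x) ixl.
have {E} : Phi x - Phi (2 * x) = \int[leb]_(t in `]x, (2 * x)]) (y t ^+ 2).
  by rewrite /Phi -E ?bnd_simp; [rewrite opprB addrC subrK|lra|exact: x2l].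
have := @bump_integral_ge x (2 * x) (L / (4 * x)) (fun t => y t ^+ 2) x0.
have -> : L / (4 * x) * (2 * x - x) = L / 4 by field; rewrite gt_eqF.
move=> /(_ _ _ _) H E; move: small; rewrite E ltNge => /negP; apply; apply: H.
- lra.
- by apply: integrableS ixl => //; apply: subset_itvl; rewrite bnd_simp.
move=> t /andP[xt t2x]; have t0 : 0 < t by exact: lt_trans xt.
have : L / 2 < f t by apply: Hr; rewrite t0 (le_lt_trans t2x).
rewrite /f => h; rewrite ler_pdivrMr ?mulr_gt0//.
by have := sqr_ge0 (y t); nra.
Unshelve. all: by end_near. Qed.

(** Cauchy-Schwarz for [p'] against the constant 1 on []0, x[]. *)
Lemma sq_le_int_derive l p x : 0 < x <= l -> loc_abs_continuous l p -> L2 l (derive1 p) ->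
  p x @[x --> 0^'+] --> (0 : R) -> p x ^+ 2 <= x * int l (fun t => derive1 p t ^+ 2).
Proof.
move=> /andP[x0 xl] acp Lp p0.
have Lx := L2_sub xl Lp.
have E : int x (derive1 p) = p x.
  by apply: (FTC_eq x0) p0; [exact: loc_ac_sub acp|exact: L2_L1|exact: ae_onW].
rewrite -E; have := cauchy_schwarz_int (L2_cst x 1) Lx.
rewrite (@eq_int _ _ (fun t => 1 * derive1 p t) (derive1 p)); last by move=> *; rewrite mul1r.
move=> /le_trans; apply; rewrite expr1n (int_cst _ (ltW x0)) mulr1; apply: (ler_wpM2l (ltW x0)).
by apply: int_sub => //; [exact: L2_sq|move=> *; exact: sqr_ge0].
Qed.

Lemma cvg0_of_sq (F : set_system R) {FF : Filter F} (b n : R -> R) (c : R) :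
  0 <= c -> (\forall s \near F, b s ^+ 2 <= c * n s) -> n s @[s --> F] --> (0 : R) ->
  b s @[s --> F] --> (0 : R).
Proof.
move=> c0 bn n0; apply/cvgrPdist_lt => e e0.
have c1 : 0 < c + 1 by rewrite ltr_wpDl.
have e2 : 0 < e ^+ 2 / (c + 1) by rewrite divr_gt0// exprn_gt0.
move/cvgrPdist_lt: n0 => /(_ _ e2); apply: filterS2 bn => s bs.
rewrite !sub0r !normrN => ns.
rewrite -(@ltr_pXn2r _ 2) ?nnegrE ?(ltW e0)// real_normK ?num_real//.
apply: le_lt_trans bs _; apply: (@le_lt_trans _ _ (c * (e ^+ 2 / (c + 1)))).
  by apply: ler_wpM2l => //; apply: le_trans (ler_norm _) (ltW ns).
rewrite mulrCA -[ltRHS]mulr1 ltr_pM2l ?exprn_gt0// ltr_pdivrMr//; lra.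
Qed.

(* In the strongly degenerate case [p] vanishes like [sqrt x] and [y] grows
   slower than [1 / sqrt x]. *)
Lemma boundary_product_cvg0 l p y g (weak strong : Prop) : 0 < l -> weak \/ strong ->
  loc_abs_continuous l p -> L2 l (derive1 p) ->
  loc_abs_continuous l y -> L2 l y -> L2 l g -> ae_on l (fun x => x * derive1 y x = g x) ->
  (weak -> y x @[x --> 0^'+] --> (0 : R)) -> (strong -> p x @[x --> 0^'+] --> (0 : R)) ->
  p x * y x @[x --> 0^'+] --> (0 : R).
Proof.
move=> l0 ws acp Lp acy Ly Lg yg weak0 strong0; case: ws => [/weak0 y0|/strong0 p0].
  have : p x * y x @[x --> 0^'+] --> (p l - int l (derive1 p)) * 0; last by rewrite mulr0.
  apply: cvgM y0.
  by apply: FTC_cvg0 => //; [exact: L2_L1|exact: ae_onW].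
apply: (cvg0_of_sq (int_sq_ge0 l (derive1 p))) (sq_weight_cvg0 l0 acy Ly Lg yg).
near=> x; rewrite exprMn mulrA (mulrC (int _ _)); apply: ler_wpM2r; first exact: sqr_ge0.
apply: sq_le_int_derive => //; apply/andP; split; near: x.
  exact: nbhs_right_gt.
exact: nbhs_right_le.
Unshelve. all: by end_near. Qed.

End BoundaryAtZero.

(** * Bounded bilinear forms along curves in the energy space *)

Section BoundedForms.
Context (R : realType) (T : lmodType R) (H : T -> Prop) (N : T -> R).
Context (H_lin : forall a b u v, H u -> H v -> H (a *: u + b *: v))
  (N_ge0 : forall u, H u -> 0 <= N u).

Definition bounded_functional (f : T -> R) :=
  (forall a b u v, H u -> H v -> f (a *: u + b *: v) = a * f u + b * f v) /\
  exists2 C, 0 <= C & forall u, H u -> f u ^+ 2 <= C * N u.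

(** Linearity is required on [H] only, because integrals are additive only on integrable functions.
    Continuity is expressed through the squared norm [N], which vanishes on differences of functions
    that agree almost everywhere. *)
Definition bounded_form (B : T -> T -> R) :=
  [/\ forall a b u v w, H u -> H v -> H w -> B (a *: u + b *: v) w = a * B u w + b * B v w,
      forall a b u v w, H u -> H v -> H w -> B w (a *: u + b *: v) = a * B w u + b * B w v &
      exists2 C, 0 <= C & forall u v, H u -> H v -> B u v ^+ 2 <= C * (N u * N v)].

Lemma bounded_formD B1 B2 : bounded_form B1 -> bounded_form B2 ->
  bounded_form (fun u v => B1 u v + B2 u v).
Proof.
move=> [l1 r1 [C1 C10 b1]] [l2 r2 [C2 C20 b2]]; split.
- by move=> a b u v w Hu Hv Hw; rewrite l1// l2//; ring.
- by move=> a b u v w Hu Hv Hw; rewrite r1// r2//; ring.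
- exists (2 * (C1 + C2)); first by rewrite mulr_ge0// addr_ge0.
  move=> u v Hu Hv; have := b1 u v Hu Hv; have := b2 u v Hu Hv.
  by have := sqr_ge0 (B1 u v - B2 u v); nra.
Qed.

Lemma bounded_formZ c B : bounded_form B -> bounded_form (fun u v => c * B u v).
Proof.
move=> [l r [C C0 b]]; split.
- by move=> a1 b1 u v w Hu Hv Hw; rewrite l//; ring.
- by move=> a1 b1 u v w Hu Hv Hw; rewrite r//; ring.
- exists (c ^+ 2 * C); first by rewrite mulr_ge0// sqr_ge0.
  move=> u v Hu Hv; rewrite exprMn -[leRHS]mulrA; apply: ler_wpM2l; first exact: sqr_ge0.
  exact: b.
Qed.

Lemma bounded_form_prod f g : bounded_functional f -> bounded_functional g ->
  bounded_form (fun u v => f u * g v).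
Proof.
move=> [lf [C C0 bf]] [lg [D D0 bg]]; split.
- by move=> a b u v w Hu Hv Hw; rewrite lf//; ring.
- by move=> a b u v w Hu Hv Hw; rewrite lg//; ring.
- exists (C * D); first by rewrite mulr_ge0.
  move=> u v Hu Hv; rewrite exprMn [leRHS]mulrACA.
  by apply: ler_pM; rewrite ?sqr_ge0 ?bf ?bg.
Qed.

Lemma bounded_form_diag B : bounded_form B ->
  exists2 C, 0 <= C & forall u, H u -> `|B u u| <= C * N u.
Proof.
(* [C] bounds the square of the form; since [C <= (C + 1)^2], the form itself is bounded with
   [C + 1]. *)
move=> [_ _ [C C0 b]]; exists (C + 1); first by rewrite addr_ge0.
move=> u Hu; rewrite -(@ler_pXn2r _ 2) ?nnegrE ?mulr_ge0 ?addr_ge0 ?N_ge0//.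
rewrite real_normK ?num_real//; apply: le_trans (b u u Hu Hu) _.
rewrite exprMn expr2 -/(N u ^+ 2); apply: ler_wpM2r; first by rewrite mulr_ge0 ?N_ge0.
nra.
Qed.

Lemma bounded_form_cvg0l B w (F : set_system R) {FF : Filter F} (E : R -> T) :
  bounded_form B -> H w -> (\forall s \near F, H (E s)) -> N (E s) @[s --> F] --> (0 : R) ->
  B (E s) w @[s --> F] --> (0 : R).
Proof.
move=> [_ _ [C C0 b]] Hw HE NE.
apply: (cvg0_of_sq (n := fun s => N (E s)) (c := C * N w)) NE.
  by rewrite mulr_ge0 ?N_ge0.
by apply: filterS HE => s Hs; rewrite -mulrA (mulrC (N w)) b.
Qed.

Lemma bounded_form_cvg0r B w (F : set_system R) {FF : Filter F} (E : R -> T) :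
  bounded_form B -> H w -> (\forall s \near F, H (E s)) -> N (E s) @[s --> F] --> (0 : R) ->
  B w (E s) @[s --> F] --> (0 : R).
Proof.
move=> [_ _ [C C0 b]] Hw HE NE.
apply: (cvg0_of_sq (n := fun s => N (E s)) (c := C * N w)) NE.
  by rewrite mulr_ge0 ?N_ge0.
by apply: filterS HE => s Hs; rewrite -mulrA b.
Qed.

Lemma bounded_form_cvg0 B (F : set_system R) {FF : Filter F} (E : R -> T) :
  bounded_form B -> (\forall s \near F, H (E s)) -> N (E s) @[s --> F] --> (0 : R) ->
  B (E s) (E s) @[s --> F] --> (0 : R).
Proof.
move=> bB HE NE; have [C C0 b] := bounded_form_diag bB.
have b0 : - (C * N (E s)) @[s --> F] --> (0 : R).
  by rewrite -oppr0; apply: cvgN; rewrite -(mulr0 C); apply: cvgM => //; exact: cvg_cst.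
have b1 : C * N (E s) @[s --> F] --> (0 : R).
  by rewrite -[X in _ --> X](mulr0 C); apply: cvgM => //; exact: cvg_cst.
apply: squeeze_cvgr b0 b1; apply: filterS HE => s Hs.
by rewrite -ler_norml b.
Qed.

Lemma bounded_form_cvg B (F : set_system R) {FF : Filter F} (V : R -> T) (v : T) :
  bounded_form B -> H v -> (\forall s \near F, H (V s)) ->
  N (V s - v) @[s --> F] --> (0 : R) -> B (V s) (V s) @[s --> F] --> B v v.
Proof.
move=> bB Hv HV NV; pose E s := 1 *: V s + (-1) *: v.
have EE s : V s - v = E s by rewrite /E scale1r scaleN1r.
have HE : \forall s \near F, H (E s) by apply: filterS HV => s Hs; exact: H_lin.
have NE : N (E s) @[s --> F] --> (0 : R).
  by rewrite (_ : (fun s => N (E s)) = (fun s => N (V s - v)))//; apply/funext => s; rewrite EE.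
clearbody E.
have c : B v v + (B v (E s) + B (E s) v) + B (E s) (E s) @[s --> F] --> B v v + (0 + 0) + 0.
  apply: cvgD; last exact: bounded_form_cvg0.
  apply: cvgD; first exact: cvg_cst.
  by apply: cvgD; [exact: bounded_form_cvg0r|exact: bounded_form_cvg0l].
rewrite !addr0 in c; apply: cvg_trans c; apply: near_eq_cvg; apply: filterS HE => s Hs.
have -> : V s = 1 *: v + 1 *: E s by rewrite !scale1r -EE addrC subrK.
have HX : H (1 *: v + 1 *: E s) by exact: H_lin.
by case: bB => bl br _; rewrite bl// !br//; ring.
Qed.

Local Notation F0 t := (within `[0, +oo[ (dnbhs t)).

(** Write [U s = U t + (s - t) (U' t + E s)] with [N (E s)] tending to 0 and expand the form: each
    term that contains [E s] or keeps a factor [s - t] disappears in the limit. *)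
Lemma bounded_form_derivative B (U U' : R -> T) (t : R) : bounded_form B ->
  (forall s, 0 <= s -> H (U s)) -> H (U' t) -> derivative_curve N U U' -> 0 <= t ->
  (B (U s) (U s) - B (U t) (U t)) / (s - t) @[s --> F0 t] -->
    B (U' t) (U t) + B (U t) (U' t).
Proof.
move=> bB HU HU' dU t0; have Ht := HU t t0.
pose D s := (s - t)^-1 *: U s + (- (s - t)^-1) *: U t.
pose E s := 1 *: D s + (-1) *: U' t.
have EE s : (s - t)^-1 *: (U s - U t) - U' t = E s.
  by rewrite /E /D scale1r scaleN1r scalerBr scaleNr.
have HE : \forall s \near F0 t, H (E s).
  rewrite near_withinE; apply: nearW => s; rewrite /= in_itv/= andbT => s0.
  by apply: H_lin => //; apply: H_lin => //; exact: HU.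
have NE : N (E s) @[s --> F0 t] --> (0 : R).
  rewrite (_ : (fun s => N (E s)) = (fun s => N ((s - t)^-1 *: (U s - U t) - U' t))).
    exact: dU.
  by apply/funext => s; rewrite EE.
clearbody E; clear D.
have st0 : s - t @[s --> F0 t] --> (0 : R).
  rewrite -(subrr t); apply: cvgB; last exact: cvg_cst.
  by apply: cvg_within_filter; apply: cvg_within_filter; exact: cvg_id.
have c : B (U' t) (U t) + B (U t) (U' t) + (B (E s) (U t) + B (U t) (E s)) +
   (s - t) * (B (U' t) (U' t) + (B (E s) (U' t) + B (U' t) (E s)) + B (E s) (E s))
   @[s --> F0 t] -->
   B (U' t) (U t) + B (U t) (U' t) + (0 + 0) + 0 * (B (U' t) (U' t) + (0 + 0) + 0).
  apply: cvgD.
    apply: cvgD; first exact: cvg_cst.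
    by apply: cvgD; [exact: bounded_form_cvg0l|exact: bounded_form_cvg0r].
  apply: cvgM => //; apply: cvgD; last exact: bounded_form_cvg0.
  apply: cvgD; first exact: cvg_cst.
  by apply: cvgD; [exact: bounded_form_cvg0l|exact: bounded_form_cvg0r].
rewrite mul0r !addr0 in c; apply: cvg_trans c; apply: near_eq_cvg.
near=> s; have Es : H (E s) by near: s.
have sN : s - t != 0.
  rewrite subr_eq0; near: s; rewrite near_withinE.
  by apply/nbhs_ballP; exists 1 => //= s _ sN _.
have -> : U s = 1 *: U t + (s - t) *: (1 *: U' t + 1 *: E s).
  by rewrite !scale1r -EE (addrC (U' t)) subrK scalerA divff// scale1r addrC subrK.
have HX : H (1 *: U' t + 1 *: E s) by exact: H_lin.
case: bB => bl br _.
rewrite !(bl, br)//; try exact: H_lin.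
by field.
Unshelve. all: by end_near. Qed.

End BoundedForms.

Section Features.
Context (R : realType) (T : lmodType R) (H : T -> Prop) (N : T -> R) (l : R).
Context (H_lin : forall a b u v, H u -> H v -> H (a *: u + b *: v))
  (N_ge0 : forall u, H u -> 0 <= N u).
Local Notation L2 := (L2 l).
Local Notation int := (int l).

(** A bounded linear map from the energy space to [L^2]. It is linear up to null sets, because
    [derive1] is additive only where derivatives exist. *)
Definition feature (f : T -> R -> R) :=
  [/\ forall u, H u -> L2 (f u),
      forall a b u v, H u -> H v ->
        ae_on l (fun x => f (a *: u + b *: v) x = a * f u x + b * f v x) &
      exists2 C, 0 <= C & forall u, H u -> int (fun x => f u x ^+ 2) <= C * N u].

Lemma feature_bmul (f : T -> R -> R) (k : R -> R) (c : R) : measurable_fun (`]0, l[%classic : set R) k ->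
  (forall x, 0 < x < l -> `|k x| <= c) -> feature f -> feature (fun u x => k x * f u x).
Proof.
move=> mk kc [Lf lf [C C0 bf]]; split.
- by move=> u Hu; exact: L2_bmul mk kc (Lf u Hu).
- move=> a b u v Hu Hv; apply: ae_onS (lf a b u v Hu Hv) => x _ ->; ring.
- exists (c ^+ 2 * C); first by rewrite mulr_ge0// sqr_ge0.
  move=> u Hu; rewrite -mulrA; apply: le_trans (_ : c ^+ 2 * int (fun x => f u x ^+ 2) <= _); last first.
    by rewrite ler_wpM2l ?sqr_ge0// bf.
  exact: int_bmul_le mk kc (Lf u Hu).
Qed.

Lemma feature_form f g : feature f -> feature g ->
  bounded_form H N (fun u v => int (fun x => f u x * g v x)).
Proof.
move=> [Lf lf [C C0 bf]] [Lg lg [D D0 bg]]; split.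
- move=> a b u v w Hu Hv Hw.
  have Lfu := Lf u Hu; have Lfv := Lf v Hv; have Lgw := Lg w Hw.
  have Lfuv := Lf _ (H_lin a b Hu Hv).
  rewrite -intZ ?L2_mul// -intZ ?L2_mul// -intD; [|by apply: L1_scale; exact: L2_mul..].
  apply: int_ae.
  + exact: L1_measurable (L2_mul Lfuv Lgw).
  + by apply: L1_measurable; apply: L1_add; apply: L1_scale; exact: L2_mul.
  + by apply: ae_onS (lf a b u v Hu Hv) => x _ ->; ring.
- move=> a b u v w Hu Hv Hw.
  have Lgu := Lg u Hu; have Lgv := Lg v Hv; have Lfw := Lf w Hw.
  have Lguv := Lg _ (H_lin a b Hu Hv).
  rewrite -intZ ?L2_mul// -intZ ?L2_mul// -intD; [|by apply: L1_scale; exact: L2_mul..].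
  apply: int_ae.
  + exact: L1_measurable (L2_mul Lfw Lguv).
  + by apply: L1_measurable; apply: L1_add; apply: L1_scale; exact: L2_mul.
  + by apply: ae_onS (lg a b u v Hu Hv) => x _ ->; ring.
- exists (C * D); first by rewrite mulr_ge0.
  move=> u v Hu Hv; apply: le_trans (cauchy_schwarz_int (Lf u Hu) (Lg v Hv)) _.
  by rewrite mulrACA ler_pM ?int_sq_ge0 ?bf ?bg.
Qed.

Lemma feature_functional f (k : R -> R) : L2 k -> feature f ->
  bounded_functional H N (fun u => int (fun x => f u x * k x)).
Proof.
move=> Lk [Lf lf [C C0 bf]]; split.
- move=> a b u v Hu Hv; have Lfu := Lf u Hu; have Lfv := Lf v Hv.
  have Lfuv := Lf _ (H_lin a b Hu Hv).
  rewrite -intZ ?L2_mul// -intZ ?L2_mul// -intD; [|by apply: L1_scale; exact: L2_mul..].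
  apply: int_ae.
  + exact: L1_measurable (L2_mul Lfuv Lk).
  + by apply: L1_measurable; apply: L1_add; apply: L1_scale; exact: L2_mul.
  + by apply: ae_onS (lf a b u v Hu Hv) => x _ ->; ring.
- exists (C * int (fun x => k x ^+ 2)); first by rewrite mulr_ge0// int_sq_ge0.
  move=> u Hu; apply: le_trans (cauchy_schwarz_int (Lf u Hu) Lk) _.
  by rewrite mulrAC ler_wpM2r ?int_sq_ge0// bf.
Qed.

End Features.

Section Gronwall.
Context (R : realType).
Implicit Types (phi d : R -> R) (k t T : R).

Lemma continuous_diff_quotient_cvg phi d t : 
  (phi s - phi t) / (s - t) @[s --> within `[0, +oo[ (dnbhs t)] --> d t ->
  phi @ within `[0, +oo[ (nbhs t) --> phi t.
Proof.
move=> dq; have c : (s - t) * ((phi s - phi t) / (s - t)) @[s --> within `[0, +oo[ (dnbhs t)] --> 0 * d t.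
  apply: cvgM dq; rewrite -[X in _ --> X](subrr t); apply: cvgB; last exact: cvg_cst.
  by apply: cvg_within_filter; apply: cvg_within_filter; exact: cvg_id.
rewrite mul0r in c; apply/cvgrPdist_lt => e e0.
move/cvgrPdist_lt : c => /(_ e e0) /nbhs_ballP[r /= r0 Hr].
rewrite near_withinE; apply/nbhs_ballP; exists r => //= s sr sA.
have [->|st] := eqVneq s t; first by rewrite subrr normr0.
have := Hr s sr st sA; rewrite sub0r normrN mulrC divfK ?subr_eq0//.
by rewrite distrC.
Qed.

(** The derivative of [phi t * expR (k * t)] is nonpositive; the mean value theorem on [[0, T]] uses
    only continuity at the ends. *)
Lemma gronwall phi d k T : 0 <= T ->
  (forall t, 0 <= t ->
    (phi s - phi t) / (s - t) @[s --> within `[0, +oo[ (dnbhs t)] --> d t) ->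
  (forall t, 0 <= t -> d t <= - k * phi t) ->
  phi T <= phi 0 * expR (- k * T).
Proof.
rewrite le_eqVlt => /predU1P[<- _ _|T0 dq dk]; first by rewrite mulr0 expR0 mulr1.
pose g t := phi t * expR (k * t).
pose g' t := (d t + k * phi t) * expR (k * t).
have dphi t : 0 < t -> is_derive t 1 phi (d t).
  move=> t0; have nA : nbhs t (`[0, +oo[%classic : set R).
    have : t \in `]0, +oo[ by rewrite in_itv/= t0.
    move=> /near_in_itvoy; apply: filterS => y.
    by rewrite /= !in_itv/= !andbT => /ltW.
  have dc := dq t (ltW t0).
  have [|der E] := @deriv_in_interior R `[0, +oo[ phi t nA.
    by apply/cvg_ex; exists (d t).
  have := derivableP der; rewrite -derive1E E /deriv_in.
  move: dc; rewrite within_dnbhs_nbhs// => dc.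
  by rewrite (cvg_lim _ dc).
have dg t : t \in `]0, T[ -> is_derive t 1 g (g' t).
  rewrite in_itv/= => /andP[t0 tT]; have := dphi t t0 => dp.
  rewrite /g; apply: is_derive_eq; rewrite /g' /GRing.scale/= mulr1; ring.
have cg : {within `[0, T], continuous g}.
  apply/subspace_continuousP => t /=; rewrite in_itv/= => /andP[t0 tT].
  have c1 : phi @ within `[0, T] (nbhs t) --> phi t.
    apply: cvg_trans (continuous_diff_quotient_cvg (dq t t0)); apply: cvg_app.
    apply: within_subset => s; rewrite /= !in_itv/= andbT.
    by case/andP.
  apply: cvgM c1 _; apply: cvg_within_filter.
  apply: continuous_comp; last exact: continuous_expR.
  by apply: cvgM; [exact: cvg_cst|exact: cvg_id].
have [c cI E] := MVT T0 dg cg.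
have g'c : g' c <= 0.
  rewrite /g' mulr_le0_ge0 ?expR_ge0//.
  have /dk : 0 <= c by apply: ltW; move: cI; rewrite in_itv/= => /andP[].
  lra.
have gT : g T <= g 0.
  by rewrite -subr_le0 E subr0 mulr_le0_ge0// ltW.
move: gT; rewrite /g mulr0 expR0 mulr1 => gT.
by rewrite mulNr expRN ler_pdivlMr ?expR_gt0.
Qed.

End Gronwall.

Lemma cvg0_lin (R : realType) (F : set_system R) {FF : Filter F} (f g : R -> R) (a b : R) :
  f x @[x --> F] --> (0 : R) -> g x @[x --> F] --> (0 : R) -> a * f x + b * g x @[x --> F] --> (0 : R).
Proof.
move=> f0 g0; have : a * f x + b * g x @[x --> F] --> a * 0 + b * 0.
  by apply: cvgD; apply: cvgM => //; exact: cvg_cst.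
by rewrite !mulr0 addr0.
Qed.

(** * Forward difference quotients of curves *)

Section ForwardQuotient.
Context (R : realType) (T : lmodType R) (H : T -> Prop) (N : T -> R).
Context (H_lin : forall a b u v, H u -> H v -> H (a *: u + b *: v)) (N_ge0 : forall u, H u -> 0 <= N u)
  (N_lin : forall a b u v, H u -> H v -> N (a *: u + b *: v) <= 2 * a ^+ 2 * N u + 2 * b ^+ 2 * N v).
Context (U J : R -> T) (HU : forall t, 0 <= t -> H (U t)) (HJ : forall t, 0 <= t -> H (J t))
  (dJ : derivative_curve N J U).

(** Module identity expressing that difference quotients in time commute with the forward
    quotient. *)
Lemma quotient_rearrange (k r : R) (a b c d e f : T) :
  k *: (r *: a + (- r) *: b - (r *: c + (- r) *: d)) - (r *: e + (- r) *: f) =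
  r *: (k *: (a - c) - e) + (- r) *: (k *: (b - d) - f).
Proof.
rewrite !scaleNr -!scalerBr scalerA mulrC -scalerA -!scalerBr; congr (_ *: _).
have e4 (x y z t : T) : x - y - (z - t) = x - z - (y - t).
  by rewrite !opprB addrACA [in RHS]addrACA [- y - z]addrC.
by rewrite e4 scalerBr e4.
Qed.

Lemma squeeze0 (F : set_system R) {FF : Filter F} (f g : R -> R) :
  (\forall x \near F, 0 <= f x <= g x) -> g x @[x --> F] --> (0 : R) -> f x @[x --> F] --> (0 : R).
Proof.
move=> fg g0; have c : (fun=> 0 : R) x @[x --> F] --> (0 : R) by exact: cvg_cst.
by move: c g0; apply: squeeze_cvgr.
Qed.

Lemma shift_within (h t : R) : 0 <= h ->
  (fun s => s + h) @ within `[0, +oo[ (dnbhs t) --> within `[0, +oo[ (dnbhs (t + h)).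
Proof.
move=> h0 A /nbhs_ballP[r /= r0 HA]; apply/nbhs_ballP; exists r => // s /= sr st.
rewrite /= in_itv/= andbT => s0; apply: HA.
- by rewrite /ball/= opprD addrACA subrr addr0.
- by apply: contra_neq st => /addIr.
- by rewrite /= in_itv/= andbT addr_ge0.
Qed.

Lemma right_within (t : R) : 0 <= t ->
  (fun h => t + h) @ (0:R)^'+ --> within `[0, +oo[ (dnbhs t).
Proof.
move=> t0 A /nbhs_ballP[r /= r0 HA]; apply/nbhs_ballP; exists r => // h /= hr h0.
apply: HA.
- by move: hr; rewrite /ball/= sub0r opprD addrA subrr sub0r.
- by rewrite gt_eqF// ltrDl.
- by rewrite /= in_itv/= andbT addr_ge0// ltW.
Qed.

(** Kept as a linear combination, so that the linearity hypotheses on [H], [N] and the operator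
    apply as they stand. *)
Definition forward_quotient (W : R -> T) (h t : R) : T :=
  h^-1 *: W (t + h) + (- h^-1) *: W t.

Lemma forward_quotient_inH W h t : (forall t, 0 <= t -> H (W t)) -> 0 <= h -> 0 <= t ->
  H (forward_quotient W h t).
Proof.
by move=> HW h0 t0; apply: H_lin => //; apply: HW => //; exact: addr_ge0.
Qed.

Lemma forward_quotient_derivative h : 0 < h ->
  derivative_curve N (forward_quotient J h) (forward_quotient U h).
Proof.
move=> h0 t t0; have th0 : 0 <= t + h by rewrite addr_ge0// ltW.
pose E s t := (s - t)^-1 *: (J s - J t) - U t.
have HE s u : 0 <= s -> 0 <= u -> H (E s u).
  move=> s0 u0; have -> : E s u = 1 *: ((s - u)^-1 *: J s + (- (s - u)^-1) *: J u) + (-1) *: U u.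
    by rewrite /E scale1r scaleN1r scalerBr scaleNr.
  by apply: (H_lin _ _ _ (HU u0)); apply: H_lin; exact: HJ.
have c1 : N (E (s + h) (t + h)) @[s --> within `[0, +oo[ (dnbhs t)] --> (0 : R).
  by apply: (cvg_comp _ _ (shift_within (ltW h0)) (dJ th0)).
have c2 : N (E s t) @[s --> within `[0, +oo[ (dnbhs t)] --> (0 : R) by exact: dJ.
have FF : Filter (within `[0, +oo[ (dnbhs t)) by exact: within_filter.
have c3 := @cvg0_lin R _ FF _ _ (2 * h^-1 ^+ 2) (2 * (- h^-1) ^+ 2) c1 c2.
have EE s : (s - t)^-1 *: (forward_quotient J h s - forward_quotient J h t) - forward_quotient U h t =
    h^-1 *: E (s + h) (t + h) + (- h^-1) *: E s t.
  rewrite /forward_quotient /E (_ : s + h - (t + h) = s - t); last by rewrite opprD addrACA subrr addr0.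
  exact: quotient_rearrange.
apply: (@squeeze0 _ FF _ _ _ c3); rewrite near_withinE; apply: nearW => s.
rewrite /= in_itv/= andbT => s0; rewrite EE.
have H1' : H (E (s + h) (t + h)) by apply: HE => //; rewrite addr_ge0// ltW.
have H2' : H (E s t) by exact: HE.
by rewrite N_lin// N_ge0//; exact: H_lin.
Qed.

Lemma forward_quotient_cvg t : 0 <= t ->
  N (forward_quotient J h t - U t) @[h --> 0^'+] --> (0 : R).
Proof.
move=> t0; have := cvg_comp _ _ (right_within t0) (dJ t0).
apply: cvg_trans; apply: near_eq_cvg; apply: nearW => h.
by rewrite /forward_quotient /= addrAC subrr add0r scalerBr scaleNr.
Qed.

End ForwardQuotient.

(** * Weighted trace and Hardy inequalities; the energy space *)

Section WeightedTrace.
Context (R : realType) (l : R) (l_gt0 : 0 < l) (y g : R -> R).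
Context (acy : loc_abs_continuous l y) (Ly : L2 l y) (Lg : L2 l g)
  (yg : ae_on l (fun x => x * derive1 y x = g x)).

(** Integrates the derivative of [x y^2]; its value at 0 vanishes by [sq_weight_cvg0]. *)
Lemma weighted_trace_eq :
  int l (fun x => y x ^+ 2) + 2 * int l (fun x => y x * g x) = l * y l ^+ 2.
Proof.
have L1y := L2_sq Ly; have L1yg := L2_mul Ly Lg.
rewrite -intZ// -intD//; last exact: L1_scale.
apply: (@FTC_eq _ _ l_gt0 (fun x => x * y x ^+ 2)).
- apply: loc_acM; first exact: loc_ac_id.
  by apply: loc_ac_ext (loc_acM acy acy) => x _; rewrite expr2.
- by apply: L1_add => //; exact: L1_scale.
- apply: ae_onS2 yg (loc_ac_is_derive acy l_gt0) => x _ E dy; apply: is_derive1E.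
  apply: is_derive_eq; rewrite -E /GRing.scale/=; ring.
- exact: sq_weight_cvg0 yg.
Qed.

Lemma weighted_mul_le (c : R) : 0 < c ->
  `|2 * int l (fun x => y x * g x)| <=
  c * int l (fun x => y x ^+ 2) + c^-1 * int l (fun x => g x ^+ 2).
Proof.
move=> c0; have L1y := L2_sq Ly; have L1g := L2_sq Lg; have L1yg := L2_mul Ly Lg.
rewrite -!intZ// -intD; [|exact: L1_scale..].
have ci : 0 < c^-1 by rewrite invr_gt0.
have key x s : s ^+ 2 = 1 -> s * (2 * (y x * g x)) <= c * y x ^+ 2 + c^-1 * g x ^+ 2.
  move=> s1; rewrite -subr_ge0.
  have -> : c * y x ^+ 2 + c^-1 * g x ^+ 2 - s * (2 * (y x * g x)) =
     c^-1 * (c * y x - s * g x) ^+ 2 + c^-1 * (1 - s ^+ 2) * g x ^+ 2.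
    by field; rewrite gt_eqF.
  by rewrite s1 subrr mulr0 mul0r addr0 mulr_ge0 ?sqr_ge0 ?(ltW ci).
have L1s : L1 l (fun x => c * y x ^+ 2 + c^-1 * g x ^+ 2) by apply: L1_add; exact: L1_scale.
rewrite ler_norml; apply/andP; split.
  rewrite lerNl -mulN1r -intZ; last exact: L1_scale.
  apply: le_int => //; first by apply: L1_scale; exact: L1_scale.
  by apply: ae_onW => x _; apply: key; rewrite sqrrN expr1n.
apply: le_int => //; first exact: L1_scale.
by apply: ae_onW => x _; have := key x 1; rewrite expr1n mul1r; apply.
Qed.

Lemma trace_le : l * y l ^+ 2 <= 2 * int l (fun x => y x ^+ 2) + int l (fun x => g x ^+ 2).
Proof.
rewrite -weighted_trace_eq; have := weighted_mul_le ltr01; rewrite invr1 !mul1r.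
by move=> /ler_normlP[_]; lra.
Qed.

(** Young's inequality with weight [1/2] in [weighted_trace_eq] lets the left side absorb half of
    the integral of [y^2]. *)
Lemma hardy_le : int l (fun x => y x ^+ 2) <= 2 * l * y l ^+ 2 + 4 * int l (fun x => g x ^+ 2).
Proof.
have := weighted_trace_eq; have h : 0 < 2^-1 :> R by rewrite invr_gt0.
have := weighted_mul_le h; rewrite invrK => /ler_normlP[]; lra.
Qed.

End WeightedTrace.

Lemma summands_le (R : realDomainType) (b1 b2 b3 b4 b5 b6 : R) :
  0 <= b1 -> 0 <= b2 -> 0 <= b3 -> 0 <= b4 -> 0 <= b5 -> 0 <= b6 ->
  let n := b1 + b2 + b3 + b4 + b5 + b6 in
  [/\ b1 <= n, b2 <= n, b3 <= n, b4 <= n & b5 <= n /\ b6 <= n].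
Proof. by move=> h1 h2 h3 h4 h5 h6 n; rewrite /n; split; [| | | |split]; lra. Qed.

Section EnergySpace.
Context (R : realType) (l : R) (K EI : R -> R) (l_gt0 : 0 < l)
  (K_A : classA l K) (EI_A : classA l EI) (m2 : mu_max l K EI < 2).
Local Notation m := (mu_max l K EI).

Lemma muK_le : mu l K <= m. Proof. by rewrite /mu_max le_max lexx. Qed.
Lemma muEI_le : mu l EI <= m. Proof. by rewrite /mu_max le_max lexx orbT. Qed.

Definition shear (y : field2 R) (x : R) : R := Num.sqrt (K x) * (derive1 y.1 x + y.2 x).
Definition bend (y : field2 R) (x : R) : R := Num.sqrt (EI x) * derive1 y.2 x.

(** Multiplying [shear] or [bend] by this weight of [K] or [EI] produces [x (w' + psi)] or [x psi'].
    The weight is bounded, by [sq_coef_le], so these are square integrable. *)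
Definition root_weight (a : R -> R) (x : R) : R := x / Num.sqrt (a x).

Lemma measurable_sqrt_coef a : classA l a -> mu l a <= m ->
  measurable_fun (`]0, l[%classic : set R) (fun x => Num.sqrt (a x)).
Proof.
move=> aA am; apply: measurableT_comp; last first.
  exact: (loc_ac_measurable (coef_ac l_gt0 aA am)).
by apply: continuous_measurable_fun; exact: sqrt_continuous.
Qed.

Lemma sqrt_coef_gt0 a x : classA l a -> 0 < x < l -> 0 < Num.sqrt (a x).
Proof.
by move=> aA /andP[x0 xl]; rewrite sqrtr_gt0; apply: (coef_gt0 aA); rewrite x0 ltW.
Qed.

Lemma measurable_root_weight a : classA l a -> mu l a <= m ->
  measurable_fun (`]0, l[%classic : set R) (root_weight a).
Proof.
move=> aA am.
have mw : measurable_fun (`]0, l[%classic : set R) (fun x => x * Num.sqrt ((a x)^-1)).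
  apply: measurable_funM; first exact: measurable_id.
  apply: measurableT_comp; last first.
    exact: (loc_ac_measurable (coefV_ac l_gt0 aA am)).
  by apply: continuous_measurable_fun; exact: sqrt_continuous.
apply: eq_measurable_fun mw => x; rewrite inE/= in_itv/= => xI.
rewrite /root_weight sqrtrV// ltW// (coef_gt0 aA)//.
by case/andP: xI => -> /ltW.
Qed.

Lemma root_weight_sq a x : classA l a -> 0 < x < l -> root_weight a x ^+ 2 = x ^+ 2 / a x.
Proof.
move=> aA xI; rewrite /root_weight expr_div_n sqr_sqrtr// ltW// (coef_gt0 aA)//.
by case/andP: xI => -> /ltW.
Qed.

Lemma root_weight_le a x : classA l a -> mu l a <= m -> 0 < x < l ->
  `|root_weight a x| <= l / Num.sqrt (a l).
Proof.
move=> aA am xI; have al : 0 < a l by apply: (coef_gt0 aA); rewrite l_gt0 lexx.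
have h0 : 0 <= l / Num.sqrt (a l) by rewrite divr_ge0// ?sqrtr_ge0 ltW.
rewrite -(@ler_pXn2r _ 2) ?nnegrE// real_normK ?num_real// root_weight_sq//.
rewrite expr_div_n sqr_sqrtr ?(ltW al)//; apply: (sq_coef_le l_gt0 aA am m2).
by case/andP: xI => -> /ltW.
Qed.

Lemma derive1_lin (f g : R -> R) (a b : R) : loc_abs_continuous l f -> loc_abs_continuous l g ->
  ae_on l (fun x => derive1 (fun x => a * f x + b * g x) x = a * derive1 f x + b * derive1 g x).
Proof.
move=> acf acg; apply: ae_onS2 (loc_ac_is_derive acf l_gt0) (loc_ac_is_derive acg l_gt0).
move=> x _ df dg; apply: is_derive1E; apply: is_derive_eq; rewrite /GRing.scale/=; ring.
Qed.

Lemma loc_ac_lin (f g : R -> R) (a b : R) : loc_abs_continuous l f -> loc_abs_continuous l g ->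
  loc_abs_continuous l (fun x => a * f x + b * g x).
Proof. by move=> acf acg; apply: loc_acD; apply: loc_acZ. Qed.

Lemma field_lin1 (y z : field2 R) (a b : R) :
  (a *: y + b *: z).1 = (fun x => a * y.1 x + b * z.1 x).
Proof. by []. Qed.

Lemma field_lin2 (y z : field2 R) (a b : R) :
  (a *: y + b *: z).2 = (fun x => a * y.2 x + b * z.2 x).
Proof. by []. Qed.

Lemma state_lin1 (U V : state R) (a b : R) : (a *: U + b *: V).1 = a *: U.1 + b *: V.1.
Proof. by []. Qed.

Lemma state_lin2 (U V : state R) (a b : R) : (a *: U + b *: V).2 = a *: U.2 + b *: V.2.
Proof. by []. Qed.

Lemma shear_lin (y z : field2 R) a b : V1 l K EI y -> V1 l K EI z ->
  ae_on l (fun x => shear (a *: y + b *: z) x = a * shear y x + b * shear z x).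
Proof.
move=> [_ [acy _] _ _] [_ [acz _] _ _]; apply: ae_onS (derive1_lin a b acy acz) => x _ E.
by rewrite /shear field_lin1 field_lin2 E; ring.
Qed.

Lemma bend_lin (y z : field2 R) a b : V1 l K EI y -> V1 l K EI z ->
  ae_on l (fun x => bend (a *: y + b *: z) x = a * bend y x + b * bend z x).
Proof.
move=> [_ [_ acy] _ _] [_ [_ acz] _ _]; apply: ae_onS (derive1_lin a b acy acz) => x _ E.
by rewrite /bend field_lin2 E; ring.
Qed.

Lemma measurable_shear (y : field2 R) : loc_abs_continuous l y.1 -> loc_abs_continuous l y.2 ->
  measurable_fun (`]0, l[%classic : set R) (shear y).
Proof.
move=> ac1 ac2; apply: measurable_funM; first exact: (measurable_sqrt_coef K_A muK_le).
apply: measurable_funD; first exact: loc_ac_measurable_derive1.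
exact: loc_ac_measurable.
Qed.

Lemma measurable_bend (y : field2 R) : loc_abs_continuous l y.2 ->
  measurable_fun (`]0, l[%classic : set R) (bend y).
Proof.
move=> ac2; apply: measurable_funM; first exact: (measurable_sqrt_coef EI_A muEI_le).
exact: loc_ac_measurable_derive1.
Qed.

Lemma V1_lin (y z : field2 R) a b : V1 l K EI y -> V1 l K EI z -> V1 l K EI (a *: y + b *: z).
Proof.
move=> Vy Vz; have S := shear_lin a b Vy Vz; have T := bend_lin a b Vy Vz.
have [[Ly1 Ly2] [acy1 acy2] Sy Ty] := Vy; have [[Lz1 Lz2] [acz1 acz2] Sz Tz] := Vz.
have Sy' : L2 l (shear y) := Sy; have Ty' : L2 l (bend y) := Ty.
have Sz' : L2 l (shear z) := Sz; have Tz' : L2 l (bend z) := Tz.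
have ac1 : loc_abs_continuous l (a *: y + b *: z).1 by rewrite field_lin1; exact: loc_ac_lin.
have ac2 : loc_abs_continuous l (a *: y + b *: z).2 by rewrite field_lin2; exact: loc_ac_lin.
have LS : L2 l (shear (a *: y + b *: z)).
  apply: (L2_ae (measurable_shear ac1 ac2) (L2_lin a b Sy' Sz')).
  by apply: ae_onS S => x _ H; rewrite H.
have LT : L2 l (bend (a *: y + b *: z)).
  apply: (L2_ae (measurable_bend ac2) (L2_lin a b Ty' Tz')).
  by apply: ae_onS T => x _ H; rewrite H.
have L12 : L2 l (a *: y + b *: z).1 /\ L2 l (a *: y + b *: z).2.
  by rewrite field_lin1 field_lin2; split; apply: L2_lin.
exact: (And4 L12 (conj ac1 ac2) LS LT).
Qed.

Lemma VR_lin (y z : field2 R) a b : VR l K EI y -> VR l K EI z -> VR l K EI (a *: y + b *: z).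
Proof.
move=> [Vy y0] [Vz z0]; split; first exact: V1_lin.
move=> w; have [y1 y2] := y0 w; have [z1 z2] := z0 w.
by rewrite field_lin1 field_lin2; split; apply: cvg0_lin.
Qed.

Lemma inH_lin (a b : R) (U V : state R) : inH l K EI U -> inH l K EI V -> inH l K EI (a *: U + b *: V).
Proof.
move=> [HU [LU1 LU2]] [HV [LV1 LV2]]; split; first by rewrite state_lin1; exact: VR_lin.
by rewrite !state_lin2 field_lin1 field_lin2; split; apply: L2_lin.
Qed.

Lemma sqnormH_split (U : state R) : inH l K EI U -> sqnormH l K EI U =
  int l (fun x => U.1.1 x ^+ 2) + int l (fun x => U.1.2 x ^+ 2)
  + int l (fun x => shear U.1 x ^+ 2) + int l (fun x => bend U.1 x ^+ 2)
  + int l (fun x => U.2.1 x ^+ 2) + int l (fun x => U.2.2 x ^+ 2).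
Proof.
move=> [[[[L1' L2'] _ SU TU] _] [L3 L4]].
have SU' : L2 l (shear U.1) := SU; have TU' : L2 l (bend U.1) := TU.
have e1 : sqnormL2 l U.1 = int l (fun x => U.1.1 x ^+ 2) + int l (fun x => U.1.2 x ^+ 2).
  by rewrite -intD//; exact: L2_sq.
have e2 : sqnormL2 l U.2 = int l (fun x => U.2.1 x ^+ 2) + int l (fun x => U.2.2 x ^+ 2).
  by rewrite -intD//; exact: L2_sq.
have e3 : sqnormV l K EI U.1 = sqnormL2 l U.1 +
    (int l (fun x => shear U.1 x ^+ 2) + int l (fun x => bend U.1 x ^+ 2)).
  rewrite -intD; [|exact: L2_sq..]; rewrite /sqnormV; congr (_ + _); apply: eq_int => x xI.
  have xl : 0 < x <= l by case/andP: xI => -> /ltW.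
  by rewrite /shear /bend !exprMn !sqr_sqrtr// ltW ?(coef_gt0 K_A) ?(coef_gt0 EI_A).
by rewrite /sqnormH e3 e1 e2 !addrA.
Qed.

Lemma sqnormH_ge0 (U : state R) : inH l K EI U -> 0 <= sqnormH l K EI U.
Proof. by move=> HU; rewrite sqnormH_split// !addr_ge0// int_sq_ge0. Qed.

Local Notation feature := (feature (inH l K EI) (sqnormH l K EI) l).
Local Notation functional := (bounded_functional (inH l K EI) (sqnormH l K EI)).

Lemma feature_basic :
  [/\ feature (fun U => U.1.1), feature (fun U => U.1.2), feature (fun U => shear U.1),
      feature (fun U => bend U.1) & feature (fun U => U.2.1) /\ feature (fun U => U.2.2)].
Proof.
have bnd (f : state R -> R -> R) :
    (forall U, inH l K EI U -> int l (fun x => f U x ^+ 2) <= sqnormH l K EI U) ->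
    exists2 C, 0 <= C & forall U, inH l K EI U -> int l (fun x => f U x ^+ 2) <= C * sqnormH l K EI U.
  by move=> H; exists 1 => // U HU; rewrite mul1r H.
have pos f : 0 <= int l (fun x => f x ^+ 2) by exact: int_sq_ge0.
have lin1 (U V : state R) a b : (a *: U + b *: V).1.1 = (fun x => a * U.1.1 x + b * V.1.1 x).
  by rewrite state_lin1 field_lin1.
have lin2 (U V : state R) a b : (a *: U + b *: V).1.2 = (fun x => a * U.1.2 x + b * V.1.2 x).
  by rewrite state_lin1 field_lin2.
have lin3 (U V : state R) a b : (a *: U + b *: V).2.1 = (fun x => a * U.2.1 x + b * V.2.1 x).
  by rewrite state_lin2 field_lin1.
have lin4 (U V : state R) a b : (a *: U + b *: V).2.2 = (fun x => a * U.2.2 x + b * V.2.2 x).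
  by rewrite state_lin2 field_lin2.
have le U : inH l K EI U -> let n := sqnormH l K EI U in
    [/\ int l (fun x => U.1.1 x ^+ 2) <= n, int l (fun x => U.1.2 x ^+ 2) <= n,
        int l (fun x => shear U.1 x ^+ 2) <= n, int l (fun x => bend U.1 x ^+ 2) <= n &
        int l (fun x => U.2.1 x ^+ 2) <= n /\ int l (fun x => U.2.2 x ^+ 2) <= n].
  by move=> HU; rewrite /= sqnormH_split//; exact: summands_le.
split; [| | | |split]; split.
- by move=> U [[[[]]]].
- by move=> a b u v _ _; rewrite lin1; apply: ae_onW.
- by apply: bnd => U /le[].
- by move=> U [[[[]]]].
- by move=> a b u v _ _; rewrite lin2; apply: ae_onW.
- by apply: bnd => U /le[].
- by move=> U [[[]]].
- move=> a b u v [[Vu _] _] [[Vv _] _]; rewrite state_lin1; exact: shear_lin.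
- by apply: bnd => U /le[].
- by move=> U [[[]]].
- move=> a b u v [[Vu _] _] [[Vv _] _]; rewrite state_lin1; exact: bend_lin.
- by apply: bnd => U /le[].
- by move=> U [_ []].
- by move=> a b u v _ _; rewrite lin3; apply: ae_onW.
- by apply: bnd => U /le[_ _ _ _ []].
- by move=> U [_ []].
- by move=> a b u v _ _; rewrite lin4; apply: ae_onW.
- by apply: bnd => U /le[_ _ _ _ []].
Qed.

End EnergySpace.

(** The arithmetic of [energy_form_coercive], with numbers for integrals: [iks], [iet] and [isub]
    stand for those of the squares of [x (w' + psi)], [x psi'] and [x w']. *)
Lemma hardy_combine (R : realFieldType) (cK cE l r i g d : R) :
  0 < l -> 0 < r -> 0 < i -> 0 < g -> 0 < d ->
  exists2 C, 0 < C & forall w psi iw ipsi iS iT iv ip iks iet isub : R,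
    0 <= iS -> 0 <= iT -> 0 <= iv -> 0 <= ip ->
    iks <= cK ^+ 2 * iS -> iet <= cE ^+ 2 * iT ->
    ipsi <= 2 * l * psi ^+ 2 + 4 * iet -> iw <= 2 * l * w ^+ 2 + 4 * isub ->
    isub <= 2 * iks + 2 * l ^+ 2 * ipsi ->
    iw + ipsi + iS + iT + iv + ip <=
      C * (r * iv + i * ip + iS + iT + g * w ^+ 2 + d * psi ^+ 2).
Proof.
have sums (b1 b2 b3 b4 b5 b6 : R) : 0 <= b1 -> 0 <= b2 -> 0 <= b3 -> 0 <= b4 -> 0 <= b5 -> 0 <= b6 ->
    let c := 1 + b1 + b2 + b3 + b4 + b5 + b6 in
    0 < c /\ [/\ b1 <= c, b2 <= c, 1 + b3 <= c, 1 + b4 <= c & b5 <= c /\ b6 <= c].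
  by move=> h1 h2 h3 h4 h5 h6 c; rewrite /c; split; [|split; [| | | |split]]; lra.
(* [q] counts [ipsi] once for itself and [8 l^2] times through the bounds on [isub] and then
   [iw]. *)
move=> l0 r0 i0 g0 d0; pose q := 1 + 8 * l ^+ 2.
have q0 : 0 <= q by have := sqr_ge0 l; rewrite /q; lra.
pose a1 := 2 * l / g; pose a2 := q * (2 * l / d); pose a3 := 8 * cK ^+ 2; pose a4 := q * (4 * cE ^+ 2).
have p1 : 0 <= a1 by rewrite divr_ge0 ?mulr_ge0 ?ltW.
have p2 : 0 <= a2 by rewrite mulr_ge0// divr_ge0 ?mulr_ge0 ?ltW.
have p3 : 0 <= a3 by rewrite mulr_ge0 ?sqr_ge0.
have p4 : 0 <= a4 by rewrite mulr_ge0// mulr_ge0// sqr_ge0.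
have p5 : 0 <= r^-1 by rewrite invr_ge0 ltW.
have p6 : 0 <= i^-1 by rewrite invr_ge0 ltW.
pose C := 1 + a1 + a2 + a3 + a4 + r^-1 + i^-1.
have [C0 [c1 c2 c3 c4 [c5 c6]]] := sums _ _ _ _ _ _ p1 p2 p3 p4 p5 p6.
exists C => //.
move=> w psi iw ipsi iS iT iv ip iks iet isub iS0 iT0 iv0 ip0 hS hT hpsi hw hsub.
have h1 : 2 * l * w ^+ 2 <= C * (g * w ^+ 2).
  apply: le_trans (ler_wpM2r (mulr_ge0 (ltW g0) (sqr_ge0 w)) c1).
  by rewrite mulrA divfK// gt_eqF.
have h2 : q * (2 * l * psi ^+ 2) <= C * (d * psi ^+ 2).
  apply: le_trans (ler_wpM2r (mulr_ge0 (ltW d0) (sqr_ge0 psi)) c2).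
  by rewrite -[a2 * _]mulrA [2 * l / d * _]mulrA divfK// gt_eqF.
have h3 : iS + a3 * iS <= C * iS by rewrite -[X in X + _]mul1r -mulrDl; exact: ler_wpM2r.
have h4 : iT + a4 * iT <= C * iT by rewrite -[X in X + _]mul1r -mulrDl; exact: ler_wpM2r.
have h5 : iv <= C * (r * iv).
  by apply: le_trans (ler_wpM2r (mulr_ge0 (ltW r0) iv0) c5); rewrite mulKf// gt_eqF.
have h6 : ip <= C * (i * ip).
  by apply: le_trans (ler_wpM2r (mulr_ge0 (ltW i0) ip0) c6); rewrite mulKf// gt_eqF.
have h7 : q * ipsi <= q * (2 * l * psi ^+ 2) + a4 * iT.
  rewrite -[a4 * _]mulrA -mulrDr; apply: ler_wpM2l => //; apply: le_trans hpsi _.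
  by rewrite lerD2l -mulrA ler_wpM2l.
have h8 : iw + ipsi <= 2 * l * w ^+ 2 + a3 * iS + q * ipsi.
  by move: hS hw hsub; rewrite /a3 /q; move: (2 * l * w ^+ 2) (cK ^+ 2) (l ^+ 2) => x y z; lra.
move: h1 h2 h3 h4 h5 h6 h7 h8; rewrite !(mulrDr C).
move: (2 * l * w ^+ 2) (q * (2 * l * _)) (q * ipsi) (C * (g * _)) (C * (d * _)) (C * (r * _)) (C * (i * _)).
by move: (C * iS) (C * iT) (a3 * iS) (a4 * iT) {hS hT hpsi hw hsub} => *; lra.
Qed.

(** * The energy form and the dilation form *)

Section Forms.
Context (R : realType) (l rho Irho gamma delta : R) (K EI : R -> R) (l_gt0 : 0 < l)
  (rho_gt0 : 0 < rho) (Irho_gt0 : 0 < Irho) (gamma_gt0 : 0 < gamma) (delta_gt0 : 0 < delta)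
  (K_A : classA l K) (EI_A : classA l EI) (m2 : mu_max l K EI < 2).
Local Notation m := (mu_max l K EI).
Local Notation H := (inH l K EI).
Local Notation N := (sqnormH l K EI).
Local Notation feature := (feature H N l).
Local Notation functional := (bounded_functional H N).
Local Notation form := (bounded_form H N).
Local Notation int := (int l).
Local Notation shear := (shear K).
Local Notation bend := (bend EI).
Local Notation kap := (root_weight K).
Local Notation eps := (root_weight EI).

Lemma weighted_bend (y : field2 R) :
  ae_on l (fun x => x * derive1 y.2 x = eps x * bend y x).
Proof.
apply: ae_onW => x xI; rewrite /root_weight /bend mulrACA.
by field; rewrite gt_eqF// (sqrt_coef_gt0 EI_A xI).
Qed.

Lemma weighted_shear (y : field2 R) :
  ae_on l (fun x => x * derive1 y.1 x = kap x * shear y x - x * y.2 x).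
Proof.
apply: ae_onW => x xI; rewrite /root_weight /shear.
by field; rewrite gt_eqF// (sqrt_coef_gt0 K_A xI).
Qed.

Lemma L2_weighted_bend (y : field2 R) : V1 l K EI y -> L2 l (fun x => eps x * bend y x).
Proof.
case=> _ _ _ T; apply: L2_bmul (T : L2 l (bend y)); first exact: (measurable_root_weight l_gt0 EI_A (muEI_le l K EI)).
by move=> x xI; exact: (root_weight_le l_gt0 m2 EI_A (muEI_le l K EI) xI).
Qed.

Lemma L2_kap_shear (y : field2 R) : V1 l K EI y -> L2 l (fun x => kap x * shear y x).
Proof.
case=> _ _ S _; apply: L2_bmul (S : L2 l (shear y)); first exact: (measurable_root_weight l_gt0 K_A (muK_le l K EI)).
by move=> x xI; exact: (root_weight_le l_gt0 m2 K_A (muK_le l K EI) xI).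
Qed.

Lemma L2_weighted_shear (y : field2 R) : V1 l K EI y ->
  L2 l (fun x => kap x * shear y x - x * y.2 x).
Proof.
move=> Vy; have [[_ L] _ _ _] := Vy.
apply: eq_L2 (L2_lin 1 (-1) (L2_kap_shear Vy) (L2_idM L)) => x _.
by rewrite mul1r mulN1r.
Qed.

Lemma feature_bend : feature (fun U x => eps x * bend U.1 x).
Proof.
have [_ _ _ T _] := feature_basic l_gt0 K_A EI_A.
apply: feature_bmul T; first exact: (measurable_root_weight l_gt0 EI_A (muEI_le l K EI)).
by move=> x xI; exact: (root_weight_le l_gt0 m2 EI_A (muEI_le l K EI) xI).
Qed.

Lemma feature_shear : feature (fun U x => kap x * shear U.1 x).
Proof.
have [_ _ S _ _] := feature_basic l_gt0 K_A EI_A.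
apply: feature_bmul S; first exact: (measurable_root_weight l_gt0 K_A (muK_le l K EI)).
by move=> x xI; exact: (root_weight_le l_gt0 m2 K_A (muK_le l K EI) xI).
Qed.

Lemma trace2_functional : functional (fun U => U.1.2 l).
Proof.
have [_ [_ _ [C C0 Cp]] _ _ _] := feature_basic l_gt0 K_A EI_A.
have [_ _ [D D0 Dp]] := feature_bend.
split; first by move=> a b U V _ _; rewrite state_lin1 field_lin2.
exists (l^-1 * (2 * C + D)).
  by rewrite mulr_ge0 ?invr_ge0 ?(ltW l_gt0)// addr_ge0 ?mulr_ge0.
move=> U HU; have [[V _] _] := HU; have [[_ L] [_ ac] _ _] := V.
have := trace_le l_gt0 ac L (L2_weighted_bend V) (weighted_bend U.1).
rewrite -mulrA ler_pdivlMl// => h; apply: le_trans h _.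
have := Cp U HU; have := Dp U HU; lra.
Qed.

Lemma trace1_functional : functional (fun U => U.1.1 l).
Proof.
have [[_ _ [B B0 Bp]] [_ _ [C C0 Cp]] _ _ _] := feature_basic l_gt0 K_A EI_A.
have [_ _ [D D0 Dp]] := feature_shear.
split; first by move=> a b U V _ _; rewrite state_lin1 field_lin1.
exists (l^-1 * (2 * B + 2 * D + 2 * l ^+ 2 * C)).
  by rewrite mulr_ge0 ?invr_ge0 ?(ltW l_gt0)// !addr_ge0 ?mulr_ge0 ?sqr_ge0 ?(ltW l_gt0).
move=> U HU; have [[V _] _] := HU; have [[L L2'] [ac _] _ _] := V.
have := trace_le l_gt0 ac L (L2_weighted_shear V) (weighted_shear U.1).
move=> h; rewrite -[X in _ <= X]mulrA ler_pdivlMl//; apply: le_trans h _.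
have h1 := sq_sub_le_int l_gt0 (L2_kap_shear V) L2'.
have : int (fun x => U.1.1 x ^+ 2) <= B * N U := Bp U HU.
have : int (fun x => (kap x * shear U.1 x) ^+ 2) <= D * N U := Dp U HU.
have : l ^+ 2 * int (fun x => U.1.2 x ^+ 2) <= l ^+ 2 * (C * N U) := ler_wpM2l (sqr_ge0 l) (Cp U HU).
move: (N U) h1 => n.
set i1 := int (fun x => (_ - _) ^+ 2); set i2 := int (fun x => (kap x * _) ^+ 2).
set i3 := int (fun x => U.1.2 x ^+ 2); set i4 := int (fun x => U.1.1 x ^+ 2).
clearbody i1 i2 i3 i4; lra.
Qed.

(** Twice the energy, polarised. *)
Definition energy_form (U V : state R) : R :=
  rho * int (fun x => U.2.1 x * V.2.1 x) + Irho * int (fun x => U.2.2 x * V.2.2 x)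
  + int (fun x => shear U.1 x * shear V.1 x) + int (fun x => bend U.1 x * bend V.1 x)
  + gamma * (U.1.1 l * V.1.1 l) + delta * (U.1.2 l * V.1.2 l).

(** The factors [kap * shear] and [eps * bend] are [x (w' + psi)] and [x psi'] in the form of
    [feature]s. Velocities come from [U] and displacements from [V], so the time derivative splits
    into two values of the form. *)
Definition dilation_form (U V : state R) : R :=
  rho * int (fun x => U.2.1 x * (kap x * shear V.1 x))
  + Irho * int (fun x => U.2.2 x * (eps x * bend V.1 x))
  + m / 4 * (rho * int (fun x => U.2.1 x * V.1.1 x) + Irho * int (fun x => U.2.2 x * V.1.2 x)).

Lemma bounded_energy_form : form energy_form.
Proof.
have [w psi S T [v phi]] := feature_basic l_gt0 K_A EI_A.
have t1 := trace1_functional; have t2 := trace2_functional.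
have lin := @inH_lin R l K EI l_gt0 K_A EI_A.
have h1 := bounded_formZ rho (feature_form lin v v).
have h2 := bounded_formZ Irho (feature_form lin phi phi).
have h3 := feature_form lin S S; have h4 := feature_form lin T T.
have h5 := bounded_formZ gamma (bounded_form_prod t1 t1).
have h6 := bounded_formZ delta (bounded_form_prod t2 t2).
have D := @bounded_formD R (state R) H N.
exact: (D _ _ (D _ _ (D _ _ (D _ _ (D _ _ h1 h2) h3) h4) h5) h6).
Qed.

Lemma bounded_dilation_form : form dilation_form.
Proof.
have [w psi S T [v phi]] := feature_basic l_gt0 K_A EI_A.
have lin := @inH_lin R l K EI l_gt0 K_A EI_A.
have h1 := bounded_formZ rho (feature_form lin v feature_shear).
have h2 := bounded_formZ Irho (feature_form lin phi feature_bend).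
have h3 := bounded_formZ rho (feature_form lin v w).
have h4 := bounded_formZ Irho (feature_form lin phi psi).
have D := @bounded_formD R (state R) H N.
exact: (D _ _ (D _ _ h1 h2) (bounded_formZ (m / 4) (D _ _ h3 h4))).
Qed.

Lemma energy_form_sq (U : state R) : energy_form U U =
  rho * int (fun x => U.2.1 x ^+ 2) + Irho * int (fun x => U.2.2 x ^+ 2)
  + int (fun x => shear U.1 x ^+ 2) + int (fun x => bend U.1 x ^+ 2)
  + gamma * U.1.1 l ^+ 2 + delta * U.1.2 l ^+ 2.
Proof. by rewrite /energy_form !expr2; do 5 congr (_ + _). Qed.

(** The energy lacks the integrals of [w^2] and [psi^2]. The Hardy inequality recovers [psi] first,
    and then [w] through [x w' = x (w' + psi) - x psi]. *)
Lemma energy_form_coercive : exists2 C, 0 < C & forall U, H U -> N U <= C * energy_form U U.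
Proof.
have [C C0 comb] := hardy_combine (l / Num.sqrt (K l)) (l / Num.sqrt (EI l))
  l_gt0 rho_gt0 Irho_gt0 gamma_gt0 delta_gt0.
exists C => // U HU; have [[V _] [Lv Lphi]] := HU; have [[Lw Lpsi] [acw acpsi] S T] := V.
rewrite (sqnormH_split _ _ HU)// energy_form_sq.
apply: (comb _ _ _ _ _ _ _ _ (int (fun x => (kap x * shear U.1 x) ^+ 2))
  (int (fun x => (eps x * bend U.1 x) ^+ 2)) (int (fun x => (kap x * shear U.1 x - x * U.1.2 x) ^+ 2)));
  rewrite ?int_sq_ge0//.
- apply: int_bmul_le (S : L2 l (shear U.1)); first exact: (measurable_root_weight l_gt0 K_A (muK_le l K EI)).
  by move=> x xI; exact: (root_weight_le l_gt0 m2 K_A (muK_le l K EI) xI).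
- apply: int_bmul_le (T : L2 l (bend U.1)); first exact: (measurable_root_weight l_gt0 EI_A (muEI_le l K EI)).
  by move=> x xI; exact: (root_weight_le l_gt0 m2 EI_A (muEI_le l K EI) xI).
- exact: (hardy_le l_gt0 acpsi Lpsi (L2_weighted_bend V) (weighted_bend U.1)).
- exact: (hardy_le l_gt0 acw Lw (L2_weighted_shear V) (weighted_shear U.1)).
- exact: (sq_sub_le_int l_gt0 (L2_kap_shear V) Lpsi).
Qed.

End Forms.

(** * Static deflections under end loads *)

Section Multiplier.
Context (R : realType) (l gamma delta : R) (K EI : R -> R) (l_gt0 : 0 < l)
  (gamma_gt0 : 0 < gamma) (delta_gt0 : 0 < delta)
  (K_A : classA l K) (EI_A : classA l EI) (m2 : mu_max l K EI < 2).
Local Notation cvg0 f := (f x @[x --> 0^'+] --> (0 : R)).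

(* [Z = P zB + Q zA] and [Xi = P xB + Q xA] solve the static system
   [K (Z' + Xi) = chi P], [EI Xi' = chi (P (x - l) + Q)] loaded by the forces
   [P] and [Q] at [x = l] if [chi = 1]. *)
Record multiplier (chi : R) (zA zB xA xB : R -> R) : Prop := Multiplier {
  mult_ac : [/\ loc_abs_continuous l zA, loc_abs_continuous l zB,
                loc_abs_continuous l xA & loc_abs_continuous l xB];
  mult_bounded : exists2 C, 0 <= C & forall x, 0 < x <= l ->
    [/\ `|zA x| <= C, `|zB x| <= C, `|xA x| <= C & `|xB x| <= C];
  mult_derive : forall x, 0 < x < l ->
    [/\ is_derive x 1 zA (- xA x), is_derive x 1 zB (chi / K x - xB x),
        is_derive x 1 xA (chi / EI x) & is_derive x 1 xB (chi * (x - l) / EI x)];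
  mult_zero : (weakly_degenerate l K EI /\ [/\ cvg0 zA, cvg0 zB, cvg0 xA & cvg0 xB])
    \/ (strongly_degenerate l K EI /\ chi = 0);
  mult_pos : exists2 c, 0 < c & forall P Q,
    c * (P ^+ 2 + Q ^+ 2) <= P * (P * zB l + Q * zA l) + Q * (P * xB l + Q * xA l)
      + chi * (P ^+ 2 / gamma + Q ^+ 2 / delta) }.

Lemma primitive_loc_ac (f : R -> R) : loc_abs_continuous l f -> L1 l f ->
  exists G : R -> R, [/\ loc_abs_continuous l G,
    forall x, 0 < x < l -> is_derive x 1 G (f x), cvg0 G &
    exists2 C, 0 <= C & forall x, 0 < x <= l -> `|G x| <= C].
Proof.
move=> acf L1f; apply: primitive_exists => //.
  by move=> x xI; apply: (loc_ac_continuous_at acf).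
move=> x xI; have [M M0 HM] := abs_continuous_bounded (acf x xI).
by exists M => // y /andP[xy yl]; apply: HM; rewrite xy ltW.
Qed.

(** [Z = P + Q (l - x)] and [Xi = Q] carry neither shear nor bending. They need not vanish at 0,
    because there [p] and [q] do; at [l] they equal [P] and [Q], which makes the quadratic form
    [P^2 + Q^2]. *)
Lemma strong_multiplier : strongly_degenerate l K EI ->
  multiplier 0 (fun x => l - x) (fun=> 1) (fun=> 1) (fun=> 0).
Proof.
move=> strong; split.
- split; [|exact: loc_ac_cst..].
  apply: loc_ac_ext (loc_acD (loc_ac_cst l) (loc_acZ (-1) (@loc_ac_id R l))) => x _.
  by rewrite mulN1r.
- exists (l + 1); first by rewrite addr_ge0 ?(ltW l_gt0).
  move=> x /andP[x0 xl]; split; rewrite ger0_norm//; lra.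
- move=> x _ /=; rewrite !mul0r subrr; split; try exact: is_derive_cst.
  by have := is_deriveB (is_derive_cst l x 1) (is_derive_id x 1); rewrite sub0r.
- by right.
- exists 1 => // P Q; rewrite subrr; lra.
Qed.

(** [1 / K] and [1 / EI] are integrable by [coefV_L1], so the static equations can be integrated
    from the clamped end 0, first for [Xi] and then for [Z]. *)
Lemma weak_multiplier : weakly_degenerate l K EI ->
  exists zA zB xA xB : R -> R, multiplier 1 zA zB xA xB.
Proof.
move=> weak; have [wK wE] := weak.
have K1 := coefV_L1 l_gt0 K_A (lexx _) wK; have E1 := coefV_L1 l_gt0 EI_A (lexx _) wE.
have acK := coefV_ac l_gt0 K_A (lexx _); have acE := coefV_ac l_gt0 EI_A (lexx _).
have bounded_L1 f : loc_abs_continuous l f ->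
    (exists2 C, 0 <= C & forall x, 0 < x <= l -> `|f x| <= C) -> L1 l f.
  move=> acf [C C0 fC]; apply: (L1_le _ (L1_cst l C)); first exact: loc_ac_measurable.
  by move=> x /andP[x0 xl]; apply: fC; rewrite x0 ltW.
have ac1 : loc_abs_continuous l (fun x => (x - l) * (EI x)^-1).
  apply: loc_acM => //; apply: loc_acD; [exact: loc_ac_id|exact: loc_ac_cst].
have [xA [acxA dxA xA0 bxA]] := primitive_loc_ac acE E1.
have [|xB [acxB dxB xB0 bxB]] := primitive_loc_ac ac1.
  apply: (L1_le _ (L1_scale l E1)); first exact: loc_ac_measurable.
  move=> x xI; have := coef_gt0 EI_A (_ : 0 < x <= l); case/andP: xI => x0 xl.
  rewrite x0 (ltW xl) => /(_ isT) E0.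
  rewrite normrM [X in _ * X]ger0_norm ?invr_ge0 ?(ltW E0)// ler_wpM2r ?invr_ge0 ?(ltW E0)//.
  by rewrite ler0_norm; lra.
have [|zA [aczA dzA zA0 bzA]] := primitive_loc_ac (loc_acZ (-1) acxA).
  by apply: L1_scale; exact: bounded_L1.
have [|zB [aczB dzB zB0 bzB]] := primitive_loc_ac (loc_acD acK (loc_acZ (-1) acxB)).
  by apply: L1_add => //; apply: L1_scale; exact: bounded_L1.
exists zA, zB, xA, xB; split => //.
- move: bzA bzB bxA bxB => [C1 C10 h1] [C2 C20 h2] [C3 C30 h3] [C4 C40 h4].
  exists (Num.max (Num.max C1 C2) (Num.max C3 C4)); first by rewrite !le_max C10.
  by move=> x xI; rewrite !le_max h1// h2// h3// h4// !orbT.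
- move=> x xI; have d1 := dzA x xI; have d2 := dzB x xI; have d3 := dxA x xI; have d4 := dxB x xI.
  by rewrite !mul1r; split=> //; [rewrite -mulN1r|rewrite -mulN1r].
- by left.
(* Positivity comes from [P^2 / gamma + Q^2 / delta]; the remaining terms, the work [f l] of the end
   loads, are only shown to be nonnegative. *)
- pose c := Num.min gamma^-1 delta^-1.
  have c1 : c <= gamma^-1 by rewrite /c ge_min lexx.
  have c2 : c <= delta^-1 by rewrite /c ge_min lexx orbT.
  exists c; first by rewrite lt_min !invr_gt0 gamma_gt0.
  move=> P Q.
  (* Force times deflection plus moment times rotation. Its derivative is the sum of squares
     [P^2 / K + (P (x - l) + Q)^2 / EI] and it vanishes at 0. *)
  pose f x := P * (P * zB x + Q * zA x) + (P * (x - l) + Q) * (P * xB x + Q * xA x).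
  have acf : loc_abs_continuous l f.
    apply: loc_acD; first by apply: loc_acZ; apply: loc_acD; apply: loc_acZ.
    apply: loc_acM; last by apply: loc_acD; apply: loc_acZ.
    apply: loc_acD; last exact: loc_ac_cst.
    by apply: loc_acZ; apply: loc_acD; [exact: loc_ac_id|exact: loc_ac_cst].
  have f'0 : ae_on l (fun x => 0 <= derive1 f x).
    apply: ae_onW => x xI; have d1 := dzA x xI; have d2 := dzB x xI.
    have d3 := dxA x xI; have d4 := dxB x xI.
    have x1 : 0 < x <= l by case/andP: xI => -> /ltW.
    have Kx := coef_gt0 K_A x1; have Ex := coef_gt0 EI_A x1.
    have df : is_derive x 1 f (P ^+ 2 / K x + (P * (x - l) + Q) ^+ 2 / EI x).
      apply: is_derive_eq; rewrite /GRing.scale/=; field.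
      by rewrite (gt_eqF Kx) (gt_eqF Ex).
    by rewrite (is_derive1E df) addr_ge0 ?divr_ge0 ?sqr_ge0 ?ltW.
  have f0 : cvg0 f.
    have : f x @[x --> 0^'+] --> P * (P * 0 + Q * 0) + (P * (0 - l) + Q) * (P * 0 + Q * 0).
      have cx : x - l @[x --> 0^'+] --> (0 - l).
        apply: cvgB; last exact: cvg_cst.
        by apply: cvg_within_filter; exact: cvg_id.
      apply: cvgD; first by apply: cvgM; [exact: cvg_cst|apply: cvgD; apply: cvgM => //; exact: cvg_cst].
      apply: cvgM; last by apply: cvgD; apply: cvgM => //; exact: cvg_cst.
      by apply: cvgD; [apply: cvgM => //; exact: cvg_cst|exact: cvg_cst].
    by rewrite !mulr0 !addr0 !mulr0 addr0.
  have : 0 <= f l.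
    apply: (cvgr_to_le f0); near=> x; apply: loc_ac_le => //; apply/andP; split; near: x.
      exact: nbhs_right_gt.
    exact: nbhs_right_le.
  rewrite /f subrr mulr0 add0r mul1r.
  have := ler_wpM2r (sqr_ge0 P) c1; have := ler_wpM2r (sqr_ge0 Q) c2.
  rewrite -!(mulrC _ (_ ^+ 2)); lra.
Unshelve. all: by end_near. Qed.

Lemma multiplier_exists : weakly_degenerate l K EI \/ strongly_degenerate l K EI ->
  exists chi (zA zB xA xB : R -> R), multiplier chi zA zB xA xB.
Proof.
case=> [/weak_multiplier[zA [zB [xA [xB h]]]]|/strong_multiplier h].
  by exists 1, zA, zB, xA, xB.
by exists 0, (fun x => l - x), (fun=> 1), (fun=> 1), (fun=> 0).
Qed.

(** Reciprocity between the moving beam and the static one: [K] and [EI] enter symmetrically, so the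
    elastic terms of both cancel and only values at [l] remain. *)
Lemma multiplier_eq chi zA zB xA xB P Q (w psi p q : R -> R) : multiplier chi zA zB xA xB ->
  VR l K EI (w, psi) -> H1 l p -> H1 l q ->
  ae_on l (fun x => p x = K x * (derive1 w x + psi x)) ->
  ae_on l (fun x => q x = EI x * derive1 psi x) ->
  (strongly_degenerate l K EI -> cvg0 p /\ cvg0 q) ->
  let Z x := P * zB x + Q * zA x in let Xi x := P * xB x + Q * xA x in
  int l (fun x => derive1 p x * Z x + (derive1 q x - p x) * Xi x) =
  p l * Z l + q l * Xi l - chi * (P * w l + Q * psi l).
Proof.
move=> [[aczA aczB acxA acxB] [C C0 bnd] der zero _] [[_ [acw acpsi] _ _] VR0].
move=> [acp Lp Lp'] [acq Lq Lq'] Ep Eq pq0 Z Xi; rewrite /= in acw acpsi VR0.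
have acZ : loc_abs_continuous l Z by exact: loc_ac_lin.
have acXi : loc_abs_continuous l Xi by exact: loc_ac_lin.
pose D := `|P| * C + `|Q| * C.
have bZ x : 0 < x <= l -> `|Z x| <= D.
  move=> xI; have [z1 z2 _ _] := bnd x xI; apply: le_trans (ler_normD _ _) _.
  by rewrite !normrM lerD// ler_wpM2l.
have bXi x : 0 < x <= l -> `|Xi x| <= D.
  move=> xI; have [_ _ z1 z2] := bnd x xI; apply: le_trans (ler_normD _ _) _.
  by rewrite !normrM lerD// ler_wpM2l.
pose f x := p x * Z x + q x * Xi x - chi * (P * w x + (P * (x - l) + Q) * psi x).
rewrite (_ : p l * Z l + _ - _ = f l); last by rewrite /f subrr mulr0 add0r.
have LZ := loc_ac_bounded_L2 acZ bZ; have LXi := loc_ac_bounded_L2 acXi bXi.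
apply: (FTC_eq l_gt0).
- apply: loc_ac_ext (loc_acD (loc_acD (loc_acM acp acZ) (loc_acM acq acXi)) (loc_acZ (- chi) _)).
    by move=> x _; rewrite mulNr.
  apply: loc_acD; first exact: loc_acZ.
  apply: loc_acM => //; apply: loc_acD; last exact: loc_ac_cst.
  by apply: loc_acZ; apply: loc_acD; [exact: loc_ac_id|exact: loc_ac_cst].
- apply: L1_add; first exact: L2_mul.
  apply: L2_mul LXi; apply: eq_L2 (L2_lin 1 (-1) Lq' Lp) => x _.
  by rewrite mul1r mulN1r.
- apply: ae_onS2 (ae_onI Ep Eq) (ae_onI (ae_onI (loc_ac_is_derive acp l_gt0) (loc_ac_is_derive acq l_gt0))
    (ae_onI (loc_ac_is_derive acw l_gt0) (loc_ac_is_derive acpsi l_gt0))).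
  move=> x xI [Epx Eqx] [[dp dq] [dw dpsi]]; have [d1 d2 d3 d4] := der x xI.
  have x1 : 0 < x <= l by case/andP: xI => -> /ltW.
  have Kx := coef_gt0 K_A x1; have Ex := coef_gt0 EI_A x1.
  apply: is_derive1E; apply: is_derive_eq; rewrite /GRing.scale/= /Z /Xi Epx Eqx; field.
  by rewrite (gt_eqF Kx) (gt_eqF Ex).
(* At 0 the strong case has [p] and [q] vanishing against bounded [Z] and [Xi], with [chi = 0]
   removing the rest. In the weak case [Z], [Xi], [w] and [psi] vanish while [p] and [q] have
   limits. *)
- case: zero => [[weak [z1 z2 z3 z4]]|[strong chi0]]; last first.
    have [p0 q0] := pq0 strong.
    have D0 : 0 <= D by rewrite addr_ge0// mulr_ge0.
    have small (y z : R -> R) : cvg0 y -> (forall x, 0 < x <= l -> `|z x| <= D) -> cvg0 (fun x => y x * z x).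
      move=> y0 zD; have y2 : cvg0 (fun x => y x ^+ 2).
        have c := cvgM y0 y0; rewrite mulr0 in c; exact: c.
      apply: (cvg0_of_sq (sqr_ge0 D)) y2; near=> x.
      rewrite exprMn mulrC ler_wpM2r ?sqr_ge0// -[leLHS]real_normK ?num_real// lerXn2r ?nnegrE//.
      apply: zD; apply/andP; split; near: x.
        exact: nbhs_right_gt.
      exact: nbhs_right_le.
    have : p x * Z x + q x * Xi x @[x --> 0^'+] --> 0 + 0 by apply: cvgD; exact: small.
    rewrite addr0; apply: cvg_trans; apply: near_eq_cvg; apply: nearW => x.
    by rewrite /f chi0 mul0r subr0.
  have [/= w0 psi0] := VR0 weak.
  have Z0 : cvg0 Z by exact: cvg0_lin.
  have Xi0 : cvg0 Xi by exact: cvg0_lin.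
  have pc := FTC_cvg0 l_gt0 acp (L2_L1 Lp') (ae_onW (fun _ _ => erefl)).
  have qc := FTC_cvg0 l_gt0 acq (L2_L1 Lq') (ae_onW (fun _ _ => erefl)).
  have cx : x - l @[x --> 0^'+] --> (0 - l).
    apply: cvgB; last exact: cvg_cst.
    by apply: cvg_within_filter; exact: cvg_id.
  move: pc qc; move: (p l - _) (q l - _) => a b pc qc.
  rewrite [X in _ --> X](_ : 0 = a * 0 + b * 0 - chi * (P * 0 + (P * (0 - l) + Q) * 0)); last by ring.
    apply: cvgB; first by apply: cvgD; [exact: (cvgM pc Z0)|exact: (cvgM qc Xi0)].
    apply: cvgM; first exact: cvg_cst.
    apply: cvgD; first by apply: cvgM => //; exact: cvg_cst.
    apply: cvgM => //; apply: cvgD; last exact: cvg_cst.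
    by apply: cvgM => //; exact: cvg_cst.
Unshelve. all: by end_near. Qed.

End Multiplier.

(** * The operator: traces, dissipation and pointwise bounds *)

Section HasInt.
Context (R : realType) (l : R).

(** Carries integrability along with the value, so that the integral of a long sum is evaluated by
    composing terms. *)
Definition has_int (f : R -> R) (c : R) := L1 l f /\ int l f = c.

Lemma has_intD f g c d : has_int f c -> has_int g d -> has_int (fun x => f x + g x) (c + d).
Proof. by move=> [L1f <-] [L1g <-]; split; [exact: L1_add|rewrite intD]. Qed.

Lemma has_intZ k f c : has_int f c -> has_int (fun x => k * f x) (k * c).
Proof. by move=> [L1f <-]; split; [exact: L1_scale|rewrite intZ]. Qed.

Lemma has_int_mul f g : L2 l f -> L2 l g -> has_int (fun x => f x * g x) (int l (fun x => f x * g x)).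
Proof. by move=> Lf Lg; split=> //; exact: L2_mul. Qed.

Lemma has_int_sq f : L2 l f -> has_int (fun x => f x ^+ 2) (int l (fun x => f x ^+ 2)).
Proof. by move=> Lf; split=> //; exact: L2_sq. Qed.

Lemma has_int_L1 f : L1 l f -> has_int f (int l f).
Proof. by []. Qed.

End HasInt.

Section Operator.
Context (R : realType) (l rho Irho alpha beta gamma delta : R) (K EI : R -> R) (l_gt0 : 0 < l)
  (rho_gt0 : 0 < rho) (Irho_gt0 : 0 < Irho) (alpha_gt0 : 0 < alpha) (beta_gt0 : 0 < beta)
  (gamma_gt0 : 0 < gamma) (delta_gt0 : 0 < delta) (K_A : classA l K) (EI_A : classA l EI)
  (degenerate : weakly_degenerate l K EI \/ strongly_degenerate l K EI)
  (small : mu_max l K EI + 2 * C_h l rho Irho K EI < 2).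
Local Notation m := (mu_max l K EI).
Local Notation Ch := (C_h l rho Irho K EI).
Local Notation H := (inH l K EI).
Local Notation N := (sqnormH l K EI).
Local Notation form := (bounded_form H N).
Local Notation int := (int l).
Local Notation shear := (shear K).
Local Notation bend := (bend EI).
Local Notation kap := (root_weight K).
Local Notation eps := (root_weight EI).
Local Notation BE := (energy_form l rho Irho gamma delta K EI).
Local Notation op := (timoshenko_op l rho Irho alpha beta gamma delta K EI).

Lemma C_h_ge0 : 0 <= Ch.
Proof. by rewrite /C_h le_max mulr_ge0 ?sqrtr_ge0 ?(ltW l_gt0). Qed.

Lemma mu_max_lt2 : m < 2.
Proof. by have := C_h_ge0; have := small; lra. Qed.

Lemma mu_ge0 a : classA l a -> 0 <= mu l a.
Proof.
move=> aA; have l0 := l_gt0; have := coef_derive_lr aA (lexx _) (_ : 0 < l / 2 < l).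
have -> : 0 < l / 2 < l by apply/andP; split; lra.
move=> /(_ isT) /andP[h1 h2]; have a0 : 0 < a (l / 2).
  by apply: (coef_gt0 aA); apply/andP; split; lra.
by rewrite -(pmulr_lge0 _ a0); lra.
Qed.

Lemma mu_max_ge0 : 0 <= m.
Proof. by rewrite /mu_max le_max mu_ge0. Qed.

Record op_data (U F : state R) (p q : R -> R) : Prop := OpData {
  op_inH : H U; op_VR : VR l K EI U.2; op_imH : H F; op_H1p : H1 l p; op_H1q : H1 l q;
  op_p : ae_on l (fun x => p x = K x * (derive1 U.1.1 x + U.1.2 x));
  op_q : ae_on l (fun x => q x = EI x * derive1 U.1.2 x);
  op_bdry_p : p l + gamma * U.1.1 l = - alpha * U.2.1 l;
  op_bdry_q : q l + delta * U.1.2 l = - beta * U.2.2 l;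
  op_strong : strongly_degenerate l K EI ->
    p x @[x --> 0^'+] --> (0 : R) /\ q x @[x --> 0^'+] --> (0 : R);
  op_im1 : forall x, 0 < x <= l -> F.1.1 x = U.2.1 x /\ F.1.2 x = U.2.2 x;
  op_im2 : ae_on l (fun x => F.2.1 x = derive1 p x / rho /\ F.2.2 x = (derive1 q x - p x) / Irho)
}.

(** The operator fixes [F.1] almost everywhere only. With [H F] both sides are absolutely
    continuous, so the equality with [U.2] holds on all of []0, l]] and gives the traces at [l]. *)
Lemma op_dataP (U F : state R) : op U F -> H F -> exists p q, op_data U F p q.
Proof.
case: U => [[w psi] [v phi]] [VU [VV [p [q [[Hp Hq] [Ep Eq] [bp bq] str EF]]]]] HF.
have [[LV _ _ _] _] := VV; have [_ acV _ _] := VV.1; have [_ acF _ _] := HF.1.1.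
exists p, q; split => //.
- move=> x xI; split.
    apply: (loc_ac_ae_eq acF.1 acV.1) xI.
    by apply: ae_onS EF => y _ [].
  apply: (loc_ac_ae_eq acF.2 acV.2) xI.
  by apply: ae_onS EF => y _ [].
- by apply: ae_onS EF => y _ [].
Qed.

Section Data.
Context (U F : state R) (p q : R -> R) (D : op_data U F p q).

Lemma op_shear x : 0 < x < l -> shear F.1 x = shear U.2 x /\ bend F.1 x = bend U.2 x.
Proof.
move=> xI; have x1 : 0 < x <= l by case/andP: xI => -> /ltW.
have nI : \forall y \near x, 0 < y <= l.
  have : x \in `]0, l[ by rewrite in_itv.
  by move=> /near_in_itvoo; apply: filterS => y; rewrite in_itv/= => /andP[-> /ltW].
have e1 : derive1 F.1.1 x = derive1 U.2.1 x.
  by rewrite !derive1E; apply: near_eq_derive; rewrite ?oner_neq0//; apply: filterS nI => y /(op_im1 D)[].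
have e2 : derive1 F.1.2 x = derive1 U.2.2 x.
  by rewrite !derive1E; apply: near_eq_derive; rewrite ?oner_neq0//; apply: filterS nI => y /(op_im1 D)[].
by have [h1 h2] := op_im1 D x1; rewrite /shear /bend e1 e2 h2.
Qed.

Lemma op_ae : ae_on l (fun x =>
  [/\ [/\ is_derive x 1 U.1.1 (derive1 U.1.1 x), is_derive x 1 U.1.2 (derive1 U.1.2 x),
          is_derive x 1 U.2.1 (derive1 U.2.1 x) & is_derive x 1 U.2.2 (derive1 U.2.2 x)],
      is_derive x 1 p (derive1 p x) /\ is_derive x 1 q (derive1 q x),
      p x = K x * (derive1 U.1.1 x + U.1.2 x) /\ q x = EI x * derive1 U.1.2 x,
      F.2.1 x = derive1 p x / rho /\ F.2.2 x = (derive1 q x - p x) / Irho &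
      [/\ shear F.1 x = Num.sqrt (K x) * (derive1 U.2.1 x + U.2.2 x),
          bend F.1 x = Num.sqrt (EI x) * derive1 U.2.2 x, F.1.1 x = U.2.1 x & F.1.2 x = U.2.2 x]]).
Proof.
have [[_ [ac1 ac2] _ _] _] := (op_inH D).1; have [[_ [ac3 ac4] _ _] _] := op_VR D.
have [acp _ _] := op_H1p D; have [acq _ _] := op_H1q D.
apply: ae_onS2 (ae_onI (op_im2 D) (ae_onI (op_p D) (op_q D)))
  (ae_onI (ae_onI (loc_ac_is_derive acp l_gt0) (loc_ac_is_derive acq l_gt0))
    (ae_onI (ae_onI (loc_ac_is_derive ac1 l_gt0) (loc_ac_is_derive ac2 l_gt0))
            (ae_onI (loc_ac_is_derive ac3 l_gt0) (loc_ac_is_derive ac4 l_gt0)))).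
move=> x xI [h1' h3] [[h4 h5] [[h6 h7] [h8 h9]]]; have [e1 e2] := op_shear xI.
have x1 : 0 < x <= l by case/andP: xI => -> /ltW.
have [h10 h11] := op_im1 D x1.
exact: (And5 (And4 h6 h7 h8 h9) (conj h4 h5) h3 h1' (And4 e1 e2 h10 h11)).
Qed.

Lemma trace_product_cvg0 (y : field2 R) : VR l K EI y ->
  p x * y.1 x + q x * y.2 x @[x --> 0^'+] --> (0 : R).
Proof.
move=> [Vy Vy0]; have [[L3 L4] [ac3 ac4] _ _] := Vy.
have [acp _ Lp] := op_H1p D; have [acq _ Lq] := op_H1q D.
have c1 : p x * y.1 x @[x --> 0^'+] --> (0 : R).
  apply: (boundary_product_cvg0 l_gt0 degenerate acp Lp ac3 L3 (L2_weighted_shear l_gt0 K_A mu_max_lt2 Vy)).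
  - exact: (weighted_shear K_A).
  - by move=> /Vy0[].
  - by move=> /(op_strong D)[].
have c2 : q x * y.2 x @[x --> 0^'+] --> (0 : R).
  apply: (boundary_product_cvg0 l_gt0 degenerate acq Lq ac4 L4 (L2_weighted_bend l_gt0 EI_A mu_max_lt2 Vy)).
  - exact: (weighted_bend EI_A).
  - by move=> /Vy0[].
  - by move=> /(op_strong D)[].
by have c := cvgD c1 c2; rewrite addr0 in c; exact: c.
Qed.

(** The interior terms of the form are the integral of the derivative of [p v + q phi], whose value
    at 0 vanishes; at [l] the feedback conditions leave the dissipation. *)
Lemma energy_form_op : BE U F = - alpha * U.2.1 l ^+ 2 - beta * U.2.2 l ^+ 2.
Proof.
have [[_ _ S T] _] := (op_inH D).1; have [Lv Lphi] := (op_inH D).2.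
have [[[_ _ SF TF] _] [LF1 LF2]] := op_imH D.
have [acp _ Lp] := op_H1p D; have [acq _ Lq] := op_H1q D.
have [[_ [ac3 ac4] _ _] _] := op_VR D.
have S' : L2 l (shear U.1) := S; have T' : L2 l (bend U.1) := T.
have SF' : L2 l (shear F.1) := SF; have TF' : L2 l (bend F.1) := TF.
have m1 := L2_mul Lv LF1; have m2 := L2_mul Lphi LF2; have m3 := L2_mul S' SF'.
have m4 := L2_mul T' TF'; have n1 := L1_scale rho m1; have n2 := L1_scale Irho m2.
have := @FTC_eq _ _ l_gt0 (fun x => p x * U.2.1 x + q x * U.2.2 x) _
  (loc_acD (loc_acM acp ac3) (loc_acM acq ac4)) (L1_add (L1_add (L1_add n1 n2) m3) m4) _
  (trace_product_cvg0 (op_VR D)).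
rewrite intD//; last by apply: L1_add => //; exact: L1_add.
rewrite intD//; last exact: L1_add.
rewrite intD// intZ// intZ// => E.
have := op_bdry_p D; have := op_bdry_q D; have l1 : 0 < l <= l by rewrite l_gt0 lexx.
have [f1 f2] := op_im1 D l1.
rewrite /energy_form E; last first.
  apply: ae_onS op_ae => x xI [[d1 d2 d3 d4] [dp dq] [Ep Eq] [F1 F2] [F3 F4 _ _]].
  apply: is_derive1E; apply: is_derive_eq; rewrite /GRing.scale/= F1 F2 F3 F4 /shear /bend Ep Eq.
  have x1 : 0 < x <= l by case/andP: xI => -> /ltW.
  have := sqr_sqrtr (ltW (coef_gt0 K_A x1)); have := sqr_sqrtr (ltW (coef_gt0 EI_A x1)).
  move: (Num.sqrt (K x)) (Num.sqrt (EI x)) => k e <- <-.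
  move: (derive1 U.1.1 x) (derive1 U.1.2 x) (derive1 U.2.1 x) (derive1 U.2.2 x) (derive1 p x) (derive1 q x)
    (U.1.2 x) (U.2.1 x) (U.2.2 x) {Ep Eq F1 F2 F3 F4 d1 d2 d3 d4 dp dq}.
  move=> w' psi' v' phi' p' q' psi v phi.
  by field; rewrite (gt_eqF rho_gt0) (gt_eqF Irho_gt0).
by rewrite f1 f2 => /(canRL (addrK _)) -> /(canRL (addrK _)) ->; ring.
Qed.

End Data.

Lemma log_slope a : classA l a -> mu l a <= m ->
  measurable_fun (`]0, l[%classic : set R) (fun x => x * derive1 a x / a x) /\
  forall x, 0 < x < l -> `|x * derive1 a x / a x| <= m.
Proof.
move=> aA am; split.
  apply: measurable_funM; last exact: (loc_ac_measurable (coefV_ac l_gt0 aA am)).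
  apply: measurable_funM; first exact: measurable_id.
  exact: (loc_ac_measurable_derive1 l_gt0 (coef_ac l_gt0 aA am)).
move=> x xI; have := coef_derive_lr aA am xI.
have ax : 0 < a x by apply: (coef_gt0 aA); case/andP: xI => -> /ltW.
by rewrite ler_norml ler_pdivrMr// ler_pdivlMr// mulNr.
Qed.

(** This is the coefficient of [shear * bend] in the coupling [p x psi']. The second entry of [C_h]
    dominates it since [l] is at most the maximum of 1 and [l^2]. *)
Lemma coupling_le x : 0 < x < l -> `|Num.sqrt (K x) * eps x| <= Ch.
Proof.
move=> xI; have x1 : 0 < x <= l by case/andP: xI => -> /ltW.
have x2 : 0 <= x <= l by case/andP: x1 => /ltW -> ->.
have l0 := ltW l_gt0; have l1 : 0 < l <= l by rewrite l_gt0 lexx.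
have El := coef_gt0 EI_A l1; have Kx := coef_gt0 K_A x1; have Ex := coef_gt0 EI_A x1.
have KN := coef_le_supnorm l_gt0 K_A x2.
have h0 : 0 <= Num.sqrt (supnorm l K / EI l) * l by rewrite mulr_ge0 ?sqrtr_ge0.
apply: (@le_trans _ _ (Num.sqrt (supnorm l K / EI l) * l)).
  rewrite -(@ler_pXn2r _ 2) ?nnegrE// real_normK ?num_real// exprMn sqr_sqrtr ?(ltW Kx)//.
  rewrite (root_weight_sq EI_A xI) exprMn sqr_sqrtr.
    have -> : supnorm l K / EI l * l ^+ 2 = supnorm l K * (l ^+ 2 / EI l) by rewrite mulrAC mulrA.
    apply: ler_pM; rewrite ?(ltW Kx) ?KN ?(divr_ge0 (sqr_ge0 _) (ltW Ex))//.
    exact: (sq_coef_le l_gt0 EI_A (muEI_le l K EI) mu_max_lt2 x1).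
  by rewrite divr_ge0 ?(ltW El)// (le_trans (ltW Kx)).
rewrite /C_h le_max; apply/orP; right; rewrite ler_wpM2l ?sqrtr_ge0// le_max.
by have [//|l1'] := leP l 1; rewrite expr2 ler_peMl ?orbT// ltW.
Qed.

(** The inertial coupling of deflection and rotation. Completing the square in [r v - phi], with
    [r^2 = rho / Irho], yields the first entry of [C_h]. *)
Lemma gyration_le x (v phi : R) : 0 < x < l ->
  rho * x * (v * phi) <= Ch / 2 * (rho * v ^+ 2 + Irho * phi ^+ 2).
Proof.
move=> /andP[x0 xl]; pose r := Num.sqrt (rho / Irho).
have I0 := Irho_gt0; have rI : rho = r ^+ 2 * Irho.
  by rewrite sqr_sqrtr ?divr_ge0 ?ltW// divfK// gt_eqF.
have r0 : 0 <= r by exact: sqrtr_ge0.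
have rC : x * r <= Ch.
  by rewrite /C_h le_max; apply/orP; left; rewrite ler_wpM2r// ltW.
apply: (@le_trans _ _ (x * r / 2 * (rho * v ^+ 2 + Irho * phi ^+ 2))).
  rewrite rI -subr_ge0.
  have -> : x * r / 2 * (r ^+ 2 * Irho * v ^+ 2 + Irho * phi ^+ 2) - r ^+ 2 * Irho * x * (v * phi) =
     x * r / 2 * Irho * (r * v - phi) ^+ 2 by field.
  have q0 : 0 <= x * r / 2 by rewrite mulr_ge0 ?invr_ge0// mulr_ge0// ltW.
  by rewrite mulr_ge0 ?sqr_ge0// mulr_ge0// ltW.
apply: ler_wpM2r; last by rewrite ler_wpM2r ?invr_ge0.
by apply: addr_ge0; apply: mulr_ge0; rewrite ?sqr_ge0// ltW.
Qed.

End Operator.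

(** The decay at one point [x]: [s] and [t] are [shear] and [bend], [k] and [e] the slopes
    [x K' / K] and [x EI' / EI], [c] the coefficient of [coupling_le]. Both energy densities keep
    the factor [(2 - m) / 4] and each coupling takes away [C / 2]. *)
Lemma dilation_density_ge (R : realFieldType) (m C rho I x c k e s t v f : R) :
  rho * x * (v * f) <= C / 2 * (rho * v ^+ 2 + I * f ^+ 2) -> - C <= c <= C -> k <= m -> e <= m ->
  (2 - m - 2 * C) / 4 * (rho * v ^+ 2 + I * f ^+ 2 + (s ^+ 2 + t ^+ 2)) <=
  (1 + m / 2) / 2 * (s ^+ 2 + t ^+ 2) + - 2^-1 * (k * s * s + e * t * t) + c * (s * t)
  + (2^-1 - m / 4) * (rho * v ^+ 2 + I * f ^+ 2) + - rho * (x * v * f).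
Proof.
move=> hg /andP[c1 c2] hk he.
have h1 := ler_wpM2r (sqr_ge0 s) hk; have h2 := ler_wpM2r (sqr_ge0 t) he.
rewrite -subr_ge0 in c2; rewrite -subr_ge0 opprK in c1.
have h3 := mulr_ge0 c1 (sqr_ge0 (s + t)); have h4 := mulr_ge0 c2 (sqr_ge0 (s - t)).
by move: hg h1 h2 h3 h4; lra.
Qed.

(** * Decay produced by the dilation form *)

Section Dilation.
Context (R : realType) (l rho Irho alpha beta gamma delta : R) (K EI : R -> R) (l_gt0 : 0 < l)
  (rho_gt0 : 0 < rho) (Irho_gt0 : 0 < Irho) (alpha_gt0 : 0 < alpha) (beta_gt0 : 0 < beta)
  (gamma_gt0 : 0 < gamma) (delta_gt0 : 0 < delta) (K_A : classA l K) (EI_A : classA l EI)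
  (degenerate : weakly_degenerate l K EI \/ strongly_degenerate l K EI)
  (small : mu_max l K EI + 2 * C_h l rho Irho K EI < 2).
Local Notation m := (mu_max l K EI).
Local Notation Ch := (C_h l rho Irho K EI).
Local Notation int := (int l).
Local Notation shear := (shear K).
Local Notation bend := (bend EI).
Local Notation kap := (root_weight K).
Local Notation eps := (root_weight EI).
Local Notation op_data := (op_data l rho Irho alpha beta gamma delta K EI).

Definition interior_energy (U : state R) : R :=
  rho * int (fun x => U.2.1 x ^+ 2) + Irho * int (fun x => U.2.2 x ^+ 2)
  + (int (fun x => shear U.1 x ^+ 2) + int (fun x => bend U.1 x ^+ 2)).

Lemma dilation_form_op (U F : state R) (p q : R -> R) : op_data U F p q ->
  dilation_form l rho Irho K EI F U + dilation_form l rho Irho K EI U F + (2 - m - 2 * Ch) / 4 * interior_energy U <=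
  l / 2 * (p l ^+ 2 / K l + q l ^+ 2 / EI l + rho * U.2.1 l ^+ 2 + Irho * U.2.2 l ^+ 2)
  + m / 4 * (p l * U.1.1 l + q l * U.1.2 l).
Proof.
move=> D; have m2 := mu_max_lt2 l_gt0 small; have muK := muK_le l K EI; have muE := muEI_le l K EI.
have VU := (op_inH D).1.1; have [[Lw Lpsi] [acw acpsi] S T] := VU; have [Lv Lphi] := (op_inH D).2.
have VF := (op_imH D).1.1; have [[LF11 LF12] _ SF TF] := VF; have [LF21 LF22] := (op_imH D).2.
have [acp Lp0 Lp] := op_H1p D; have [acq Lq0 Lq] := op_H1q D.
have [[_ [acv acphi] _ _] _] := op_VR D.
have S' : L2 l (shear U.1) := S; have T' : L2 l (bend U.1) := T.
have kS := L2_kap_shear l_gt0 K_A m2 VU; have eT := L2_weighted_bend l_gt0 EI_A m2 VU.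
have kSF := L2_kap_shear l_gt0 K_A m2 VF; have eTF := L2_weighted_bend l_gt0 EI_A m2 VF.
have [mK bK] := log_slope l_gt0 K_A muK; have [mE bE] := log_slope l_gt0 EI_A muE.
have LKS := L2_bmul mK bK S'; have LET := L2_bmul mE bE T'.
have iG1 := has_intD (has_intD (has_intZ rho (has_int_mul LF21 kS)) (has_intZ Irho (has_int_mul LF22 eT)))
  (has_intZ (m / 4) (has_intD (has_intZ rho (has_int_mul LF21 Lw)) (has_intZ Irho (has_int_mul LF22 Lpsi)))).
have iG2 := has_intD (has_intD (has_intZ rho (has_int_mul Lv kSF)) (has_intZ Irho (has_int_mul Lphi eTF)))
  (has_intZ (m / 4) (has_intD (has_intZ rho (has_int_mul Lv LF11)) (has_intZ Irho (has_int_mul Lphi LF12)))).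
have iG := has_intD iG1 iG2.
have iX := has_intZ ((2 - m - 2 * Ch) / 4)
  (has_intD (has_intD (has_intZ rho (has_int_sq Lv)) (has_intZ Irho (has_int_sq Lphi)))
            (has_intD (has_int_sq S') (has_int_sq T'))).
(* The integrand assembled here complements the derivative of the form to an exact derivative
   ([EGW]); by [XW] it dominates the decay density. *)
have [L1W E1] := has_intD (has_intD (has_intD (has_intD
  (has_intZ ((1 + m / 2) / 2) (has_intD (has_int_sq S') (has_int_sq T')))
  (has_intZ (- 2^-1) (has_intD (has_int_mul LKS S') (has_int_mul LET T'))))
  (has_int_mul Lp0 eT))
  (has_intZ (2^-1 - m / 4) (has_intD (has_intZ rho (has_int_sq Lv)) (has_intZ Irho (has_int_sq Lphi)))))
  (has_intZ (- rho) (has_int_mul (L2_idM Lv) Lphi)).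
have XW := le_int iX.1 L1W _.
have [L1GW EGW] := has_intD iG (has_int_L1 L1W).
(* The four terms weighted by [x] are nonnegative, so [FTC_le] asks only for the limit of
   [p w + q psi] at 0. *)
pose FF x := 2^-1 * (x * (p x * p x * (K x)^-1)) + 2^-1 * (x * (q x * q x * (EI x)^-1))
  + (rho / 2 * (x * (U.2.1 x * U.2.1 x)) + Irho / 2 * (x * (U.2.2 x * U.2.2 x)))
  + m / 4 * (p x * U.1.1 x + q x * U.1.2 x).
have acFF : loc_abs_continuous l FF.
  have acV a : classA l a -> mu l a <= m -> loc_abs_continuous l (fun x => (a x)^-1).
    by move=> aA am; exact: coefV_ac am.
  have idM f : loc_abs_continuous l f -> loc_abs_continuous l (fun x => x * f x).
    by move=> acf; apply: loc_acM => //; exact: loc_ac_id.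
  apply: loc_acD; last by apply: loc_acZ; apply: loc_acD; exact: loc_acM.
  apply: loc_acD; last by apply: loc_acD; apply: loc_acZ; apply: idM; exact: loc_acM.
  by apply: loc_acD; apply: loc_acZ; apply: idM; apply: loc_acM; [exact: loc_acM|exact: acV|exact: loc_acM|exact: acV].
have FTC := @FTC_le _ _ l_gt0 FF _ (fun x => m / 4 * (p x * U.1.1 x + q x * U.1.2 x)) acFF L1GW.
move: FTC XW; rewrite EGW iX.2 => FTC XW.
have -> : l / 2 * (p l ^+ 2 / K l + q l ^+ 2 / EI l + rho * U.2.1 l ^+ 2 + Irho * U.2.2 l ^+ 2)
  + m / 4 * (p l * U.1.1 l + q l * U.1.2 l) = FF l.
  by rewrite /FF; ring.
have l0 := l_gt0; rewrite /dilation_form; apply: le_trans (FTC _ _ _).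
- rewrite lerD2l; apply: XW; apply: ae_onS (op_ae l_gt0 D) => x xI [_ _ [Ep _] _ _].
  have Ep' : p x = Num.sqrt (K x) * shear U.1 x.
    rewrite Ep /shear mulrA -expr2 sqr_sqrtr// ltW// (coef_gt0 K_A)//.
    by case/andP: xI => -> /ltW.
  have pe : p x * (eps x * bend U.1 x) = (Num.sqrt (K x) * eps x) * (shear U.1 x * bend U.1 x).
    by rewrite Ep'; ring.
  have := coupling_le l_gt0 K_A EI_A small xI; have := bK x xI; have := bE x xI.
  have := gyration_le K EI rho_gt0 Irho_gt0 (U.2.1 x) (U.2.2 x) xI; rewrite /= pe !ler_norml.
  move=> hg /andP[_ he] /andP[_ hk] hc; exact: dilation_density_ge.
- apply: ae_onS (op_ae l_gt0 D) => x xI [[d1 d2 d3 d4] [dp dq] [Ep Eq] [F1 F2] [F3 F4 F5 F6]].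
  have dK := coef_is_deriveV K_A xI; have dE := coef_is_deriveV EI_A xI.
  have x1 : 0 < x <= l by case/andP: xI => -> /ltW.
  have k0 := sqrt_coef_gt0 K_A xI; have e0 := sqrt_coef_gt0 EI_A xI.
  apply: is_derive1E; apply: is_derive_eq; rewrite /GRing.scale/= F1 F2 F3 F4 F5 F6 /shear /bend.
  rewrite /root_weight Ep Eq.
  have := sqr_sqrtr (ltW (coef_gt0 K_A x1)); have := sqr_sqrtr (ltW (coef_gt0 EI_A x1)).
  move: (Num.sqrt (K x)) (Num.sqrt (EI x)) k0 e0 => k e k0 e0 <- <-.
  move: (derive1 U.1.1 x) (derive1 U.1.2 x) (derive1 U.2.1 x) (derive1 U.2.2 x) (derive1 p x) (derive1 q x)
    (derive1 K x) (derive1 EI x) (U.1.1 x) (U.1.2 x) (U.2.1 x) (U.2.2 x) {Ep Eq F1 F2 F3 F4 F5 F6 d1 d2 d3 d4 dp dq dK dE}.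
  move=> w' psi' v' phi' p' q' K' E' w psi v phi.
  by field; rewrite (gt_eqF rho_gt0) (gt_eqF Irho_gt0) (gt_eqF k0) (gt_eqF e0).
- have c := trace_product_cvg0 l_gt0 K_A EI_A degenerate small D (op_inH D).1.
  have := cvgM (cvg_cst (m / 4)) c; rewrite mulr0; exact.
- move=> x xI; rewrite /FF lerDr; have x1 : 0 < x <= l by case/andP: xI => -> /ltW.
  have Kx := coef_gt0 K_A x1; have Ex := coef_gt0 EI_A x1.
  have x0 : 0 <= x by case/andP: x1 => /ltW.
  have rho0 := ltW rho_gt0; have I0 := ltW Irho_gt0.
  have sq (y : R) : 0 <= y * y by rewrite -expr2 sqr_ge0.
  have Kx' : 0 <= (K x)^-1 by rewrite invr_ge0 ltW.
  have Ex' : 0 <= (EI x)^-1 by rewrite invr_ge0 ltW.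
  have half : 0 <= 2^-1 :> R by rewrite invr_ge0.
  by repeat first [exact: sq|assumption|apply: addr_ge0|apply: mulr_ge0].
Qed.

End Dilation.

(** [E] is an energy to be absorbed with a small factor [s], and [D] a dissipation that may cost
    [1 / s]. The common [M >= 1] gives all cross terms of the multiplier identity the same bound. *)
Lemma young_le (R : realFieldType) (c a b s M E D : R) : 0 < s -> 1 <= M -> 0 <= E -> 
  a ^+ 2 <= M * E -> b ^+ 2 <= D -> c * (a * b) <= `|c| * (M * (s * E + D / s)).
Proof.
move=> s0 M1 E0 aE bD; have si : 0 < s^-1 by rewrite invr_gt0.
have h : `|a * b| <= s * a ^+ 2 + s^-1 * b ^+ 2.
  have e (t : R) : t ^+ 2 = 1 -> t * (a * b) <= s * a ^+ 2 + s^-1 * b ^+ 2.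
    move=> t1; have := sqr_ge0 (s * (t * a) - 2^-1 * b) => h1.
    have := mulr_ge0 (ltW si) h1; have -> : s^-1 * (s * (t * a) - 2^-1 * b) ^+ 2 =
      t ^+ 2 * (s * a ^+ 2) - t * (a * b) + 4^-1 * (s^-1 * b ^+ 2).
      by field; rewrite gt_eqF.
    rewrite t1; have := mulr_ge0 (ltW si) (sqr_ge0 b); lra.
  rewrite ler_norml lerNl -mulN1r !e ?sqrrN ?expr1n//.
  by have := e 1; rewrite expr1n mul1r => ->.
apply: le_trans (ler_norm _) _; rewrite normrM ler_wpM2l// (le_trans h)//.
have h1 := ler_wpM2l (ltW s0) aE; have D0 := le_trans (sqr_ge0 b) bD.
have h2 := ler_wpM2l (ltW si) bD; have h3 := ler_wpM2r (mulr_ge0 (ltW si) D0) M1.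
rewrite mulrDr (mulrC D); move: h1 h2 h3; lra.
Qed.

(** * Absorption of the displacement traces *)

Section MultiplierForm.
Context (R : realType) (l rho Irho alpha beta gamma delta : R) (K EI : R -> R) (l_gt0 : 0 < l)
  (rho_gt0 : 0 < rho) (Irho_gt0 : 0 < Irho) (alpha_gt0 : 0 < alpha) (beta_gt0 : 0 < beta)
  (gamma_gt0 : 0 < gamma) (delta_gt0 : 0 < delta) (K_A : classA l K) (EI_A : classA l EI)
  (m2 : mu_max l K EI < 2) (chi : R) (zA zB xA xB : R -> R)
  (mult : multiplier l gamma delta K EI chi zA zB xA xB).
Local Notation H := (inH l K EI).
Local Notation N := (sqnormH l K EI).
Local Notation int := (int l).
Local Notation op_data := (op_data l rho Irho alpha beta gamma delta K EI).
Local Notation interior_energy := (interior_energy l rho Irho K EI).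

(** The loads [P = gamma w(l)] and [Q = delta psi(l)] are taken from [V] and the velocities from
    [U]; this makes the multiplier functional a sum of products of bounded functionals. *)
Definition multiplier_form (U V : state R) : R :=
  rho * gamma * (int (fun x => U.2.1 x * zB x) * V.1.1 l)
  + rho * delta * (int (fun x => U.2.1 x * zA x) * V.1.2 l)
  + Irho * gamma * (int (fun x => U.2.2 x * xB x) * V.1.1 l)
  + Irho * delta * (int (fun x => U.2.2 x * xA x) * V.1.2 l).

Lemma multiplier_L2 : [/\ L2 l zA, L2 l zB, L2 l xA & L2 l xB].
Proof.
have [ac1 ac2 ac3 ac4] := mult_ac mult; have [C _ b] := mult_bounded mult.
by split; apply: (@loc_ac_bounded_L2 _ _ C) => // x /b[].
Qed.

Lemma bounded_multiplier_form : bounded_form H N multiplier_form.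
Proof.
have [LzA LzB LxA LxB] := multiplier_L2.
have [_ _ _ _ [v phi]] := feature_basic l_gt0 K_A EI_A.
have lin := @inH_lin R l K EI l_gt0 K_A EI_A.
have t1 := trace1_functional l_gt0 K_A EI_A m2; have t2 := trace2_functional l_gt0 K_A EI_A m2.
have h1 := bounded_formZ (rho * gamma) (bounded_form_prod (feature_functional lin LzB v) t1).
have h2 := bounded_formZ (rho * delta) (bounded_form_prod (feature_functional lin LzA v) t2).
have h3 := bounded_formZ (Irho * gamma) (bounded_form_prod (feature_functional lin LxB phi) t1).
have h4 := bounded_formZ (Irho * delta) (bounded_form_prod (feature_functional lin LxA phi) t2).
have D := @bounded_formD R (state R) H N.
exact: (D _ _ (D _ _ (D _ _ h1 h2) h3) h4).
Qed.

Lemma multiplier_form_eq (U F : state R) (p q : R -> R) : op_data U F p q ->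
  let P := gamma * U.1.1 l in let Q := delta * U.1.2 l in
  multiplier_form F U = p l * (P * zB l + Q * zA l) + q l * (P * xB l + Q * xA l)
    - chi * (P * U.1.1 l + Q * U.1.2 l).
Proof.
move=> D P Q; have [LzA LzB LxA LxB] := multiplier_L2; have [LF21 LF22] := (op_imH D).2.
have VU : VR l K EI (U.1.1, U.1.2) by case: U D @P @Q => [[? ?] ?] D _ _; exact: (op_inH D).1.
have := multiplier_eq l_gt0 K_A EI_A P Q mult VU (op_H1p D) (op_H1q D) (op_p D) (op_q D) (op_strong D).
move=> /= <-.
have [L1h Eh] := has_intD (has_intD (has_intD
  (has_intZ (rho * gamma * U.1.1 l) (has_int_mul LF21 LzB))
  (has_intZ (rho * delta * U.1.2 l) (has_int_mul LF21 LzA)))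
  (has_intZ (Irho * gamma * U.1.1 l) (has_int_mul LF22 LxB)))
  (has_intZ (Irho * delta * U.1.2 l) (has_int_mul LF22 LxA)).
have -> : multiplier_form F U = rho * gamma * U.1.1 l * int (fun x => F.2.1 x * zB x)
  + rho * delta * U.1.2 l * int (fun x => F.2.1 x * zA x)
  + Irho * gamma * U.1.1 l * int (fun x => F.2.2 x * xB x)
  + Irho * delta * U.1.2 l * int (fun x => F.2.2 x * xA x) by rewrite /multiplier_form; ring.
rewrite -Eh.
have [_ Lp Lp'] := op_H1p D; have [_ _ Lq'] := op_H1q D.
apply: int_ae; first exact: L1_measurable L1h.
  apply: L1_measurable; apply: L1_add; first exact: L2_mul Lp' (L2_lin P Q LzB LzA).
  apply: L2_mul (L2_lin P Q LxB LxA); apply: eq_L2 (L2_lin 1 (-1) Lq' Lp) => x _.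
  by rewrite mul1r mulN1r.
apply: ae_onS (op_im2 D) => x _ [-> ->]; rewrite /P /Q.
by field; rewrite (gt_eqF rho_gt0) (gt_eqF Irho_gt0).
Qed.

Lemma interior_energy_ge0 (U : state R) : 0 <= interior_energy U.
Proof.
by rewrite /interior_energy !addr_ge0// ?mulr_ge0// ?int_sq_ge0 ?(ltW rho_gt0) ?(ltW Irho_gt0).
Qed.

(** In [multiplier_form F U] the feedback conditions and [mult_pos] give the negative term, up to
    products of displacement traces with velocity traces. In [multiplier_form U F] the loads become
    velocity traces, times integrals bounded by the kinetic energy. [young_le] treats all eight
    products; [c] and [C] do not depend on [s]. *)
Lemma multiplier_form_op : exists c C, [/\ 0 < c, 0 <= C & forall U F p q, op_data U F p q ->
  forall s, 0 < s -> multiplier_form F U + multiplier_form U F <=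
    - c * (U.1.1 l ^+ 2 + U.1.2 l ^+ 2)
    + C * (s * (interior_energy U + (U.1.1 l ^+ 2 + U.1.2 l ^+ 2))
           + (U.2.1 l ^+ 2 + U.2.2 l ^+ 2) / s)].
Proof.
have [LzA LzB LxA LxB] := multiplier_L2; have [c c0 pos] := mult_pos mult.
pose iA := int (fun x => zA x ^+ 2); pose iB := int (fun x => zB x ^+ 2).
pose jA := int (fun x => xA x ^+ 2); pose jB := int (fun x => xB x ^+ 2).
have iA0 : 0 <= iA by exact: int_sq_ge0. have iB0 : 0 <= iB by exact: int_sq_ge0.
have jA0 : 0 <= jA by exact: int_sq_ge0. have jB0 : 0 <= jB by exact: int_sq_ge0.
have ri : 0 < rho^-1 by rewrite invr_gt0. have Ii : 0 < Irho^-1 by rewrite invr_gt0.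
pose M := 1 + rho^-1 * (iA + iB) + Irho^-1 * (jA + jB).
have rA := mulr_ge0 (ltW ri) iA0; have rB := mulr_ge0 (ltW ri) iB0.
have sA := mulr_ge0 (ltW Ii) jA0; have sB := mulr_ge0 (ltW Ii) jB0.
have M1 : 1 <= M by rewrite /M !mulrDr; lra.
have [MB MA NB NA] : [/\ rho^-1 * iB <= M, rho^-1 * iA <= M, Irho^-1 * jB <= M & Irho^-1 * jA <= M].
  by clearbody iA iB jA jB; rewrite /M !mulrDr; split; lra.
pose cs := `|- (alpha * gamma * zB l)| + `|- (alpha * delta * zA l)| + `|- (beta * gamma * xB l)|
  + `|- (beta * delta * xA l)| + `|rho * gamma| + `|rho * delta| + `|Irho * gamma| + `|Irho * delta|.
exists (c * Num.min (gamma ^+ 2) (delta ^+ 2)), (cs * M); split.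
- by rewrite mulr_gt0// lt_min !exprn_gt0.
- by rewrite mulr_ge0 ?(le_trans ler01 M1)// /cs !addr_ge0.
move=> U F p q D s s0.
have bp := canRL (addrK _) (op_bdry_p D); have bq := canRL (addrK _) (op_bdry_q D).
rewrite (multiplier_form_eq D) bp bq /multiplier_form.
have l1 : 0 < l <= l by rewrite l_gt0 lexx.
have [-> ->] := op_im1 D l1; have [Lv Lphi] := (op_inH D).2.
set Y := U.1.1 l ^+ 2 + _; set E := interior_energy U + Y; set d := U.2.1 l ^+ 2 + _.
have X0 := interior_energy_ge0 U.
have Y1 : U.1.1 l ^+ 2 <= Y by rewrite /Y lerDl sqr_ge0.
have Y2 : U.1.2 l ^+ 2 <= Y by rewrite /Y lerDr sqr_ge0.
have d1 : U.2.1 l ^+ 2 <= d by rewrite /d lerDl sqr_ge0.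
have d2 : U.2.2 l ^+ 2 <= d by rewrite /d lerDr sqr_ge0.
have Y0 := le_trans (sqr_ge0 _) Y1.
have E0 : 0 <= E by exact: addr_ge0.
have YE : Y <= E by rewrite /E lerDr.
have ME : E <= M * E by rewrite ler_peMl.
have w1 : U.1.1 l ^+ 2 <= M * E by apply: le_trans ME; apply: le_trans YE.
have w2 : U.1.2 l ^+ 2 <= M * E by apply: le_trans ME; apply: le_trans YE.
have cs1 (f z : R -> R) (r iz : R) : 0 < r -> L2 l f -> L2 l z -> int (fun x => z x ^+ 2) <= iz ->
    r * int (fun x => f x ^+ 2) <= E -> r^-1 * iz <= M -> int (fun x => f x * z x) ^+ 2 <= M * E.
  move=> r0 Lf Lz zi fE zM; apply: le_trans (cauchy_schwarz_int Lf Lz) _.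
  have i0 := int_sq_ge0 l f; have z0 := int_sq_ge0 l z.
  apply: (@le_trans _ _ ((r^-1 * iz) * (r * int (fun x => f x ^+ 2)))).
    by rewrite mulrACA mulVf ?gt_eqF// mul1r mulrC ler_wpM2r.
  by apply: ler_pM => //; rewrite mulr_ge0 ?invr_ge0 ?(ltW r0)// (le_trans z0).
have EX : interior_energy U <= E by rewrite /E lerDl.
have hv : rho * int (fun x => U.2.1 x ^+ 2) <= E.
  apply: le_trans EX; rewrite /interior_energy -addrA lerDl.
  by rewrite !addr_ge0 ?mulr_ge0 ?int_sq_ge0 ?(ltW Irho_gt0).
have hphi : Irho * int (fun x => U.2.2 x ^+ 2) <= E.
  apply: le_trans EX; rewrite /interior_energy -addrA addrCA lerDl.
  by rewrite !addr_ge0 ?mulr_ge0 ?int_sq_ge0 ?(ltW rho_gt0).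
have a1 := cs1 _ _ _ iB rho_gt0 Lv LzB (lexx _) hv MB.
have a2 := cs1 _ _ _ iA rho_gt0 Lv LzA (lexx _) hv MA.
have a3 := cs1 _ _ _ jB Irho_gt0 Lphi LxB (lexx _) hphi NB.
have a4 := cs1 _ _ _ jA Irho_gt0 Lphi LxA (lexx _) hphi NA.
have y1 := young_le (- (alpha * gamma * zB l)) s0 M1 E0 w1 d1.
have y2 := young_le (- (alpha * delta * zA l)) s0 M1 E0 w2 d1.
have y3 := young_le (- (beta * gamma * xB l)) s0 M1 E0 w1 d2.
have y4 := young_le (- (beta * delta * xA l)) s0 M1 E0 w2 d2.
have y5 := young_le (rho * gamma) s0 M1 E0 a1 d1.
have y6 := young_le (rho * delta) s0 M1 E0 a2 d2.
have y7 := young_le (Irho * gamma) s0 M1 E0 a3 d1.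
have y8 := young_le (Irho * delta) s0 M1 E0 a4 d2.
have := pos (gamma * U.1.1 l) (delta * U.1.2 l).
have cm : c * Num.min (gamma ^+ 2) (delta ^+ 2) * Y <= c * ((gamma * U.1.1 l) ^+ 2 + (delta * U.1.2 l) ^+ 2).
  rewrite -mulrA ler_wpM2l ?(ltW c0)// /Y mulrDr !exprMn lerD// ler_wpM2r ?sqr_ge0//.
    by rewrite ge_min lexx.
  by rewrite ge_min lexx orbT.
move=> /(le_trans cm) {}cm.
rewrite (_ : _ + (_ + _ + _ + _) = - (gamma * U.1.1 l * (gamma * U.1.1 l * zB l + delta * U.1.2 l * zA l)
    + delta * U.1.2 l * (gamma * U.1.1 l * xB l + delta * U.1.2 l * xA l)
    + chi * ((gamma * U.1.1 l) ^+ 2 / gamma + (delta * U.1.2 l) ^+ 2 / delta))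
  + (- (alpha * gamma * zB l) * (U.1.1 l * U.2.1 l) + - (alpha * delta * zA l) * (U.1.2 l * U.2.1 l)
   + - (beta * gamma * xB l) * (U.1.1 l * U.2.2 l) + - (beta * delta * xA l) * (U.1.2 l * U.2.2 l)
   + rho * gamma * (int (fun x => U.2.1 x * zB x) * U.2.1 l)
   + rho * delta * (int (fun x => U.2.1 x * zA x) * U.2.2 l)
   + Irho * gamma * (int (fun x => U.2.2 x * xB x) * U.2.1 l)
   + Irho * delta * (int (fun x => U.2.2 x * xA x) * U.2.2 l))); last first.
  by field; rewrite (gt_eqF gamma_gt0) (gt_eqF delta_gt0).
apply: lerD; first by rewrite [leRHS]mulNr lerN2.
rewrite -[leRHS]mulrA; move: y1 y2 y3 y4 y5 y6 y7 y8; move: (M * _) => W y1 y2 y3 y4 y5 y6 y7 y8.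
by rewrite /cs !mulrDl; do 7 (apply: lerD => //).
Qed.

End MultiplierForm.

(** [M] is chosen so that [M * c2 = C1 + 1]: the second estimate pays for the traces [Y] left by the
    first and gains one more [Y]. Then [s] is so small that the error [M * C2 * s * (X + Y)] uses up
    at most half of the gain. *)
Lemma combine_decay (R : realFieldType) (c0 c2 C1 C2 : R) : 0 < c0 -> 0 < c2 -> 0 <= C1 -> 0 <= C2 ->
  exists M c C, [/\ 0 < M, 0 < c, 0 <= C & forall g1 g2 X Y Z, 0 <= X -> 0 <= Y ->
    g1 <= - c0 * X + C1 * (Y + Z) ->
    (forall s, 0 < s -> g2 <= - c2 * Y + C2 * (s * (X + Y) + Z / s)) ->
    g1 + M * g2 <= - c * (X + Y) + C * Z].
Proof.
move=> c00 c20 C10 C20; pose M := (C1 + 1) / c2; have M0 : 0 < M by rewrite divr_gt0// ltr_wpDl.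
pose c3 := Num.min c0 1 / 2.
have c30 : 0 < c3 by rewrite divr_gt0// lt_min c00 ltr01.
have c3c0 : 2 * c3 <= c0 by rewrite /c3 mulrC divfK// ge_min lexx.
have c31 : 2 * c3 <= 1 by rewrite /c3 mulrC divfK// ge_min lexx orbT.
have MC0 : 0 <= M * C2 by rewrite mulr_ge0// ltW.
pose s := c3 / (M * C2 + 1); have s0 : 0 < s by rewrite divr_gt0// ltr_wpDl.
have MCs : M * C2 * s <= c3.
  by rewrite /s mulrA ler_pdivrMr ?ltr_wpDl// [_ * c3]mulrC ler_pM2l// lerDl.
exists M, c3, (C1 + M * C2 / s); split => //; first by rewrite addr_ge0// divr_ge0// ltW.
move=> g1 g2 X Y Z X0 Y0 h1 /(_ s s0) h2; have {}h2 := ler_wpM2l (ltW M0) h2.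
have e : M * (- c2 * Y + C2 * (s * (X + Y) + Z / s)) =
  - ((C1 + 1) * Y) + (M * C2 * s * (X + Y) + M * C2 / s * Z).
  by rewrite /M; field; rewrite (gt_eqF c20) (gt_eqF s0).
rewrite e in h2; have h3 := ler_wpM2r (addr_ge0 X0 Y0) MCs.
have h4 := ler_wpM2r X0 c3c0; have h5 := ler_wpM2r Y0 c31.
rewrite mulrDl; move: h1 h2 h3 h4 h5; clear -R.
move: (M * C2 / s * Z) (M * C2 * s * (X + Y)) (M * g2) => x y z; lra.
Qed.

(** * The Lyapunov functional *)

Section Lyapunov.
Context (R : realType) (l rho Irho alpha beta gamma delta : R) (K EI : R -> R) (l_gt0 : 0 < l)
  (rho_gt0 : 0 < rho) (Irho_gt0 : 0 < Irho) (alpha_gt0 : 0 < alpha) (beta_gt0 : 0 < beta)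
  (gamma_gt0 : 0 < gamma) (delta_gt0 : 0 < delta) (K_A : classA l K) (EI_A : classA l EI)
  (degenerate : weakly_degenerate l K EI \/ strongly_degenerate l K EI)
  (small : mu_max l K EI + 2 * C_h l rho Irho K EI < 2).
Local Notation m := (mu_max l K EI).
Local Notation Ch := (C_h l rho Irho K EI).
Local Notation H := (inH l K EI).
Local Notation N := (sqnormH l K EI).
Local Notation int := (int l).
Local Notation op_data := (op_data l rho Irho alpha beta gamma delta K EI).
Local Notation interior_energy := (interior_energy l rho Irho K EI).
Local Notation BE := (energy_form l rho Irho gamma delta K EI).
Local Notation G1 := (dilation_form l rho Irho K EI).

Definition sq_traces (y : field2 R) : R := y.1 l ^+ 2 + y.2 l ^+ 2.

Lemma energy_form_sym U V : BE U V = BE V U.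
Proof.
have C (f g : R -> R) : int (fun x => f x * g x) = int (fun x => g x * f x).
  by apply: eq_int => x _; exact: mulrC.
by rewrite /energy_form !(C U.2.1) !(C U.2.2) (C (shear K U.1)) (C (bend EI U.1)) !(mulrC (U.1.1 l)) !(mulrC (U.1.2 l)).
Qed.

Lemma energy_form_le U : BE U U <= (1 + gamma + delta) * (interior_energy U + sq_traces U.1).
Proof.
rewrite energy_form_sq /sq_traces; have X0 := interior_energy_ge0 l K EI rho_gt0 Irho_gt0 U.
have -> : forall a b c d e f : R, a + b + c + d + e + f = (a + b + (c + d)) + e + f by move=> *; ring.
rewrite -/(interior_energy U); move: (interior_energy U) X0 => X X0.
have w0 := sqr_ge0 (U.1.1 l); have p0 := sqr_ge0 (U.1.2 l).
have g1 := ltW gamma_gt0; have g2 := ltW delta_gt0.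
have h1 := mulr_ge0 g1 X0; have h2 := mulr_ge0 g1 p0; have h3 := mulr_ge0 g2 X0; have h4 := mulr_ge0 g2 w0.
move: X0 w0 p0 h1 h2 h3 h4; move: (U.1.1 l ^+ 2) (U.1.2 l ^+ 2) => w p; lra.
Qed.

(** The feedback conditions express [p l] and [q l] by traces of displacement and velocity, so every
    boundary term is bounded by the squares of these. *)
Lemma dilation_form_decay : exists2 C, 0 <= C & forall U F p q, op_data U F p q ->
  G1 F U + G1 U F <= - ((2 - m - 2 * Ch) / 4) * interior_energy U + C * (sq_traces U.1 + sq_traces U.2).
Proof.
have l1 : 0 < l <= l by rewrite l_gt0 lexx.
have Kl := coef_gt0 K_A l1; have El := coef_gt0 EI_A l1.
have m0 := mu_max_ge0 EI l_gt0 K_A; have l0 := ltW l_gt0.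
pose A := 2 * (alpha ^+ 2 + gamma ^+ 2); pose B := 2 * (beta ^+ 2 + delta ^+ 2).
have A0 : 0 <= A by rewrite mulr_ge0// addr_ge0 ?sqr_ge0.
have B0 : 0 <= B by rewrite mulr_ge0// addr_ge0 ?sqr_ge0.
have l2 : 0 <= l / 2 by rewrite divr_ge0.
have m4 : 0 <= m / 4 by rewrite divr_ge0.
exists (l / 2 * (A / K l + B / EI l + rho + Irho) + m / 4 * (A + B + 1)).
  have AK := divr_ge0 A0 (ltW Kl); have BE' := divr_ge0 B0 (ltW El).
  have AB : 0 <= A + B + 1 by rewrite addr_ge0// addr_ge0.
  have S : 0 <= A / K l + B / EI l + rho + Irho.
    exact: (addr_ge0 (addr_ge0 (addr_ge0 AK BE') (ltW rho_gt0)) (ltW Irho_gt0)).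
  exact: (addr_ge0 (mulr_ge0 l2 S) (mulr_ge0 m4 AB)).
move=> U F p q D; have := dilation_form_op l_gt0 rho_gt0 Irho_gt0 K_A EI_A degenerate small D.
set X := interior_energy U; set c := (2 - m - 2 * Ch) / 4; move=> h.
rewrite mulNr [X in _ <= X]addrC lerBrDr; apply: le_trans h _.
have bp := canRL (addrK _) (op_bdry_p D); have bq := canRL (addrK _) (op_bdry_q D).
rewrite /sq_traces; set E := _ + (U.2.1 l ^+ 2 + _).
have e1 : U.1.1 l ^+ 2 + U.2.1 l ^+ 2 <= E.
  by have := sqr_ge0 (U.1.2 l); have := sqr_ge0 (U.2.2 l); rewrite /E; lra.
have e2 : U.1.2 l ^+ 2 + U.2.2 l ^+ 2 <= E.
  by have := sqr_ge0 (U.1.1 l); have := sqr_ge0 (U.2.1 l); rewrite /E; lra.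
have e3 : U.1.1 l ^+ 2 + U.1.2 l ^+ 2 <= E.
  by have := sqr_ge0 (U.2.1 l); have := sqr_ge0 (U.2.2 l); rewrite /E; lra.
have e4 : U.2.1 l ^+ 2 <= E by have := sqr_ge0 (U.1.1 l); lra.
have e5 : U.2.2 l ^+ 2 <= E by have := sqr_ge0 (U.1.2 l); lra.
have cs (a b v w : R) : (- a * v - b * w) ^+ 2 <= 2 * (a ^+ 2 + b ^+ 2) * (w ^+ 2 + v ^+ 2).
  by have := sqr_ge0 (a * w - b * v); have := sqr_ge0 (a * v - b * w); have := sqr_ge0 (a * v + b * w); have := sqr_ge0 (a * w); lra.
have p2 : p l ^+ 2 <= A * E by rewrite bp; apply: le_trans (cs _ _ _ _) _; exact: ler_wpM2l.
have q2 : q l ^+ 2 <= B * E by rewrite bq; apply: le_trans (cs _ _ _ _) _; exact: ler_wpM2l.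
have pw : p l * U.1.1 l + q l * U.1.2 l <= (A + B + 1) * E.
  have h1 := sqr_ge0 (p l - U.1.1 l); have h2 := sqr_ge0 (q l - U.1.2 l).
  have h3 := sqr_ge0 (p l); have h4 := sqr_ge0 (q l).
  have h5 := sqr_ge0 (U.1.1 l); have h6 := sqr_ge0 (U.1.2 l).
  by move: (p l) (q l) (U.1.1 l) (U.1.2 l) p2 q2 e3 h1 h2 h3 h4 h5 h6 => a b w z; lra.
rewrite mulrDl -[X in _ <= X + _]mulrA -[X in _ <= _ + X]mulrA.
apply: lerD; last exact: ler_wpM2l.
apply: ler_wpM2l => //; rewrite 3!mulrDl; apply: lerD; last by rewrite ler_wpM2l// ltW.
apply: lerD; last by rewrite ler_wpM2l// ltW.
by apply: lerD; rewrite [X in _ <= X]mulrAC ler_wpM2r// invr_ge0 ltW.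
Qed.

Lemma lyapunov_exists : exists (L : state R -> state R -> R) (k : R), [/\ bounded_form H N L, 0 < k,
  forall U, H U -> 2^-1 * BE U U <= L U U <= 3 / 2 * BE U U &
  forall U F p q, op_data U F p q -> L F U + L U F <= - k * L U U].
Proof.
have halve (g b : R) : `|g| <= 2^-1 * b -> 2^-1 * b <= b + g <= 3 / 2 * b.
  by rewrite ler_norml => /andP[h1 h2]; apply/andP; split; lra.
have dissipate (x y z b g : R) : z <= b -> y <= 2 * z -> g <= - x + y -> 2 * - b + g <= - x by lra.
have twothirds (x y : R) : x <= 3 / 2 * y -> 2 / 3 * x <= y by lra.
have m2 := mu_max_lt2 l_gt0 small.
have [chi [zA [zB [xA [xB mult]]]]] :=
  multiplier_exists l_gt0 gamma_gt0 delta_gt0 K_A EI_A degenerate.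
have [c2 [C2 [c20 C20 G2op]]] := multiplier_form_op alpha beta l_gt0 rho_gt0 Irho_gt0 gamma_gt0 delta_gt0 K_A EI_A mult.
have [C1 C10 G1op] := dilation_form_decay.
pose G2 := multiplier_form l rho Irho gamma delta zA zB xA xB.
pose c0 := (2 - m - 2 * Ch) / 4.
have c00 : 0 < c0 by rewrite divr_gt0//; have := small; lra.
have [M [c3 [C3 [M0 c30 C30 combine]]]] := combine_decay c00 c20 C10 C20.
pose G U V := G1 U V + M * G2 U V.
have bG : bounded_form H N G.
  have h1 := bounded_dilation_form rho Irho l_gt0 K_A EI_A m2.
  have h2 := bounded_formZ M (bounded_multiplier_form rho Irho l_gt0 K_A EI_A m2 mult).
  exact: (bounded_formD h1 h2).
have Gop U F p q : op_data U F p q ->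
    G F U + G U F <= - c3 * (interior_energy U + sq_traces U.1) + C3 * sq_traces U.2.
  move=> D; have X0 := interior_energy_ge0 l K EI rho_gt0 Irho_gt0 U.
  have Y0 : 0 <= sq_traces U.1 by rewrite addr_ge0 ?sqr_ge0.
  have := combine _ _ _ _ _ X0 Y0 (G1op U F p q D) (fun s => G2op U F p q D s).
  by move=> h; rewrite /G addrACA -mulrDr; exact: h.
have [Cn Cn0 Nle] := energy_form_coercive l_gt0 rho_gt0 Irho_gt0 gamma_gt0 delta_gt0 K_A EI_A m2.
have [Cg Cg0 Gle] := bounded_form_diag (sqnormH_ge0 K_A EI_A) bG.
pose ab := Num.min alpha beta; have ab0 : 0 < ab by rewrite lt_min alpha_gt0.
have CC0 : 0 <= Cg * Cn by rewrite mulr_ge0// ltW.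
(* The first entry lets the dissipation absorb the velocity traces left by [G]; the second keeps
   [e * G] below half of the energy form. *)
pose e := Num.min (2 * ab / (C3 + 1)) (1 / (2 * (Cg * Cn + 1))).
have C31 : 0 < C3 + 1 by rewrite ltr_wpDl.
have CC1 : 0 < 2 * (Cg * Cn + 1) by rewrite mulr_gt0// ltr_wpDl.
have e0 : 0 < e by rewrite lt_min !divr_gt0// mulr_gt0.
have eC3 : e * C3 <= 2 * ab.
  apply: (@le_trans _ _ (e * (C3 + 1))); first by rewrite ler_wpM2l ?(ltW e0)// lerDl.
  by rewrite -ler_pdivlMr// ge_min lexx.
have eCC : e * (Cg * Cn) <= 2^-1.
  have : e * (2 * (Cg * Cn + 1)) <= 1 by rewrite -ler_pdivlMr// ge_min lexx orbT.
  by have := ltW e0; lra.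
have C40 : 0 < 1 + gamma + delta by rewrite !addr_gt0.
(* The rate loses [1 + gamma + delta] through [energy_form_le] and [2 / 3] through the upper bound
   of the functional by [3 / 2] of the energy form. *)
exists (fun U V => BE U V + e * G U V), (2 / 3 * (e * c3 / (1 + gamma + delta))).
have k0 : 0 < e * c3 / (1 + gamma + delta) by rewrite divr_gt0// mulr_gt0.
have equiv U : H U -> 2^-1 * BE U U <= BE U U + e * G U U <= 3 / 2 * BE U U.
  move=> HU; have h1 : `|G U U| <= Cg * Cn * BE U U.
    by apply: le_trans (Gle U HU) _; rewrite -mulrA ler_wpM2l// Nle.
  have h2 := ler_wpM2l (ltW e0) h1; have B0 : 0 <= BE U U.
    by rewrite -(pmulr_rge0 _ Cn0); apply: le_trans (Nle U HU); exact: (sqnormH_ge0 K_A EI_A).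
  have h3 := ler_wpM2r B0 eCC; have h4 : `|e * G U U| <= 2^-1 * BE U U.
    by rewrite normrM gtr0_norm// (le_trans h2)// mulrA.
  exact: halve h4.
split => //.
- have bB := bounded_energy_form rho Irho gamma delta l_gt0 K_A EI_A m2.
  exact: (bounded_formD bB (bounded_formZ e bG)).
- by rewrite mulr_gt0// divr_gt0.
- move=> U F p q D; have h1 := Gop U F p q D.
  have /andP[_ h2] := equiv U (op_inH D).
  have := energy_form_op l_gt0 rho_gt0 Irho_gt0 K_A EI_A degenerate small D.
  rewrite (energy_form_sym F U) => ->.
  have h3 := energy_form_le U; have Z0 : 0 <= sq_traces U.2 by rewrite addr_ge0 ?sqr_ge0.
  have h4 : ab * sq_traces U.2 <= alpha * U.2.1 l ^+ 2 + beta * U.2.2 l ^+ 2.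
    by rewrite mulrDr lerD// ler_wpM2r ?sqr_ge0// ge_min lexx ?orbT.
  have h5 := ler_wpM2r Z0 eC3; have h6 := ler_wpM2l (ltW e0) h1.
  have h7 := ler_wpM2l (ltW k0) h3; have h8 := ler_wpM2l (ltW k0) h2.
  rewrite (_ : _ * (_ * (_ + sq_traces U.1)) = e * c3 * (interior_energy U + sq_traces U.1)) in h7; last first.
    by rewrite mulrA divfK// gt_eqF.
  have {}h6 : e * (G F U + G U F) <= - (e * c3 * (interior_energy U + sq_traces U.1)) + e * C3 * sq_traces U.2.
    by apply: le_trans h6 _; rewrite mulrDr mulrA mulrN mulNr !mulrA.
  have fin1 : 2 * (- alpha * U.2.1 l ^+ 2 - beta * U.2.2 l ^+ 2) + e * (G F U + G U F) <=
      - (e * c3 * (interior_energy U + sq_traces U.1)).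
    rewrite mulNr -opprD; by apply: (dissipate _ _ _ _ _ h4 _ h6); rewrite mulrA.
  apply: le_trans (_ : _ <= 2 * (- alpha * U.2.1 l ^+ 2 - beta * U.2.2 l ^+ 2) + e * (G F U + G U F)) _.
    by rewrite le_eqVlt; apply/orP; left; apply/eqP; ring.
  apply: le_trans fin1 _; rewrite [X in _ <= X]mulNr lerN2; apply: le_trans h7.
  by rewrite -[X in X <= _]mulrA; apply: twothirds; rewrite mulrCA in h8.
Qed.

End Lyapunov.

Lemma feature_sq_le (R : realType) (T : lmodType R) (H : T -> Prop) (N : T -> R) (l : R)
  (H_lin : forall a b u v, H u -> H v -> H (a *: u + b *: v)) f a b u v :
  feature H N l f -> H u -> H v ->
  int l (fun x => f (a *: u + b *: v) x ^+ 2) <=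
  2 * a ^+ 2 * int l (fun x => f u x ^+ 2) + 2 * b ^+ 2 * int l (fun x => f v x ^+ 2).
Proof.
move=> [Lf lf _] Hu Hv; have Lu := L2_sq (Lf u Hu); have Lv := L2_sq (Lf v Hv).
have [L1r <-] := has_intD (has_intZ (2 * a ^+ 2) (has_int_L1 Lu)) (has_intZ (2 * b ^+ 2) (has_int_L1 Lv)).
apply: le_int => //; first exact: L2_sq (Lf _ (H_lin a b u v Hu Hv)).
apply: ae_onS (lf a b u v Hu Hv) => x _ ->.
by have := sqr_ge0 (a * f u x - b * f v x); move: (f u x) (f v x) => y z; lra.
Qed.

(** * From curves in the domain to mild solutions *)

Section Semigroup.
Context (R : realType) (l rho Irho alpha beta gamma delta : R) (K EI : R -> R) (l_gt0 : 0 < l)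
  (K_A : classA l K) (EI_A : classA l EI).
Local Notation H := (inH l K EI).
Local Notation N := (sqnormH l K EI).
Local Notation op := (timoshenko_op l rho Irho alpha beta gamma delta K EI).

Lemma sqnormH_lin_le a b (U V : state R) : H U -> H V ->
  N (a *: U + b *: V) <= 2 * a ^+ 2 * N U + 2 * b ^+ 2 * N V.
Proof.
move=> HU HV; have lin := @inH_lin R l K EI l_gt0 K_A EI_A.
have [w psi S T [v phi]] := feature_basic l_gt0 K_A EI_A.
have HUV := lin a b U V HU HV; rewrite !(sqnormH_split K_A EI_A)//.
have h1 := feature_sq_le lin a b w HU HV; have h2 := feature_sq_le lin a b psi HU HV.
have h3 := feature_sq_le lin a b S HU HV; have h4 := feature_sq_le lin a b T HU HV.
have h5 := feature_sq_le lin a b v HU HV; have h6 := feature_sq_le lin a b phi HU HV.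
have e (A B x1 x2 x3 x4 x5 x6 y1 y2 y3 y4 y5 y6 : R) :
    A * (x1 + x2 + x3 + x4 + x5 + x6) + B * (y1 + y2 + y3 + y4 + y5 + y6) =
    A * x1 + B * y1 + (A * x2 + B * y2) + (A * x3 + B * y3) + (A * x4 + B * y4)
    + (A * x5 + B * y5) + (A * x6 + B * y6) by ring.
rewrite e; exact: (lerD (lerD (lerD (lerD (lerD h1 h2) h3) h4) h5) h6).
Qed.

Lemma H1_lin (a b : R) (f g : R -> R) : H1 l f -> H1 l g -> H1 l (fun x => a * f x + b * g x).
Proof.
move=> [acf Lf Lf'] [acg Lg Lg']; split; [exact: loc_ac_lin|exact: L2_lin|].
apply: L2_ae (L2_lin a b Lf' Lg') _.
  by apply: loc_ac_measurable_derive1 => //; exact: loc_ac_lin.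
by apply: ae_onS (derive1_lin l_gt0 a b acf acg) => x _ H; rewrite H.
Qed.

Lemma field_lin_pair (a b : R) (f g f' g' : R -> R^o) :
  a *: ((f, g) : field2 R) + b *: ((f', g') : field2 R) =
  ((fun x => a * f x + b * f' x), (fun x => a * g x + b * g' x)).
Proof. by []. Qed.

Lemma state_lin_pair (a b : R) (y z y' z' : field2 R) :
  a *: ((y, z) : state R) + b *: ((y', z') : state R) = (a *: y + b *: y', a *: z + b *: z').
Proof. by []. Qed.

Lemma op_lin a b (U F V G : state R) : op U F -> op V G -> op (a *: U + b *: V) (a *: F + b *: G).
Proof.
case: U V F G => [[w psi] [v phi]] [[w' psi'] [v' phi']] [[F1 F2] [F3 F4]] [[G1 G2] [G3 G4]].
move=> [VU [VU2 [p [q [[Hp Hq] [Ep Eq] [bp bq] pq0 EF]]]]].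
move=> [VV [VV2 [p' [q' [[Hp' Hq'] [Ep' Eq'] [bp' bq'] pq0' EG]]]]].
rewrite /= in VU VU2 VV VV2 Ep Eq bp bq EF Ep' Eq' bp' bq' EG.
have [_ [ac1 ac2] _ _] := VU.1; have [_ [ac3 ac4] _ _] := VV.1; rewrite /= in ac1 ac2 ac3 ac4.
have [acp _ _] := Hp; have [acq _ _] := Hq; have [acp' _ _] := Hp'; have [acq' _ _] := Hq'.
have V1 := VR_lin l_gt0 K_A EI_A a b VU VV; have V2 := VR_lin l_gt0 K_A EI_A a b VU2 VV2.
rewrite field_lin_pair in V1; rewrite field_lin_pair in V2.
rewrite !state_lin_pair !field_lin_pair.
split; first exact: V1; split; first exact: V2.
exists (fun x => a * p x + b * p' x), (fun x => a * q x + b * q' x); split => /=.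
- by split; exact: H1_lin.
- split.
    apply: ae_onS2 (ae_onI Ep Ep') (derive1_lin l_gt0 a b ac1 ac3) => x _ [E E'] ->.
    by rewrite E E'; ring.
  apply: ae_onS2 (ae_onI Eq Eq') (derive1_lin l_gt0 a b ac2 ac4) => x _ [E E'] ->.
  by rewrite E E'; ring.
- split.
    by rewrite (canRL (addrK _) bp) (canRL (addrK _) bp'); ring.
  by rewrite (canRL (addrK _) bq) (canRL (addrK _) bq'); ring.
- move=> s; have [p0 q0] := pq0 s; have [p0' q0'] := pq0' s.
  by split; exact: cvg0_lin.
- apply: ae_onS2 (ae_onI EF EG) (ae_onI (derive1_lin l_gt0 a b acp acp') (derive1_lin l_gt0 a b acq acq')).
  move=> x _ [[-> -> -> ->] [-> -> -> ->]] [-> ->]; split => //.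
    by rewrite mulrDl !mulrA.
  by rewrite !mulrA -mulrDl; congr (_ / _); ring.
Qed.

(** The initial value [U 0] cancels in the difference. As the quotient of [U] is also the time
    derivative of that of [J], the latter solves the evolution equation inside the domain. *)
Lemma forward_quotient_op (U J : R -> state R) h t : (forall t, 0 <= t -> op (J t) (U t - U 0)) -> 0 <= h -> 0 <= t ->
  op (forward_quotient J h t) (forward_quotient U h t).
Proof.
move=> opJ h0 t0; have -> : forward_quotient U h t =
    h^-1 *: (U (t + h) - U 0) + (- h^-1) *: (U t - U 0).
  by rewrite /forward_quotient !scalerBr !scaleNr opprK addrACA addNr addr0.
by apply: op_lin; apply: opJ => //; exact: addr_ge0.
Qed.

End Semigroup.

Section Decay.
Context (R : realType) (l rho Irho alpha beta gamma delta : R) (K EI : R -> R) (l_gt0 : 0 < l)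
  (rho_gt0 : 0 < rho) (Irho_gt0 : 0 < Irho) (alpha_gt0 : 0 < alpha) (beta_gt0 : 0 < beta)
  (gamma_gt0 : 0 < gamma) (delta_gt0 : 0 < delta) (K_A : classA l K) (EI_A : classA l EI)
  (degenerate : weakly_degenerate l K EI \/ strongly_degenerate l K EI)
  (small : mu_max l K EI + 2 * C_h l rho Irho K EI < 2).
Local Notation H := (inH l K EI).
Local Notation N := (sqnormH l K EI).
Local Notation BE := (energy_form l rho Irho gamma delta K EI).

Lemma mild_solution_decay : exists2 k, 0 < k & forall U,
  mild_solution l rho Irho alpha beta gamma delta K EI U ->
  forall T, 0 <= T -> BE (U T) (U T) <= 3 * BE (U 0) (U 0) * expR (- k * T).
Proof.
(* The factor 3 is the quotient of the equivalence constants [3 / 2] and [1 / 2] of the Lyapunov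
   functional. *)
have double (a b e : R) : 2^-1 * a <= 3 / 2 * b * e -> a <= 3 * b * e by lra.
have m2 := mu_max_lt2 l_gt0 small.
have lin := @inH_lin R l K EI l_gt0 K_A EI_A; have pos := @sqnormH_ge0 R l K EI K_A EI_A.
have [L [k [bL k0 equiv Lop]]] := lyapunov_exists l_gt0 rho_gt0 Irho_gt0 alpha_gt0 beta_gt0
  gamma_gt0 delta_gt0 K_A EI_A degenerate small.
have bB := bounded_energy_form rho Irho gamma delta l_gt0 K_A EI_A m2.
exists k => // U [HU _ [J [HJ _ dJ opJ]]] T T0.
pose V := forward_quotient J; pose W := forward_quotient U.
have HV h t : 0 <= h -> 0 <= t -> H (V h t) by exact: (forward_quotient_inH lin HJ).
have HW h t : 0 <= h -> 0 <= t -> H (W h t) by exact: (forward_quotient_inH lin HU).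
have key h : 0 < h -> BE (V h T) (V h T) <= 3 * BE (V h 0) (V h 0) * expR (- k * T).
  move=> h0; have hh := ltW h0.
  have dV := forward_quotient_derivative lin pos (sqnormH_lin_le l_gt0 K_A EI_A) HU HJ dJ h0.
  have G : L (V h T) (V h T) <= L (V h 0) (V h 0) * expR (- k * T).
    apply: (@gronwall R (fun t => L (V h t) (V h t))
      (fun t => L (W h t) (V h t) + L (V h t) (W h t)) k T T0).
      by move=> t t0; apply: (bounded_form_derivative lin pos bL _ _ dV t0) => [s|]; [exact: HV|exact: HW].
    move=> t t0.
    have [p [q D]] := op_dataP (forward_quotient_op l_gt0 K_A EI_A opJ hh t0) (HW h t hh t0).
    exact: Lop D.
  have /andP[h1 _] := equiv _ (HV h T hh T0); have /andP[_ h2] := equiv _ (HV h 0 hh (lexx 0)).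
  have h3 := ler_wpM2r (expR_ge0 (- k * T)) h2.
  exact: double (le_trans h1 (le_trans G h3)).
have lim t : 0 <= t -> BE (V h t) (V h t) @[h --> 0^'+] --> BE (U t) (U t).
  move=> t0; apply: (bounded_form_cvg lin pos bB (HU t t0)).
    by near=> h; apply: HV => //; apply: ltW; near: h; exact: nbhs_right_gt.
  exact: forward_quotient_cvg dJ _ t0.
have l1 := lim T T0; have l2 := lim 0 (lexx 0).
have l3 : 3 * BE (V h 0) (V h 0) * expR (- k * T) @[h --> 0^'+] --> 3 * BE (U 0) (U 0) * expR (- k * T).
  by apply: cvgM; [apply: cvgM => //; exact: cvg_cst|exact: cvg_cst].
apply: (ler_cvg_to l1 l3); near=> h; apply: key; near: h; exact: nbhs_right_gt.
Unshelve. all: by end_near. Qed.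

Lemma energyE (w psi wt psit : R -> R -> R) t : H ((w t, psi t), (wt t, psit t)) ->
  energy l rho Irho gamma delta K EI w psi wt psit t =
  2^-1 * BE ((w t, psi t), (wt t, psit t)) ((w t, psi t), (wt t, psit t)).
Proof.
set U := (_, _) => HU; rewrite energy_form_sq /energy; congr (_ * (_ + _ + _)).
have [[[_ _ S T] _] [Lv Lphi]] := HU.
have S' : L2 l (shear K U.1) := S; have T' : L2 l (bend EI U.1) := T.
have [_ <-] := has_intD (has_intD (has_intD (has_intZ rho (has_int_sq Lv)) (has_intZ Irho (has_int_sq Lphi)))
  (has_int_sq S')) (has_int_sq T').
apply: eq_int => x xI; have x1 : 0 < x <= l by case/andP: xI => -> /ltW.
by rewrite /shear /bend !exprMn !sqr_sqrtr ?ltW ?(coef_gt0 K_A) ?(coef_gt0 EI_A).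
Qed.

Lemma energy_form_ge0 (U : state R) : 0 <= BE U U.
Proof.
rewrite energy_form_sq; have r0 := ltW rho_gt0; have i0 := ltW Irho_gt0.
have g0 := ltW gamma_gt0; have d0 := ltW delta_gt0.
by repeat first [exact: int_sq_ge0|assumption|exact: sqr_ge0|apply: addr_ge0|apply: mulr_ge0].
Qed.

Lemma C_N_ge0 : 0 <= C_N l gamma delta K EI.
Proof.
rewrite /C_N !le_max; apply/orP; left; apply/orP; right.
by rewrite divr_ge0 ?mulr_ge0 ?(ltW l_gt0) ?(ltW gamma_gt0).
Qed.

Lemma C_two_ge0 : 0 <= C_two l rho Irho alpha beta gamma delta K EI.
Proof.
have r0 := ltW rho_gt0; have a0 := ltW alpha_gt0.
rewrite /C_two !mulr_ge0 ?C_N_ge0// le_max ?r0// divr_ge0//.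
by rewrite exprn_ge0// ltW.
Qed.

Lemma C_three_ge0 : 0 <= C_three rho Irho gamma delta.
Proof.
have r0 := ltW rho_gt0; have g0 := exprn_ge0 3 (ltW gamma_gt0).
by rewrite /C_three addr_ge0// !mulr_ge0// le_max ?r0// divr_ge0.
Qed.

Lemma C_F_ge0 : 0 <= C_F l rho Irho K EI.
Proof.
rewrite /C_F; apply: mulr_ge0; last by rewrite le_max sqrtr_ge0.
by case: ifP => _; [exact: ltW|case: ifP => _; exact: powR_ge0].
Qed.

Lemma C_NL_ge0 : 0 <= C_NL l rho Irho gamma delta K EI.
Proof. by rewrite /C_NL mulr_ge0 ?sqrtr_ge0// le_max sqrtr_ge0. Qed.

End Decay.

(** * Choice of the constants and the exponential estimate *)

Theorem theorem6p3 (R : realType)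
    (l rho Irho alpha beta gamma delta : R) (K EI : R -> R)
    (l_gt0 : 0 < l) (rho_gt0 : 0 < rho) (Irho_gt0 : 0 < Irho)
    (alpha_gt0 : 0 < alpha) (beta_gt0 : 0 < beta)
    (gamma_gt0 : 0 < gamma) (delta_gt0 : 0 < delta)
    (K_A : classA l K) (EI_A : classA l EI)
    (degenerate : weakly_degenerate l K EI \/ strongly_degenerate l K EI)
    (small : mu_max l K EI + 2 * C_h l rho Irho K EI < 2) :
  exists eta11 eta12 eta21 eta22 : R,
    [/\ 0 < eta11, 0 < eta12, 0 < eta21 & 0 < eta22] /\
    let mu := mu_max l K EI in
    let Ch := C_h l rho Irho K EI in
    let omega :=
      (2 - mu - Ch)
      / (2 * Num.max eta21 eta22
         * (1 + 2 * Num.max (alpha / gamma ^+ 3) (beta / delta ^+ 3))) in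
    let Ctilde :=
      1 / omega * Num.max eta21 eta22
        * (1 + C_two l rho Irho alpha beta gamma delta K EI)
      + 2 * Num.max eta21 eta22 * C_three rho Irho gamma delta
      + Num.max eta11 eta12
      + 2 * (2 * C_F l rho Irho K EI
             + mu / 2 * C_NL l rho Irho gamma delta K EI) in
    let kappa := (2 - mu - Ch) / (2 * Ctilde) in
    forall w psi wt psit : R -> R -> R,
      finite_energy_solution l rho Irho alpha beta gamma delta K EI
        w psi wt psit ->
      forall t : R, kappa^-1 <= t ->
        energy l rho Irho gamma delta K EI w psi wt psit t
        <= energy l rho Irho gamma delta K EI w psi wt psit 0
           * expR (1 - kappa * t).

Proof.
have [k k0 decay] := mild_solution_decay l_gt0 rho_gt0 Irho_gt0 alpha_gt0 beta_gt0
  gamma_gt0 delta_gt0 K_A EI_A degenerate small.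
have Ch0 : 0 <= C_h l rho Irho K EI by exact: C_h_ge0.
have mu0 : 0 <= mu_max l K EI by exact: mu_max_ge0.
have gap : 0 < 2 - mu_max l K EI - C_h l rho Irho K EI by move: Ch0 small; lra.
(* With [eta11 = eta12 = X] one gets [Ctilde >= X], the other summands being nonnegative, and hence
   [2 * kappa <= k]. Since [omega] involves only [eta21] and [eta22], set to 1, the choice is not
   circular. *)
pose X := (2 - mu_max l K EI - C_h l rho Irho K EI) / k.
have X0 : 0 < X by exact: divr_gt0.
exists X, X, 1, 1; split => // mu Ch omega Ctilde kappa w psi wt psit sol t.
have omega0 : 0 < omega.
  apply: divr_gt0 => //; rewrite maxxx mulr1 mulr_gt0// ltr_pwDl// mulr_ge0// le_max.
  by rewrite divr_ge0 ?(ltW alpha_gt0)// exprn_ge0// ltW.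
have CX : X <= Ctilde.
  have C1 : 0 <= 1 / omega * Num.max 1 1 * (1 + C_two l rho Irho alpha beta gamma delta K EI).
    rewrite maxxx mulr1; apply: mulr_ge0; first exact: divr_ge0 ler01 (ltW omega0).
    by apply: addr_ge0 => //; exact: C_two_ge0.
  have C2 : 0 <= 2 * Num.max 1 1 * C_three rho Irho gamma delta.
    by rewrite maxxx mulr1 mulr_ge0// C_three_ge0.
  have C3 : 0 <= 2 * (2 * C_F l rho Irho K EI + mu / 2 * C_NL l rho Irho gamma delta K EI).
    apply: mulr_ge0 => //; apply: addr_ge0; first by rewrite mulr_ge0// C_F_ge0.
    by rewrite mulr_ge0 ?divr_ge0// C_NL_ge0.
  rewrite /Ctilde [Num.max X X]maxxx -[leLHS]addr0; apply: lerD => //.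
  by rewrite lerDr; exact: addr_ge0.
have Ct0 : 0 < 2 * Ctilde by rewrite mulr_gt0// (lt_le_trans X0).
have kappa0 : 0 < kappa by exact: divr_gt0.
have kk : 2 * kappa <= k.
  have Ct1 := lt_le_trans X0 CX; have -> : 2 * kappa = (2 - mu - Ch) / Ctilde.
    by rewrite /kappa invfM mulrCA [2 * _]mulrA divff ?mul1r.
  by rewrite ler_pdivrMr// mulrC -ler_pdivrMr.
move=> kt; have t0 : 0 < t by apply: lt_le_trans kt; rewrite invr_gt0.
have [_ _ _ _ sol'] := sol; have [HU _ _] := sol'.
have Et := energyE rho Irho gamma delta K_A EI_A (HU t (ltW t0)).
have E0 := energyE rho Irho gamma delta K_A EI_A (HU 0 (lexx 0)).
rewrite Et E0.
have B0 := energy_form_ge0 l K EI rho_gt0 Irho_gt0 gamma_gt0 delta_gt0 ((w 0, psi 0), (wt 0, psit 0)).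
rewrite -[X in _ <= X]mulrA; apply: ler_wpM2l; first by rewrite invr_ge0.
apply: le_trans (decay _ sol' t (ltW t0)) _.
rewrite [3 * _]mulrC -mulrA; apply: ler_wpM2l => //.
(* The factor 3 is paid by the surplus rate: the exponent becomes at most [2 - 2 * kappa * t], and
   [kappa * t >= 1] brings it below [1 - kappa * t]. *)
have e3 : 3 <= expR 2 :> R by apply: le_trans (expR_ge1Dx 2); rewrite -natr1 addrC.
apply: le_trans (_ : _ <= expR 2 * expR (- k * t)) _; first by rewrite ler_wpM2r ?expR_ge0.
rewrite -expRD ler_expR.
have kt1 : 1 <= kappa * t by rewrite -ler_pdivrMl// mulr1.
have := ler_wpM2r (ltW t0) kk; rewrite mulNr -mulrA; move: (k * t) (kappa * t) kt1 => x y; lra.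
Qed.
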